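(* For every prime $p$ with $17\le p<1000$, let $N_p$ be the number of $\overline{\mathbb{F}_p}$-isomorphism classes of superspecial hyperelliptic curves of the form $H_{a,b}: y^2=x^{10}+x^7+ax^4+bx$ with $a,b\in\mathbb{F}_{p^2}$. If $p\equiv 1\pmod 3$, then $N_p=0$. If $p\equiv 2\pmod 3$, then $N_p$ is given by the following list of pairs $p:N_p$. $17:1$, $23:2$, $29:1$, $41:4$, $47:5$, $53:4$, $59:6$, $71:9$, $83:8$, $89:7$, $101:8$, $107:4$, $113:14$, $131:18$, $137:12$, $149:18$, $167:26$, $173:22$, $179:17$, $191:32$, $197:21$, $227:29$, $233:30$, $239:36$, $251:28$, $257:28$, $263:58$, $269:32$, $281:34$, $293:29$, $311:62$, $317:21$, $347:61$, $353:25$, $359:55$, $383:72$, $389:49$, $401:44$, $419:61$, $431:72$, $443:50$, $449:38$, $461:54$, $467:73$, $479:82$, $491:79$, $503:93$, $509:59$, $521:70$, $557:67$, $563:75$, $569:78$, $587:89$, $593:94$, $599:108$, $617:60$, $641:84$, $647:106$, $653:54$, $659:89$, $677:59$, $683:102$, $701:68$, $719:112$, $743:124$, $761:129$, $773:106$, $797:90$, $809:94$, $821:107$, $827:120$, $839:119$, $857:121$, $863:138$, $881:112$, $887:156$, $911:182$, $929:89$, $941:126$, $947:95$, $953:109$, $971:122$, $977:120$, $983:115$. In particular, for each prime $17\le p<1000$ with $p\equiv 2\pmod 3$ (resp. $p\equiv 1\pmod 3$), there exists (resp. does not exist) $(a,b)\in\mathbb{F}_{p^2}^2$ such that $H_{a,b}$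 is a superspecial hyperelliptic curve.
   Context: $H_{a,b}$ is a hyperelliptic curve (of genus $4$) when the polynomial $x^{10}+x^7+ax^4+bx$ is separable; it then denotes the desingularization of the projective closure of the affine curve. A curve is superspecial if its Jacobian variety is isomorphic (over the algebraic closure) to a product of supersingular elliptic curves. Equivalently, for a genus-$g$ hyperelliptic curve $y^2=f(x)$ in odd characteristic $p$: the coefficient of $x^{ip-j}$ in $f(x)^{(p-1)/2}$ is $0$ for all $1\le i,j\le g$. *)

(* Defs.v *)
From mathcomp Require Import all_boot all_order all_algebra all_field.
From mathcomp Require Import mpoly.
From mathcomp Require Import boolp.

Set Implicit Arguments.
Unset Strict Implicit.
Unset Printing Implicit Defensive.

Import GRing.Theory.
Local Open Scope ring_scope.

(* The nonsingular projective model of y^2 = f(x), where f is separable of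
   degree 2g+1 or 2g+2: the curve Y^2 = F(X, Z) in the weighted projective
   plane P(1, 1, g+1) with coordinates [X : Z : Y], where
   F = Z^(2g+2) f(X/Z). For f = 'X^10 + ..., it has two points over x = oo. *)
Section HyperellipticCurves.

Variable K : closedFieldType.
Variable g : nat.
Implicit Types (f : {poly K}) (P Q : 3.-tuple K).

Definition iX : 'I_3 := @Ordinal 3 0 isT.
Definition iZ : 'I_3 := @Ordinal 3 1 isT.
Definition iY : 'I_3 := @Ordinal 3 2 isT.

Definition weight (i : 'I_3) : nat := if i == iY then g.+1 else 1%N.

Definition same_point P Q : Prop :=
  exists2 c : K, c != 0 & forall i, tnth Q i = c ^+ weight i * tnth P i.

Definition homogenization f (x z : K) : K :=
  \sum_(i < (2 * g + 3)%N) f`_i * x ^+ i * z ^+ (2 * g + 2 - i).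

Definition on_curve f P : Prop :=
  (exists i, tnth P i != 0) /\
  tnth P iY ^+ 2 = homogenization f (tnth P iX) (tnth P iZ).

Definition weighted_homog (d : nat) (A : {mpoly K[3]}) : Prop :=
  forall m, m \in msupp A -> (\sum_(i < 3) weight i * m i)%N = d.

(* Morphisms of varieties, on K-points (K is algebraically closed).
   Around each point, phi is given by weighted homogeneous polynomials
   [A : B : C] of degrees d, d, (g+1)d, with A and B not both zero there.
   Multiplying A, B, C by D, D, D^(g+1) shrinks the locus where A or B is
   nonzero to any smaller basic open set D <> 0, so this locus may serve as
   the neighbourhood. By homogeneity phi is compatible with [same_point]. *)
Definition curve_morphism f f' (phi : 3.-tuple K -> 3.-tuple K) : Prop :=
  (forall P, on_curve f P -> on_curve f' (phi P)) /\
  (forall P, on_curve f P ->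
     exists (d : nat) (A B C : {mpoly K[3]}),
       [/\ weighted_homog d A, weighted_homog d B,
           weighted_homog (g.+1 * d) C,
           A.@[tnth P] != 0 \/ B.@[tnth P] != 0
         & forall Q, on_curve f Q ->
             A.@[tnth Q] != 0 \/ B.@[tnth Q] != 0 ->
             same_point (phi Q)
               [tuple A.@[tnth Q]; B.@[tnth Q]; C.@[tnth Q]]]).

Definition curve_isomorphic f f' : Prop :=
  exists phi psi : 3.-tuple K -> 3.-tuple K,
    [/\ curve_morphism f f' phi, curve_morphism f' f psi,
        forall P, on_curve f P -> same_point P (psi (phi P))
      & forall Q, on_curve f' Q -> same_point Q (phi (psi Q))].

(* Superspeciality of y^2 = f(x) in odd characteristic p, as the vanishing of
   the g x g Cartier-Manin matrix. *)
Definition superspecial (p : nat) f : Prop :=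
  forall i j : nat, (1 <= i <= g)%N -> (1 <= j <= g)%N ->
    (f ^+ ((p - 1) %/ 2))`_(i * p - j) = 0.

End HyperellipticCurves.

Definition Hpoly (R : nzRingType) (a b : R) : {poly R} :=
  'X^10 + 'X^7 + a *: 'X^4 + b *: 'X.

Section Counting.

Variables (p : nat) (F : finFieldType) (K : closedFieldType).
Variable iota : {rmorphism F -> K}.

Definition HK (ab : F * F) : {poly K} := Hpoly (iota ab.1) (iota ab.2).

Definition superspecial_hyperelliptic (ab : F * F) : Prop :=
  separable_poly (HK ab) /\ superspecial 4 p (HK ab).

Definition superspecial_params : {set F * F} :=
  [set ab | `[< superspecial_hyperelliptic ab >]].

Definition iso_class (ab : F * F) : {set F * F} :=
  [set cd in superspecial_params | `[< curve_isomorphic 4 (HK ab) (HK cd) >]].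

Definition num_iso_classes : nat :=
  #|[set iso_class ab | ab in superspecial_params]|.

End Counting.

Definition class_numbers : seq (nat * nat) :=
  [::
    (17, 1); (23, 2); (29, 1); (41, 4); (47, 5); (53, 4); (59, 6); (71, 9);
    (83, 8); (89, 7); (101, 8); (107, 4); (113, 14); (131, 18); (137, 12);
    (149, 18); (167, 26); (173, 22); (179, 17); (191, 32); (197, 21);
    (227, 29); (233, 30); (239, 36); (251, 28); (257, 28); (263, 58);
    (269, 32); (281, 34); (293, 29); (311, 62); (317, 21); (347, 61);
    (353, 25); (359, 55); (383, 72); (389, 49); (401, 44); (419, 61);
    (431, 72); (443, 50); (449, 38); (461, 54); (467, 73); (479, 82);
    (491, 79); (503, 93); (509, 59); (521, 70); (557, 67); (563, 75);
    (569, 78); (587, 89); (593, 94); (599, 108); (617, 60); (641, 84);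
    (647, 106); (653, 54); (659, 89); (677, 59); (683, 102); (701, 68);
    (719, 112); (743, 124); (761, 129); (773, 106); (797, 90); (809, 94);
    (821, 107); (827, 120); (839, 119); (857, 121); (863, 138); (881, 112);
    (887, 156); (911, 182); (929, 89); (941, 126); (947, 95); (953, 109);
    (971, 122); (977, 120); (983, 115) ]%N.

(* Main.v *)
(** With R(s) = 1 + s + a s^2 + b s^3, the polynomial f = x^10 + x^7 + a x^4 + b x is
x^10 R(x^-3), so the Cartier-Manin entries are coefficients of R^m, m = (p-1)/2.
The operator y |-> R y' - m R' y kills R^m, hence sends a
truncation of R^m at two consecutive vanishing coefficients to a monomial. For p = 6k+1
superspeciality provides two such truncations, and comparing them is contradictory. For
p = 6k+5 the two vanishing coefficients of index 4k+2 and 4k+3 imply those of index 2k+1 and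
8k+6, leaving only these two and the one of index 6k+4.

Up to scaling, R is the expansion of a cubic c(x) = x (x^2 + u x + v) at a point x0, and (a, b)
is determined by (u, v, x0). The coefficient of index 6k+4 vanishes exactly when y^2 = c(x) is
supersingular, and those of index 4k+2 and 4k+3 vanish exactly when x0 is a double root of a
divided derivative G of c^m. The supersingular curves with a marked 2-torsion point correspond
to the roots of an explicit polynomial of degree floor(m/2) in u^2/v, so that a list of floor(m/2)
of them is complete, and gcd(G, G', B), where B gives the coefficient of index 8k+6, bounds the
set of the x0. This leaves a finite verification for each p.

Distinct (a, b) give non-isomorphic curves. The x-coordinate of an isomorphism is a rational
function of x, hence a Moebius map sending the ten roots of f to those of f'. Both
sets of roots are invariant under multiplication by a cube root of unity, which generates a
Sylow 3-subgroup of the Moebius symmetries because a Moebius map commuting with it is a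
multiplication. By Sylow's theorem the map may be taken to be x |-> u x, and comparing
coefficients gives u^3 = 1 and f = f'. *)

From Stdlib Require Import NArith.
From HB Require Import structures.
Require Import Defs.
From mathcomp Require Import all_boot all_order all_fingroup all_algebra all_solvable all_field.
From mathcomp Require Import zify ring.
From mathcomp Require Import mpoly.
From mathcomp Require Import boolp.

Set Implicit Arguments.
Unset Strict Implicit.
Unset Printing Implicit Defensive.

Import GRing.Theory.

(** Testing every pair (a, b) over F_(p^2) would mean p^4 Cartier-Manin matrices. The elliptic
    curves reduce this to about p/4 moduli and, for each curve, one gcd of polynomials of degree
    below p/2. That the list of curves is complete is a count against a degree and not a search: a
    certificate only has to exhibit enough distinct supersingular moduli. Moving the marked
    2-torsion point to 0 leaves only scaling, for which u^2/v is a complete invariant. The index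
    8k+6, a consequence of the double root, enters the gcd because B has degree at most k, against
    2k+1 for G. Divided derivatives are used because orders such as 8k+6 exceed p.

    On the geometric side an isomorphism is only a map given locally by weighted forms. That its
    x-coordinate depends on x alone is the uniqueness of the degree 2 map to the line; it is
    obtained here by elimination and a degree bound on a discriminant, with identities between
    polynomials evaluated at the points of the curve. *)

(* An element of F_p is encoded by the two base 32 digits of its representative, so that a table
   is read by two pattern matchings: the kernel evaluates this much faster than binary integers. *)
Inductive digit := D0 | D1 | D2 | D3 | D4 | D5 | D6 | D7 | D8 | D9 | D10 | D11 | D12 | D13 | D14
    | D15 | D16 | D17 | D18 | D19 | D20 | D21 | D22 | D23 | D24 | D25 | D26 |
    D27 | D28 | D29 | D30 | D31.
Inductive elt := Elt of digit & digit.

Notation el0 := (Elt D0 D0).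
Notation el1 := (Elt D0 D1).

(** * Lookup tables for the arithmetic of F_p *)

Definition digits : seq digit :=
  [:: D0; D1; D2; D3; D4; D5; D6; D7; D8; D9; D10; D11; D12; D13; D14; D15; D16;
    D17; D18; D19; D20; D21; D22; D23; D24; D25; D26; D27; D28; D29; D30; D31].
Definition elts : seq elt :=
  flatten [seq [seq Elt h i | i <- digits] | h <- digits].

(** The dummy [let] separates the digit from the 32 entries, so that [select] applied to its entries
    evaluates to a closure awaiting one argument. *)
Definition select (A : Type)
    (x0 x1 x2 x3 x4 x5 x6 x7 x8 x9 x10 x11 x12 x13 x14 x15 x16 x17 x18 x19 x20 x21 x22 x23
     x24 x25 x26 x27 x28 x29 x30 x31 : A) : digit -> A :=
  let u := tt in fun d =>
  match d with
  | D0 => x0 | D1 => x1 | D2 => x2 | D3 => x3 | D4 => x4 | D5 => x5 | D6 => x6 |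
    D7 => x7 | D8 => x8 | D9 => x9 | D10 => x10 | D11 => x11 | D12 => x12 |
    D13 => x13 | D14 => x14 | D15 => x15 | D16 => x16 | D17 => x17 | D18 =>
    x18 | D19 => x19 | D20 => x20 | D21 => x21 | D22 => x22 | D23 => x23 | D24
    => x24 | D25 => x25 | D26 => x26 | D27 => x27 | D28 => x28 | D29 => x29 |
    D30 => x30 | D31 => x31
  end.

Fixpoint blocks (A : Type) (n : nat) (l : seq A) : seq (digit -> A) :=
  if n is n'.+1 then
    if l is
      x0 :: x1 :: x2 :: x3 :: x4 :: x5 :: x6 :: x7 :: x8 :: x9 :: x10 :: x11 :: x12
      :: x13 :: x14 :: x15 :: x16 :: x17 :: x18 :: x19 :: x20 :: x21 :: x22 ::
      x23 :: x24 :: x25 :: x26 :: x27 :: x28 :: x29 :: x30 :: x31 :: l'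
    then
      select
        x0 x1 x2 x3 x4 x5 x6 x7 x8 x9 x10 x11 x12 x13 x14 x15 x16 x17 x18 x19 x20 x21
        x22 x23 x24 x25 x26 x27 x28 x29 x30 x31
      :: blocks n' l'
    else [::]
  else [::].

Definition block (A : Type) (z : A) (l : seq A) : digit -> A :=
  head (fun=> z) (blocks 1 l).

Definition reader (A : Type) (z : A) (l : seq (digit -> A)) : elt -> A :=
  if l is
    x0 :: x1 :: x2 :: x3 :: x4 :: x5 :: x6 :: x7 :: x8 :: x9 :: x10 :: x11 :: x12
    :: x13 :: x14 :: x15 :: x16 :: x17 :: x18 :: x19 :: x20 :: x21 :: x22 ::
    x23 :: x24 :: x25 :: x26 :: x27 :: x28 :: x29 :: x30 :: x31 :: _
  then
    let u := tt in fun x =>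
    match x with
    | Elt h i =>
      match h with
      | D0 => x0 i | D1 => x1 i | D2 => x2 i | D3 => x3 i | D4 => x4 i | D5 => x5 i |
      D6 => x6 i | D7 => x7 i | D8 => x8 i | D9 => x9 i | D10 => x10 i | D11
      => x11 i | D12 => x12 i | D13 => x13 i | D14 => x14 i | D15 => x15 i |
      D16 => x16 i | D17 => x17 i | D18 => x18 i | D19 => x19 i | D20 => x20 i
      | D21 => x21 i | D22 => x22 i | D23 => x23 i | D24 => x24 i | D25 => x25
      i | D26 => x26 i | D27 => x27 i | D28 => x28 i | D29 => x29 i | D30 =>
      x30 i | D31 => x31 i
      end
    end
  else fun=> z.

Definition table (A : Type) (z : A) (l : seq A) : elt -> A :=
  reader z (blocks 32 l).

Definition cycle_upto (A : Type) (n : nat) (l : seq A) : seq A :=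
  flatten (nseq (n %/ size l).+1 l).

Fixpoint suffixes (A : Type) (n : nat) (l : seq A) : seq (seq A) :=
  if n is n'.+1 then l :: suffixes n' (behead l) else [::].

(** For x = (h, i) and y = (j, k) the sum is the entry of the periodic list [l] at 32 (h + j) + i +
    k. It depends on h + j, with 63 values, and on the window of length 32 that starts at 32 (h + j)
    + i, so 63 * 32 = 2016 shared windows serve all pairs; 2048 exceeds the last index read. *)
Definition addition (p : nat) : elt -> elt -> elt :=
  let l := cycle_upto 2048 (take p elts) in
  let columns := blocks 63 [seq block el0 s | s <- suffixes 2016 l] in
  table id (flatten [seq
    (let cs := take 32 cs in [seq reader el0 [seq c i | c <- cs] | i <- digits])
    | cs <- suffixes 32 columns]).

(** A box: matching on it selects a row of the addition table while the table of multiples is built,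
    and not at each use of that table. *)
Inductive adder := Adder of elt -> elt.

Definition multiples (add : elt -> adder) (addq : elt -> elt) :
    nat -> elt -> seq (elt -> elt) :=
  fix go n x0 :=
  if n is n'.+1 then
    let x1 := addq x0 in let x2 := addq x1 in let x3 := addq x2 in
    match add x0 with Adder f0 =>
    match add x1 with Adder f1 =>
    match add x2 with Adder f2 =>
    match add x3 with Adder f3 =>
      f0 :: f1 :: f2 :: f3 :: go n' (addq x3)
    end end end end
  else [::].

(** Computes r + q s. For each q the entry at s = (h, i) is the addition row of q s, reached by h
    steps of 32 q followed by i steps of q. *)
Definition muladd (p : nat) : elt -> elt -> elt -> elt :=
  let add := addition p in
  let adder_of := table (Adder id) [seq Adder (add x) | x <- elts] in
  table (fun=> id) [seq
    (let: Adder addq := adder_of q in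
     let: Adder addq32 := adder_of (iter 32 addq el0) in
     reader id [seq block id (multiples adder_of addq 8 x)
               | x <- traject addq32 el0 32])
    | q <- elts].

(** * Polynomials as lists of coefficients, constant term first *)

Section PolynomialLists.

Variables (C : Type) (ma : C -> C -> C -> C) (ma2 : C -> C -> C -> C -> C -> C).
Variables (z one : C) (isz forced : C -> bool) (ninv : C -> C).

Definition mulC (x y : C) : C := ma x y z.

Fixpoint evall (l : seq C) (x : C) : C :=
  if l is c :: l' then ma x (evall l' x) c else z.

(** With f s t r = r + q s + q' t this is a + q b + q' (c + X b): one pass for two elimination
    steps, and also for multiplication by a linear factor. *)
Fixpoint fuse1 (f : C -> C -> C -> C) (c : C) (b a : seq C) : seq C :=
  match b, a with
  | b0 :: b', a0 :: a' => f b0 c a0 :: fuse1 f b0 b' a'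
  | b0 :: b', [::] => f b0 c z :: fuse1 f b0 b' [::]
  | [::], a0 :: a' => f z c a0 :: a'
  | [::], [::] => [:: f z c z]
  end.

(** [fuse1] unrolled eight entries at a time, for the speed of the inner loop. *)
Definition fuse (f : C -> C -> C -> C) : C -> seq C -> seq C -> seq C :=
  fix go (c : C) (b a : seq C) {struct b} : seq C :=
  if b is b0 :: b1 :: b2 :: b3 :: b4 :: b5 :: b6 :: b7 :: b' then
    if a is a0 :: a1 :: a2 :: a3 :: a4 :: a5 :: a6 :: a7 :: a' then
      f b0 c a0 :: f b1 b0 a1 :: f b2 b1 a2 :: f b3 b2 a3 :: f b4 b3 a4 :: f b5 b4
      a5 :: f b6 b5 a6 :: f b7 b6 a7 :: go b7 b' a'
    else fuse1 f c b a
  else fuse1 f c b a.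

(* [force l] is [l]: inspecting all the entries makes lazy reduction evaluate them at once instead
   of accumulating suspended products. *)
Fixpoint all_forced (b l : seq C) : bool :=
  if b is _ :: _ :: _ :: _ :: b' then
    if l is x0 :: x1 :: x2 :: x3 :: l' then
      if forced x0 then if forced x1 then if forced x2 then if forced x3 then
        all_forced b' l'
      else false else false else false else false
    else true
  else true.

Definition force (l : seq C) : seq C := if all_forced l l then l else [::].

(* A remainder sequence dividing by increasing powers of X: every nonzero common root of [a] and [b]
   is a root of the result, whatever the fuel [n] and the estimate [d] of size a - size b. *)
Fixpoint euclid (n d : nat) (a b : seq C) : seq C :=
  if n is n'.+1 then
    if b is b0 :: b' then
      if isz b0 then euclid n' d.+1 a b' else
      if b' is b1 :: b2 then
        if a is a0 :: a1 :: a2 then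
          let i := ninv b0 in
          let q0 := mulC i a0 in
          let a1' := ma q0 b1 a1 in
          let q1 := mulC i a1' in
          (* The cancellation of the two lowest coefficients is tested, so nothing is assumed of
             [ninv]; on failure the empty list, which vanishes everywhere, preserves the
             invariant. *)
          if isz (ma q0 b0 a0) && isz (ma q1 b0 a1') then
            let a' := fuse (ma2 q0 q1) b1 b2 a2 in
            if all_forced b a' then
              (* When the sizes differ by 0 or 1, the new a is one shorter than b, and the two are
                 exchanged. *)
              if d is d'.+2 then euclid n' d' a' b else euclid n' 1 b a'
            else [::]
          else [::]
        else [::]
      else b
    else a
  else [::].

Variables u v : C.

(** The recurrence of [trinomial_coefS] divided by i + 1, in characteristic 2m + 1: [al] and [be]
    hold (m - i)/(i + 1) and -i/(i + 1), while x and y are the two preceding coefficients. *)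
Fixpoint trinomial (al be : seq C) (x y : C) : seq C :=
  match al, be with
  | a :: al', b :: be' =>
    let t := ma (mulC u a) y (mulC (mulC v b) x) in
    t :: trinomial al' be' y t
  | _, _ => [::]
  end.

(** The powers of v decrease along the list, so they are accumulated from its end; the second
    component is the next power. *)
Fixpoint weighted (es bs : seq C) : seq C * C :=
  match es, bs with
  | e :: es', b :: bs' =>
    let: (l, w) := weighted es' bs' in (mulC b (mulC w e) :: l, mulC w v)
  | _, _ => ([::], one)
  end.

Fixpoint derivl (i : C) (l : seq C) : seq C :=
  if l is c :: l' then mulC i c :: derivl (ma one i one) l' else [::].

Fixpoint mull (l l' : seq C) : seq C :=
  match l, l' with x :: s, y :: t => mulC x y :: mull s t | _, _ => [::] end.

(** The result is G, G', a polynomial vanishing at the nonzero common roots of G, G' and B, and the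
    Hasse invariant e_m of y^2 = x (x^2 + u x + v). The sizes of G and B are 2k+2 and k+1, whence
    the first estimate k+1. Insufficient fuel could not make the result unsound. *)
Definition curve_polys (k : nat) (al be bB bG : seq C) :
    seq C * seq C * seq C * C :=
  let es := one :: trinomial al be z one in
  let G1 := force (weighted (drop k es) bG).1 in
  let G2 := force (derivl one (behead G1)) in
  let B1 := force (mull (rev (take k.+1 es)) bB) in
  let D1 := euclid (8 * k + 30) k.+1 G1 B1 in
  (G1, G2, euclid (8 * k + 30) (size G2 - size D1) G2 D1, last z es).

End PolynomialLists.

(** * Codes, the quadratic extension F_p(w) and the verification of one curve *)

Fixpoint codes (n : nat) (c : N) : seq N :=
  if n is n'.+1 then c :: codes n' (N.succ c) else [::].

Definition elt_code : elt -> N := table 0%num (codes 1024 0%num).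

Definition is0 (x : elt) : bool := if x is el0 then true else false.
Definition is1 (x : elt) : bool := if x is el1 then true else false.
Definition forced1 (x : elt) : bool := match x with Elt _ _ => true end.

Notation elt2 := (elt * elt)%type.
Notation el2_0 := (el0, el0).
Notation el2_1 := (el1, el0).

Definition embed (x : elt) : elt2 := (x, el0).
Definition is0_2 (x : elt2) : bool := is0 x.1 && is0 x.2.
Definition is1_2 (x : elt2) : bool := is1 x.1 && is0 x.2.
Definition forced2 (x : elt2) : bool :=
  let: (a, b) := x in if forced1 a then forced1 b else false.

(* A certificate is (p, N_p, g, l1, l2), where F_(p^2) = F_p(w), w^2 = g, and a + b w is encoded
   by 1000 a + b. An entry (mu, rho, rs) of l1 is the curve y^2 = x (x^2 + u x + v) with
   u = v = mu (or u = 0, v = -1 if mu = 0), a root rho of x^2 + u x + v, and the candidates rs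
   for x0, up to conjugation; an entry (lam, rs) of l2 is the curve y^2 = x (x - 1) (x - lam). *)
Definition certificate1 := (N * N * seq N)%type.
Definition certificate2 := (N * seq N)%type.
Definition certificate :=
  (N * N * N * seq certificate1 * seq certificate2)%type.

(** The components are u, v, a root of x^2 + u x + v, the candidates for x0, and the output of
    [curve_polys]. *)
Definition curve :=
  (elt2 * elt2 * elt2 * seq elt2 * (seq elt2 * seq elt2 * seq elt2 * elt2))%type.

Section FieldOperations.

Variables (ma : elt -> elt -> elt -> elt) (inv : elt -> elt) (em nr : elt).

(** When [invs] holds 1, 1/2, 1/3, ..., the entries are (c + i d)/(i + 1), the factors in the
    recurrences for binomial and trinomial coefficients. *)
Fixpoint ratios (c d : elt) (invs : seq elt) : seq elt :=
  if invs is y :: invs' then ma c y el0 :: ratios (ma el1 d c) d invs' else [::].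

Fixpoint partial_products (b : elt) (rs : seq elt) : seq elt :=
  if rs is r :: rs' then b :: partial_products (ma b r el0) rs' else [:: b].

Definition power (x : elt) (n : N) : elt :=
  if n is Npos q then Pos.iter_op (fun x y => ma x y el0) q x else el1.

Definition opp (x : elt) : elt := ma em x el0.

(** The multipliers are applied first and bound by [let]: their table rows are looked up once for a
    whole polynomial. [muladd2] and [muladd2_twice] follow the same pattern, with the row of nr q1
    for the product of two w-components. *)
Definition muladd1_twice (q q' : elt) : elt -> elt -> elt -> elt :=
  let f := ma q in let g := ma q' in fun s t r => f s (g t r).

Definition muladd2 (q : elt2) : elt2 -> elt2 -> elt2 :=
  let: (q0, q1) := q in
  let f0 := ma q0 in
  let f1 := ma q1 in
  let f2 := ma (ma nr q1 el0) in
  fun s r => let: (s0, s1) := s in let: (r0, r1) := r in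
    (f2 s1 (f0 s0 r0), f1 s0 (f0 s1 r1)).

Definition muladd2_twice (q q' : elt2) : elt2 -> elt2 -> elt2 -> elt2 :=
  let: (q0, q1) := q in
  let: (p0, p1) := q' in
  let f0 := ma q0 in
  let f1 := ma q1 in
  let f2 := ma (ma nr q1 el0) in
  let g0 := ma p0 in
  let g1 := ma p1 in
  let g2 := ma (ma nr p1 el0) in
  fun s t r =>
    let: (s0, s1) := s in let: (t0, t1) := t in let: (r0, r1) := r in
    (f2 s1 (f0 s0 (g2 t1 (g0 t0 r0))), f1 s0 (f0 s1 (g1 t0 (g0 t1 r1)))).

Definition mul2 (x y : elt2) : elt2 := muladd2 x y el2_0.
Definition add2 (x y : elt2) : elt2 := muladd2 el2_1 x y.
Definition opp2 (x : elt2) : elt2 := (opp x.1, opp x.2).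
Definition conj2 (x : elt2) : elt2 := (x.1, opp x.2).

Definition inv2 (x : elt2) : elt2 :=
  let: (x0, x1) := x in
  let n := inv (ma (opp (ma nr x1 el0)) x1 (ma x0 x0 el0)) in
  (ma x0 n el0, ma (opp x1) n el0).

Definition unit2 (x : elt2) : bool := is1_2 (mul2 x (inv2 x)).

Fixpoint proportional (c d : elt2) (l l' : seq elt2) : bool :=
  match l, l' with
  | x :: s, y :: t =>
    is0_2 (muladd2 c x (mul2 (opp2 d) y)) && proportional c d s t
  | [::], [::] => true
  | _, _ => false
  end.

Definition poly_of_roots (rs : seq elt2) : seq elt2 :=
  foldr (fun r l => fuse el2_0 (muladd2_twice (opp2 r) el2_1) el2_0 l [::]) [:: el2_1] rs.

(** D is compared, up to a scalar, with the product of the X - r. The scalar is cleared by crossing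
    constant coefficients, and that of D must be invertible, which excludes D = 0. *)
Definition only_roots (D rs : seq elt2) : bool :=
  let P := poly_of_roots rs in
  let d := head el2_0 D in
  unit2 d && proportional d (head el2_0 P) P D.

Definition shift_root (u r : elt2) : elt2 * elt2 :=
  let s := add2 r (add2 r u) in (add2 r s, mul2 r s).

Definition modulus (uv : elt2 * elt2) : elt2 := mul2 (mul2 uv.1 uv.1) (inv2 uv.2).

(** The same elliptic curve with each of its 2-torsion points 0, r and -(r + u) marked in turn. *)
Definition moduli (c : curve) : seq elt2 :=
  let: (u, v, r, _, _) := c in
  [:: modulus (u, v); modulus (shift_root u r);
      modulus (shift_root u (opp2 (add2 r u)))].

Definition value_at (u v r : elt2) : elt2 := mul2 r (muladd2 r (add2 r u) v).

Definition slope_at (u v r : elt2) : elt2 :=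
  muladd2 r (add2 r (add2 r u)) (muladd2 r (add2 r u) v).

(** At such a point the expansion of the cubic cannot be scaled to one beginning with 1 + s, so it
    gives no pair (a, b). *)
Definition singular (u v r : elt2) : bool :=
  is0_2 (value_at u v r) || is0_2 (slope_at u v r).

Definition param (u v r : elt2) : elt2 * elt2 :=
  let g := value_at u v r in
  let i := inv2 (slope_at u v r) in
  (mul2 (mul2 (add2 (add2 r r) (add2 r u)) g) (mul2 i i),
   mul2 (mul2 g g) (mul2 i (mul2 i i))).

Definition params (c : curve) : seq (elt2 * elt2) :=
  let: (u, v, _, rs, _) := c in
  [seq param u v r | r <- rs & ~~ singular u v r].

Definition curve_ok (c : curve) : bool :=
  let: (u, v, r, rs, (G1, G2, D, e)) := c in
  [&& is0_2 (muladd2 r (add2 r u) v), unit2 v, unit2 (shift_root u r).2,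
      unit2 (shift_root u (opp2 (add2 r u))).2, is0_2 e, only_roots D rs &
      (* A singular point may be a root of D; it is then listed among the candidates but contributes
         no parameters. *)
      all (fun r => singular u v r ||
             [&& unit2 (value_at u v r), unit2 (slope_at u v r),
                 is0_2 (evall muladd2 el2_0 G1 r) & is0_2 (evall muladd2 el2_0 G2 r)])
          rs].

Variables (fp : seq elt) (k : nat) (al be bB bG : seq elt).

Definition read (n : N) : elt := nth el0 fp (N.to_nat n).

Definition read2 (n : N) : elt2 :=
  let: (a, b) := N.div_eucl n 1000%num in (read a, read b).

Definition with_conj (r : elt2) : seq elt2 :=
  if is0 r.2 then [:: r] else [:: r; conj2 r].

Definition curve1 (x : certificate1) : curve :=
  let: (mu, rho, rs) := x in
  let: (u, v) := if is0 (read mu) then (el0, em) else (read mu, read mu) in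
  let: (G1, G2, D, e) :=
    curve_polys ma muladd1_twice el0 el1 is0 forced1 (fun x => opp (inv x)) u v
      k al be bB bG in
  (embed u, embed v, read2 rho, flatten [seq with_conj (read2 n) | n <- rs],
   (map embed G1, map embed G2, map embed D, embed e)).

Definition curve2 (x : certificate2) : curve :=
  let: (lam, rs) := x in
  let v := read2 lam in
  let u := opp2 (add2 el2_1 v) in
  (u, v, el2_1, map read2 rs,
   curve_polys muladd2 muladd2_twice el2_0 el2_1 is0_2 forced2
     (fun x => opp2 (inv2 x)) u v
     k (map embed al) (map embed be) (map embed bB) (map embed bG)).

End FieldOperations.

(** * Correctness of the tables *)

Definition digit_rank : digit -> nat := block 0 (iota 0 32).
Definition rank (x : elt) : nat := let: Elt h i := x in 32 * digit_rank h + digit_rank i.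

Lemma digit_rank_lt d : digit_rank d < 32.
Proof. by case: d. Qed.

Lemma rank_lt x : rank x < 1024.
Proof.
case: x => h i /=; have := digit_rank_lt h; have := digit_rank_lt i.
move=> Hi Hh; apply: (@leq_trans (32 * digit_rank h + 32)); first by rewrite ltn_add2l.
by rewrite -mulnSr (leq_mul2l 32 _ 32).
Qed.

Lemma blockE (A : Type) (z : A) (l : seq A) d :
  32 <= size l -> block z l d = nth z l (digit_rank d).
Proof.
by do 32 (case: l => [//|? l]); move=> _; case: d.
Qed.

Lemma size_blocks (A : Type) n (l : seq A) : 32 * n <= size l -> size (blocks n l) = n.
Proof.
elim: n l => [//|n IH] l; rewrite mulnS.
do 32 (case: l => [//|? l]); move=> H /=; congr S; apply: IH.
by move: H; rewrite /= !ltnS.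
Qed.

Lemma nth_blocks (A : Type) (z : A) z' n (l : seq A) j :
  32 * n <= size l -> j < n ->
  nth z' (blocks n l) j = block z (drop (32 * j) l).
Proof.
elim: n l j => [//|n IH] l j; rewrite mulnS.
case: j => [|j].
  by do 32 (case: l => [//|? l]).
rewrite mulnS.
do 32 (case: l => [//|? l]); move=> H jn.
by rewrite -[LHS]/(nth z' (blocks n l) j) (IH l).
Qed.

Lemma nth_blocks_digit (A : Type) (z : A) z' n (l : seq A) j d :
  32 * n <= size l -> j < n ->
  nth z' (blocks n l) j d = nth z l (32 * j + digit_rank d).
Proof.
move=> H jn; rewrite (nth_blocks z) // blockE ?nth_drop //.
rewrite size_drop leq_subRL; last by apply: leq_trans H; rewrite leq_mul2l ltnW.
by rewrite -mulnSr; apply: leq_trans H; rewrite leq_mul2l.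
Qed.

Lemma readerE (A : Type) (z : A) z' (l : seq (digit -> A)) h i :
  32 <= size l -> reader z l (Elt h i) = nth z' l (digit_rank h) i.
Proof.
by do 32 (case: l => [//|? l]); move=> _; case: h.
Qed.

Lemma tableE (A : Type) (z : A) (l : seq A) x :
  1024 <= size l -> table z l x = nth z l (rank x).
Proof.
case: x => h i H; rewrite /table (readerE _ (fun=> z)) ?size_blocks //.
by rewrite (nth_blocks_digit z) // digit_rank_lt.
Qed.

Lemma size_elts : size elts = 1024.
Proof. by []. Qed.

Lemma rank_elts i : i < 1024 -> rank (nth el0 elts i) = i.
Proof.
move=> Hi; have -> : nth el0 elts i = nth el0 elts (nth 0 (iota 0 1024) i) by rewrite nth_iota.
suff /all_nthP H : all (fun i => rank (nth el0 elts i) == i) (iota 0 1024).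
  have := H 0 i; rewrite size_iota => /(_ Hi) /eqP ->; by rewrite nth_iota.
by vm_compute.
Qed.

Lemma digit_rank_inj : injective digit_rank.
Proof.
apply: (can_inj (g := nth D0 digits)); by case.
Qed.

Lemma rank_inj : injective rank.
Proof.
move=> [h i] [h' i'] /= E.
have Hh : digit_rank h = digit_rank h'.
  have := congr1 (divn^~ 32) E.
  by rewrite !(mulnC 32) !divnMDl // !divn_small ?digit_rank_lt // !addn0.
congr Elt; apply: digit_rank_inj => //.
by move/eqP: E; rewrite Hh eqn_add2l => /eqP.
Qed.

Lemma nth_elts x : nth el0 elts (rank x) = x.
Proof. by apply: rank_inj; rewrite rank_elts ?rank_lt. Qed.

Lemma size_cycle (A : Type) n (l : seq A) : 0 < size l -> n <= size (cycle_upto n l).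
Proof.
move=> Hl; rewrite size_flatten /shape map_nseq sumn_nseq mulnC.
by apply: ltnW; rewrite -ltn_divLR // ltnS leqnn.
Qed.

Lemma nth_cycle (A : Type) (z : A) n (l : seq A) i :
  i < size (cycle_upto n l) -> nth z (cycle_upto n l) i = nth z l (i %% size l).
Proof.
rewrite /cycle_upto; elim: (n %/ size l).+1 i => [|c IH] i //=.
rewrite size_cat nth_cat => Hj; case: ltnP => Hi; first by rewrite modn_small.
have Hl : 0 < size l by case: (l) Hj => //=; elim: (c).
rewrite IH; first by rewrite -[in RHS](subnK Hi) modnDr.
by rewrite -(ltn_add2l (size l)) subnKC.
Qed.

Lemma size_suffixes (A : Type) n (l : seq A) : size (suffixes n l) = n.
Proof. by elim: n l => //= n IH l; rewrite IH. Qed.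

Lemma nth_suffixes (A : Type) z n (l : seq A) i :
  i < n -> nth z (suffixes n l) i = drop i l.
Proof.
elim: n l i => [//|n IH] l [|i] /= Hi; first by rewrite drop0.
by rewrite IH //; case: l.
Qed.

Lemma nth_flatten_const (A : Type) (z : A) c (ss : seq (seq A)) i j :
  all (fun s => size s == c) ss -> j < c -> i < size ss ->
  nth z (flatten ss) (c * i + j) = nth z (nth [::] ss i) j.
Proof.
elim: ss i => [//|s ss IH] [|i] /= /andP[/eqP Hs Hss] jc Hi.
  by rewrite muln0 nth_cat Hs jc.
by rewrite nth_cat Hs mulnS -addnA ltnNge leq_addr /= addKn IH.
Qed.

Lemma size_flatten_const (A : Type) c (ss : seq (seq A)) :
  all (fun s => size s == c) ss -> size (flatten ss) = c * size ss.
Proof.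
by elim: ss => [|s ss IH] /=; rewrite ?muln0 // size_cat mulnS => /andP[/eqP-> /IH->].
Qed.

Lemma nth_map_elt (A : Type) (f : elt -> A) z x :
  nth z [seq f x | x <- elts] (rank x) = f x.
Proof. by rewrite (nth_map el0) ?size_elts ?rank_lt // nth_elts. Qed.

Lemma additionE p x y : 0 < p <= 1024 ->
  addition p x y = nth el0 (cycle_upto 2048 (take p elts)) (rank x + rank y).
Proof.
move=> /andP[p0 p1]; rewrite /addition; set l := cycle_upto _ _.
have Hl : 2048 <= size l by rewrite size_cycle // size_take size_elts; case: ifP.
set ws := [seq block el0 s | s <- suffixes 2016 l].
have Hws : size ws = 2016 by rewrite size_map size_suffixes.
have Hc : size (blocks 63 ws) = 63 by rewrite size_blocks // Hws.
set F := [seq _ | cs <- _].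
have HF : all (fun s => size s == 32) F by rewrite all_map (eq_all (a2 := predT)) ?all_predT // =>
  cs; rewrite inE size_map.
have HsF : size F = 32 by rewrite size_map size_suffixes.
rewrite tableE; last first.
  by rewrite (size_flatten_const HF) HsF.
case: x y => h i [j k]; rewrite [rank (Elt h i)]/=.
rewrite nth_flatten_const ?digit_rank_lt ?HsF //.
rewrite (nth_map [::]) ?size_suffixes ?digit_rank_lt // nth_suffixes ?digit_rank_lt //.
rewrite (nth_map D0) ?digit_rank_lt //.
have -> : nth D0 digits (digit_rank i) = i by case: (i).
have Ht : size (take 32 (drop (digit_rank h) (blocks 63 ws))) = 32.
  have Hh : digit_rank h <= 31 by rewrite -ltnS digit_rank_lt.
  by rewrite size_takel // size_drop Hc leq_subRL ?(leq_trans Hh) // (@leq_add _ _ 31 32).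
rewrite (readerE _ (fun=> el0)) ?size_map ?Ht //.
rewrite (nth_map (fun=> fun=> el0)) ?Ht ?digit_rank_lt //.
rewrite nth_take ?digit_rank_lt // nth_drop.
have Hh := digit_rank_lt h; have Hj := digit_rank_lt j; have Hi := digit_rank_lt i.
rewrite (nth_blocks_digit (fun=> el0)) ?Hws //; last by lia.
rewrite (nth_map [::]) ?size_suffixes; last by lia.
rewrite nth_suffixes; last by lia.
rewrite blockE ?nth_drop; last by rewrite size_drop; lia.
by congr (nth _ _ _); rewrite [rank _]/=; lia.
Qed.

Lemma nth_multiples add adder_of (q x : elt) n s :
  (forall y, adder_of y = Adder (add y)) -> s < 4 * n ->
  nth id (multiples adder_of (add q) n x) s = add (iter s (add q) x).
Proof.
move=> Hadd; elim: n x s => [//|n IH] x s; rewrite mulnS => Hs.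
rewrite /= !Hadd.
case: s Hs => [//|[//|[//|[//|s]]]] Hs.
by rewrite -[LHS]/(nth id (multiples adder_of (add q) n _) s) IH // -!iterSr.
Qed.

Lemma size_multiples add adder_of (q x : elt) n :
  (forall y, adder_of y = Adder (add y)) ->
  size (multiples adder_of (add q) n x) = 4 * n.
Proof.
move=> Hadd; elim: n x => [//|n IH] x; rewrite mulnS.
by rewrite /= !Hadd /= IH.
Qed.

Lemma muladdE p q s r :
  muladd p q s r = addition p (iter (digit_rank (let: Elt _ i := s in i)) (addition p q)
     (iter (digit_rank (let: Elt h _ := s in h)) (addition p (iter 32 (addition p q) el0)) el0)) r.
Proof.
rewrite /muladd tableE ?size_map ?size_elts // nth_map_elt.
set add := addition p; set adder_of := table _ _.
have Hadd y : adder_of y = Adder (add y).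
  by rewrite /adder_of tableE ?size_map ?size_elts // nth_map_elt.
rewrite !Hadd; case: s => h i.
rewrite (readerE _ (fun=> id)) ?size_map ?size_traject //.
rewrite (nth_map el0) ?size_traject ?digit_rank_lt // nth_traject ?digit_rank_lt //.
rewrite blockE ?(size_multiples _ _ _ Hadd) // (nth_multiples _ _ Hadd) //.
by rewrite (leq_trans (digit_rank_lt i)).
Qed.

(** * Values of the codes in a ring of characteristic p *)

Section Value.

Local Open Scope ring_scope.

Variables (R : comNzRingType) (p : nat).
Hypotheses (p_gt0 : (0 < p <= 1024)%N) (p0 : p%:R = 0 :> R).

Definition valR (x : elt) : R := (rank x)%:R.

Lemma natr_modp n : (n %% p)%:R = n%:R :> R.
Proof. by rewrite {2}(divn_eq n p) natrD natrM p0 mulr0 add0r. Qed.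

Lemma valR_addition x y : valR (addition p x y) = valR x + valR y.
Proof.
have /andP[pg0 pl] := p_gt0.
have Hs : size (take p elts) = p.
  by rewrite size_take size_elts; case: ltngtP pl.
rewrite additionE // nth_cycle ?Hs; last first.
  apply: (@leq_trans 2048); last by rewrite size_cycle ?Hs.
  by have := rank_lt x; have := rank_lt y; lia.
rewrite nth_take ?ltn_mod // /valR rank_elts; last by rewrite (leq_trans _ pl) ?ltn_mod.
by rewrite natr_modp natrD.
Qed.

Lemma valR0 : valR el0 = 0.
Proof. by []. Qed.
Lemma valR_iter n q x : valR (iter n (addition p q) x) = valR x + n%:R * valR q.
Proof.
elim: n => [|n IH]; first by rewrite mul0r addr0.
by rewrite iterS valR_addition IH mulrS mulrDl mul1r addrCA.
Qed.

Lemma valR_muladd q s r : valR (muladd p q s r) = valR r + valR q * valR s.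
Proof.
rewrite muladdE valR_addition addrC !valR_iter !valR0 !add0r; congr (_ + _).
case: s => h i; rewrite [valR (Elt h i)]/valR /= natrD natrM mulrA -mulrDl.
by rewrite mulrC; congr (_ * (_ + _)); rewrite mulrC.
Qed.

(** Two ranks below p differ by less than p. This turns the counts of distinct codes in [check] into
    counts of distinct field elements. *)
Lemma valR_inj x y : (forall n, (0 < n < p)%N -> n%:R != 0 :> R) ->
  (rank x < p)%N -> (rank y < p)%N -> valR x = valR y -> x = y.
Proof.
move=> Hn Hx Hy E; apply: rank_inj.
wlog le : x y Hx Hy E / (rank x <= rank y)%N.
  by move=> W; case/orP: (leq_total (rank x) (rank y)) => H; [|symmetry]; apply: W.
apply/eqP; rewrite eqn_leq le leqNgt; apply/negP => lt.
have := Hn (rank y - rank x)%N; rewrite subn_gt0 lt (leq_ltn_trans (leq_subr _ _) Hy).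
by rewrite natrB // -!/(valR _) E subrr eqxx => /(_ isT).
Qed.

End Value.

Definition elt_eqb (x y : elt) : bool := N.eqb (elt_code x) (elt_code y).

Lemma codesE n c : codes n c = [seq N.add c (N.of_nat i) | i <- iota 0 n].
Proof.
elim: n c => [//|n IH] c; rewrite /= IH N.add_0_r; congr (_ :: _).
rewrite (iotaDl 1 0) -map_comp; apply: eq_map => i /=; lia.
Qed.

Lemma elt_codeE x : elt_code x = N.of_nat (rank x).
Proof.
rewrite /elt_code codesE tableE ?size_map ?size_iota //.
rewrite (nth_map 0) ?size_iota ?rank_lt //.
by rewrite nth_iota ?rank_lt // N.add_0_l add0n.
Qed.

Lemma elt_eqP : Equality.axiom elt_eqb.
Proof.
move=> x y; rewrite /elt_eqb !elt_codeE; apply: (iffP idP) => [/N.eqb_eq|->].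
  by move=> /Nnat.Nat2N.inj /rank_inj.
by rewrite N.eqb_refl.
Qed.

HB.instance Definition _ := hasDecEq.Build elt elt_eqP.

Definition check (c : certificate) : bool :=
  let: (pN, count, g, l1, l2) := c in
  let p := N.to_nat pN in
  let k := (p - 5) %/ 6 in
  let m := (3 * k).+2 in
  let fp := take p elts in
  let ma := muladd p in
  let nr := read fp g in
  let em := nth el0 fp p.-1 in
  let invs := [seq power ma x (N.sub pN 2%num) | x <- behead fp] in
  let inv := table el0 (cycle_upto 1024 (el0 :: invs)) in
  (* Since 8k+7 is 2k+2 modulo p = 6k+5, these are the binomials C(8k+6+i, i); those of [bG] are
     C(4k+2+i, i). *)
  let bB := partial_products ma el1
    (ratios ma (nth el0 fp (2 * k).+2) el1 (take k invs)) in
  let bG := partial_products ma el1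
    (ratios ma (nth el0 fp (4 * k).+3) el1 (take (2 * k).+1 invs)) in
  (* With [em] = -1, the lists (m - i)/(i + 1) and -i/(i + 1) needed by [trinomial]. *)
  let al := ratios ma (nth el0 fp m) em (take m invs) in
  let be := ratios ma el0 em (take m invs) in
  let cs1 := map (curve1 ma inv em fp k al be bB bG) l1 in
  let cs2 := map (curve2 ma inv em nr fp k al be bB bG) l2 in
  let mod_of := moduli ma inv em nr in
  let par_of := params ma inv em nr in
  let ms2 := flatten (map mod_of cs2) in
  let ps2 := flatten (map par_of cs2) in
  let conj := conj2 ma em in
  let ms := undup (flatten (map mod_of cs1) ++ ms2 ++ map conj ms2) in
  let ps := undup (flatten (map par_of cs1) ++ ps2
                   ++ [seq (conj x.1, conj x.2) | x <- ps2]) in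
  (* Codes below p are the reduced ones; only for these does [undup] on codes count elements of the
     field. *)
  let small x := N.ltb (elt_code x) pN in
  let small2 (x : elt2) := small x.1 && small x.2 in
  [&& all (curve_ok ma inv em nr) (cs1 ++ cs2),
      all2 (fun x y => is1 (ma x y el0)) (behead fp) invs,
      (* Euler's criterion: g is not a square in F_p, hence w lies outside F_p. *)
      power ma nr (N.of_nat m) == em,
      all small2 ms, size [seq x <- ms | ~~ is0_2 x] == m./2,
      (el2_0 \in ms) || ~~ odd m,
      all (fun x => small2 x.1 && small2 x.2) ps & size ps == N.to_nat count].

Local Open Scope ring_scope.

(** * Coefficients of the powers of a trinomial, and the polynomials G and B *)

Section TrinomialPowers.

Variables (R : comNzRingType) (u v : R) (m : nat).

Definition trinomial_coef i : R := ((1 + u *: 'X + v *: 'X^2) ^+ m)`_i.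

Lemma trinomial_coef0 : trinomial_coef 0 = 1.
Proof.
by rewrite /trinomial_coef -horner_coef0 horner_exp !hornerE /= !mulr0 !addr0 expr1n.
Qed.

(** Compare coefficients in T P' = m T' P, where P = T^m. *)
Lemma trinomial_coefS i :
  i.+1%:R * trinomial_coef i.+1 = u * (m%:R - i%:R) * trinomial_coef i
    + v * ((2 * m).+1%:R - i%:R) * (if i is j.+1 then trinomial_coef j else 0).
Proof.
set T : {poly R} := 1 + u *: 'X + v *: 'X^2; set P := T ^+ m.
have E : T * P^`() = m%:R *: ((u%:P + (v *+ 2) *: 'X) * P).
  rewrite /P deriv_exp scaler_nat mulrnAr.
  have -> : T^`() = u%:P + (v *+ 2) *: 'X.
    by rewrite /T !derivE add0r alg_polyC -scalerMnl -scalerMnr.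
  by case: (m) => [|n] //; congr (_ *+ _); rewrite exprS /=; ring.
have := congr1 (fun Q : {poly R} => Q`_i) E.
rewrite /trinomial_coef -/T -/P /T !mulrDl mul1r -!scalerAl !coefD !coefZ coefD coefZ coefCM.
have -> : 'X^2 * P^`() = 'X * ('X * P^`()) by rewrite expr2 mulrA.
rewrite !coefXM !coef_deriv.
case: i => [|[|i]] /= E1.
- transitivity (P`_1 *+ 1 + u * 0 + v * 0); first by ring.
  by rewrite E1; ring.
- transitivity (P`_2 *+ 2 + u * (P`_1 *+ 1) + v * 0 - u * P`_1); first by ring.
  by rewrite E1; ring.
transitivity (P`_i.+3 *+ i.+3 + u * (P`_i.+2 *+ i.+2) + v * (P`_i.+1 *+ i.+1)
  - u * (P`_i.+2 *+ i.+2) - v * (P`_i.+1 *+ i.+1)); first by ring.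
by rewrite E1; ring.
Qed.

End TrinomialPowers.

Section RootPolynomials.

Variables (R : comNzRingType) (u v : R) (k : nat) (c : nat -> R).

(* In characteristic p = 6k+5, for suitable [c], these are up to a unit the divided derivatives of
   order 4k+2 (when the curve is supersingular) and 8k+6 of (X (X^2 + u X + v))^(3k+2). *)
Definition polyG : {poly R} := \poly_(i < (2 * k).+2)
  (c i * v ^+ ((2 * k).+1 - i) * trinomial_coef u v (3 * k + 2) (k + i)).

Definition polyB : {poly R} :=
  \poly_(i < k.+1) (c i * trinomial_coef u v (3 * k + 2) (k - i)).

End RootPolynomials.

(** * Correctness of the algorithms on lists *)

Section PolynomialListSpec.

Variables (C : Type) (K : fieldType) (phi : C -> K).
Variables (ma : C -> C -> C -> C) (ma2 : C -> C -> C -> C -> C -> C).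
Variables (z one : C) (isz forced : C -> bool) (ninv : C -> C).
Hypothesis phi_ma : forall q s r, phi (ma q s r) = phi r + phi q * phi s.
Hypothesis phi_ma2 : forall q q' s t r,
  phi (ma2 q q' s t r) = phi r + phi q * phi s + phi q' * phi t.
Hypotheses (phi_z : phi z = 0) (phi_one : phi one = 1).
Hypothesis isz_phi : forall x, isz x -> phi x = 0.

Definition listval (l : seq C) (y : K) : K := horner_rec (map phi l) y.

Lemma listval_cons x l y : listval (x :: l) y = listval l y * y + phi x.
Proof. by []. Qed.

Lemma phi_evall l x : phi (evall ma z l x) = listval l (phi x).
Proof. by elim: l => //= c l IH; rewrite phi_ma IH /listval /=; ring. Qed.

Lemma listval_fuse1 f (q q' : K) c b a y :
  (forall s t r, phi (f s t r) = phi r + q * phi s + q' * phi t) ->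
  listval (fuse1 z f c b a) y =
    listval a y + q * listval b y + q' * (phi c + y * listval b y).
Proof.
move=> phi_f; elim: b c a => [|b0 b IH] c [|a0 a] /=;
  rewrite ?listval_cons ?IH ?listval_cons ?phi_f /listval /= ?phi_z; ring.
Qed.

Lemma fuseE f c b a : fuse z f c b a = fuse1 z f c b a.
Proof.
have [n] := ubnP (size b); elim: n c b a => // n IH c b a.
do 8! [case: b => [|? b]; first by case: a] => bn.
do 8! [case: a => [|? a]; first by []].
rewrite /= -IH //; move: bn; rewrite /=; lia.
Qed.

Lemma listval_euclid n d a b y : y != 0 ->
  listval a y = 0 -> listval b y = 0 ->
  listval (euclid ma ma2 z isz forced ninv n d a b) y = 0.
Proof.
move=> y0; elim: n d a b => [//|n IH] d a b Ha Hb.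
case: b Hb => [|b0 b] Hb //; rewrite -/(euclid _ _ _ _ _ _) /=.
case: ifP => [/isz_phi b00|_].
  apply: IH => //; move/eqP: Hb.
  by rewrite listval_cons b00 addr0 mulf_eq0 (negPf y0) orbF => /eqP.
case: b Hb => [|b1 b] Hb //; case: a Ha => [|a0 [|a1 a]] Ha //.
case: ifP => // /andP[/isz_phi H0 /isz_phi H1].
set a' := fuse _ _ _ _ _; suff Ha' : listval a' y = 0.
  by case: ifP => // _; case: d => [|[|d]]; apply: IH.
(* The new a is (a + (q0 + q1 X) b) / X^2, so its value at y is compared after multiplication by
   y^2. *)
apply: (mulIf y0); apply: (mulIf y0); rewrite !mul0r.
rewrite /a' fuseE (listval_fuse1 _ _ _ _ (phi_ma2 _ _)).
move: H0 H1 Ha Hb; rewrite !listval_cons !(phi_ma, phi_z) !add0r.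
set q0 := phi (ninv b0) * phi a0; set q1 := phi (ninv b0) * _.
move=> H0 H1 Ha Hb.
set A2 := listval a y in Ha *; set B2 := listval b y in Hb *.
transitivity (((A2 * y + phi a1) * y + phi a0)
  + (q0 + q1 * y) * ((B2 * y + phi b1) * y + phi b0)
  - (phi a0 + q0 * phi b0) - y * (phi a1 + q0 * phi b1 + q1 * phi b0)); first by ring.
by rewrite Ha Hb H0 H1 !mulr0 !subr0 addr0.
Qed.

Definition listpoly (l : seq C) : {poly K} := Poly (map phi l).

Lemma listvalE l y : listval l y = (listpoly l).[y].
Proof. by rewrite horner_Poly. Qed.

Lemma coef_listpoly l i : (listpoly l)`_i = if (i < size l)%N then phi (nth z l i) else 0.
Proof.
rewrite coef_Poly; case: ltnP => Hi; first by rewrite (nth_map z).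
by rewrite nth_default ?size_map.
Qed.

Lemma forceE l : (forall x, forced x) -> force forced l = l.
Proof.
move=> forcedT; rewrite /force; suff -> : all_forced forced l l by [].
move: {1}l => b; have [n] := ubnP (size b); elim: n b l => // n IH b l.
case: b => [|? [|? [|? [|? b]]]] //= bn; case: l => [|? [|? [|? [|? l]]]] //=.
by rewrite !forcedT IH //; move: bn; lia.
Qed.

Variables u v : C.

Lemma trinomialE (E : nat -> K) n al be x y :
  size be = size al -> phi x = E n -> phi y = E n.+1 ->
  (forall j, (j < size al)%N -> E (n + j).+2 =
     phi u * phi (nth z al j) * E (n + j).+1 + phi v * phi (nth z be j) * E (n + j)%N) ->
  map phi (trinomial ma z u v al be x y) = [seq E i.+2 | i <- iota n (size al)].
Proof.
elim: al be n x y => [|a al IH] [|b be] n x y //= [Hs] Hx Hy HE.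
set t := ma _ _ _; have Ht : phi t = E n.+2.
  have /= := HE 0 isT; rewrite addn0 => ->.
  by rewrite /t /mulC !phi_ma phi_z -Hx -Hy; ring.
rewrite -Ht (IH _ n.+1) // => j Hj.
by have := HE j.+1 Hj; rewrite addnS.
Qed.

Lemma weightedE es bs i : (i < minn (size es) (size bs))%N ->
  phi (nth z (weighted ma z one v es bs).1 i) =
    phi (nth z bs i) * phi v ^+ ((minn (size es) (size bs)).-1 - i) * phi (nth z es i).
Proof.
have H2 es' bs' : phi (weighted ma z one v es' bs').2 = phi v ^+ minn (size es') (size bs').
  elim: es' bs' => [|e es' IH] [|b bs'] /=; rewrite ?minn0 ?min0n //.
  rewrite minnSS; case: (weighted _ _ _ _ _ _) (IH bs') => l w /= Hw.
  by rewrite /mulC phi_ma phi_z exprS -Hw; ring.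
elim: es bs i => [|e es IH] [|b bs] i; rewrite ?min0n ?minn0 // [size _]/= [size _]/= minnSS.
rewrite [weighted _ _ _ _ _ _]/=.
case: (weighted _ _ _ _ _ _) (IH bs) (H2 es bs) => l w /= {}IH {}H2.
case: i => [|i] Hi /=.
  by rewrite subn0 /mulC !phi_ma phi_z H2; ring.
rewrite IH //; congr (_ * _ ^+ _ * _); by move: Hi; rewrite ltnS -/(size _);
  case: (minn _ _) => [|n] //; rewrite subSS.
Qed.

Lemma size_weighted es bs :
  size (weighted ma z one v es bs).1 = minn (size es) (size bs).
Proof.
elim: es bs => [|e es IH] [|b bs] //=; rewrite minnSS -IH.
by case: (weighted _ _ _ _ _ _).
Qed.

Lemma size_derivl i l : size (derivl ma z one i l) = size l.
Proof. by elim: l i => //= c l IH i; rewrite IH. Qed.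

Lemma derivlE i l j : (j < size l)%N ->
  phi (nth z (derivl ma z one i l) j) = (phi i + j%:R) * phi (nth z l j).
Proof.
elim: l i j => [|c l IH] i [|j] //= Hj; first by rewrite /mulC phi_ma phi_z; ring.
by rewrite IH // phi_ma phi_one mulrS; ring.
Qed.

Lemma listpoly_deriv l : listpoly (derivl ma z one one (behead l)) = (listpoly l)^`().
Proof.
apply/polyP=> i; rewrite coef_deriv !coef_listpoly size_derivl size_behead.
case: l => [|c l] //=; first by rewrite mul0rn.
rewrite ltnS; case: ltnP => Hi; last by rewrite mul0rn.
by rewrite derivlE // phi_one -mulr_natl mulrS; ring.
Qed.

Lemma size_mull l l' : size (mull ma z l l') = minn (size l) (size l').
Proof. by elim: l l' => [|x l IH] [|y l'] //=; rewrite minnSS IH. Qed.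

Lemma mullE l l' i : (i < minn (size l) (size l'))%N ->
  phi (nth z (mull ma z l l') i) = phi (nth z l i) * phi (nth z l' i).
Proof.
elim: l l' i => [|x l IH] [|y l'] [|i] //=; rewrite minnSS ?ltnS //.
- by rewrite /mulC phi_ma phi_z add0r.
exact: IH.
Qed.

Variables (k : nat) (al be bB bG : seq C) (cB cG : nat -> K).
Let m := (3 * k + 2)%N.
Hypothesis (charK : (2 * m).+1%:R = 0 :> K).
Hypothesis natK : forall i, (i < m)%N -> i.+1%:R != 0 :> K.
Hypotheses (size_al : size al = m) (size_be : size be = m).
Hypotheses (size_bB : size bB = k.+1) (size_bG : size bG = (2 * k).+2).
Hypothesis phi_al : forall i, (i < m)%N -> i.+1%:R * phi (nth z al i) = m%:R - i%:R.
Hypothesis phi_be : forall i, (i < m)%N -> i.+1%:R * phi (nth z be i) = - i%:R.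
Hypothesis phi_bB : forall i, (i <= k)%N -> phi (nth z bB i) = cB i.
Hypothesis phi_bG : forall i, (i <= (2 * k).+1)%N -> phi (nth z bG i) = cG i.
Hypothesis forcedT : forall x, forced x.

Local Notation e := (trinomial_coef (phi u) (phi v) m).

Local Notation polyG := (polyG (phi u) (phi v) k cG).
Local Notation polyB := (polyB (phi u) (phi v) k cB).

Lemma curve_polys_spec G1 G2 D em :
  curve_polys ma ma2 z one isz forced ninv u v k al be bB bG = (G1, G2, D, em) ->
  [/\ phi em = e m, forall y, listval G1 y = polyG.[y],
      forall y, listval G2 y = polyG^`().[y]
    & forall y, y != 0 -> polyG.[y] = 0 -> polyG^`().[y] = 0 -> polyB.[y] = 0 ->
      listval D y = 0].
Proof.
rewrite /curve_polys !forceE //; set es := one :: _.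
move=> Ecp.
have He : map phi es = [seq e i | i <- iota 0 m.+1].
  rewrite /= (iotaDl 1 0) -[RHS]/(_ :: _) -map_comp; congr (_ :: _).
    by rewrite phi_one trinomial_coef0.
  (* The sequence is shifted by one to include the coefficient of index -1, which is 0 and starts
     the recurrence. *)
  pose E i := if i is j.+1 then e j else 0.
  rewrite (trinomialE (E := E) (n := 0)) ?size_al //.
    by rewrite phi_one /E trinomial_coef0.
  move=> j Hj; apply: (mulfI (natK Hj)); rewrite add0n -[E j.+2]/(e j.+1) -[E j.+1]/(e j)
    trinomial_coefS charK -/(E j).
  rewrite -[m%:R - _](phi_al Hj) sub0r -(phi_be Hj).
  by rewrite mulrDr !mulrA ![_ * j.+1%:R]mulrC.
have Hes : size es = m.+1 by rewrite -(size_map phi) He size_map size_iota.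
have Hnth i : (i <= m)%N -> phi (nth z es i) = e i.
  move=> Hi; rewrite -(nth_map z 0) ?Hes // He (nth_map 0%N) ?size_iota //.
  by rewrite nth_iota.
pose G1' := (weighted ma z one v (drop k es) bG).1.
pose B1 := mull ma z (rev (take k.+1 es)) bB.
have HG1 : listpoly G1' = polyG.
  apply/polyP => i; rewrite coef_listpoly coef_poly /G1' size_weighted size_drop Hes size_bG.
  have -> : minn (m.+1 - k) (2 * k).+2 = (2 * k).+2 by rewrite /m; lia.
  case: ltnP => // Hi; have Hm : minn (m.+1 - k) (2 * k).+2 = (2 * k).+2 by rewrite /m; lia.
  rewrite weightedE size_drop Hes size_bG Hm // phi_bG // nth_drop Hnth //.
  by move: Hi; rewrite /m; lia.
have HB1 : listpoly B1 = polyB.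
  apply/polyP => i; rewrite coef_listpoly coef_poly /B1 size_mull size_rev size_takel ?Hes;
    last by rewrite /m; lia.
  rewrite size_bB minnn; case: ltnP => // Hi.
  rewrite mullE ?size_rev ?size_takel ?Hes ?size_bB ?minnn //; try by rewrite /m; lia.
  rewrite nth_rev ?size_takel ?Hes //; try by rewrite /m; lia.
  rewrite subSS nth_take ?Hnth ?phi_bB //; last 2 first; try by rewrite /m; lia.
  by rewrite mulrC.
have Hlast : phi (last z es) = e m by rewrite -nth_last Hes Hnth.
case: Ecp => <- <- <- <-; split=> [|y|y|y y0 HG HG' HB].
- exact: Hlast.
- by rewrite listvalE HG1.
- by rewrite listvalE listpoly_deriv HG1.
apply: listval_euclid => //; first by rewrite listvalE listpoly_deriv HG1.
by apply: listval_euclid => //; rewrite listvalE ?HG1 ?HB1.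
Qed.

End PolynomialListSpec.

(** * What a verified curve provides *)

Section CurveCertificate.

Variables (K : fieldType) (k : nat) (cG cB : nat -> K).

Definition cubic (u v x : K) := x * (x ^+ 2 + u * x + v).
Definition cubic' (u v x : K) := 3%:R * x ^+ 2 + 2%:R * u * x + v.

(* The (a, b) such that 1 + s + a s^2 + b s^3 is c(x + s c(x) / c'(x)) / c(x), c = [cubic u v]. *)
Definition param_at (u v x : K) : K * K :=
  let g := cubic u v x in let g' := cubic' u v x in
  ((3%:R * x + u) * g / g' ^+ 2, g ^+ 2 / g' ^+ 3).

(* The cubic translated so that its root [r] moves to 0. *)
Definition shifted (u r : K) : K * K := (3%:R * r + u, r * (2%:R * r + u)).

Definition modulus_of (uv : K * K) : K := uv.1 ^+ 2 / uv.2.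

Definition solution (u v x : K) : Prop :=
  [/\ cubic u v x != 0, cubic' u v x != 0,
      (polyG u v k cG).[x] = 0 & (polyG u v k cG)^`().[x] = 0].

(** The list [rs] contains every nonzero common root of G, G' and B; [abs] consists of the
    parameters attached to its nonsingular points, each of which is checked to be a double root of
    G; [ms] holds the moduli for the three marked 2-torsion points. *)
Record certified (u v r : K) (rs ms : seq K) (abs : seq (K * K)) : Prop := Certified {
  certified_v : v != 0;
  certified_root : r ^+ 2 + u * r + v = 0;
  certified_shift : (shifted u r).2 != 0;
  certified_shift' : (shifted u (- (r + u))).2 != 0;
  certified_supersingular : trinomial_coef u v (3 * k + 2) (3 * k + 2) = 0;
  certified_complete : forall x, x != 0 -> (polyG u v k cG).[x] = 0 ->
    (polyG u v k cG)^`().[x] = 0 -> (polyB u v k cB).[x] = 0 -> x \in rs;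
  certified_sound : forall ab, ab \in abs ->
    exists2 x, solution u v x & ab = param_at u v x;
  certified_params : forall x, x \in rs -> cubic u v x != 0 -> cubic' u v x != 0 ->
    param_at u v x \in abs;
  certified_moduli : ms = [:: modulus_of (u, v); modulus_of (shifted u r);
    modulus_of (shifted u (- (r + u)))]
}.

End CurveCertificate.

Section FieldSpec.

Variables (K : fieldType) (phi1 : elt -> K).
Variables (ma : elt -> elt -> elt -> elt) (inv : elt -> elt) (em nr : elt) (w : K).
Hypothesis phi_ma : forall q s r, phi1 (ma q s r) = phi1 r + phi1 q * phi1 s.
Hypotheses (phi0 : phi1 el0 = 0) (phi1_1 : phi1 el1 = 1) (phi_em : phi1 em = -1).
Hypothesis sqr_w : w ^+ 2 = phi1 nr.

Definition phi2 (x : elt2) : K := phi1 x.1 + phi1 x.2 * w.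

Lemma phi_is0 x : is0 x -> phi1 x = 0.
Proof. by case: x => [[] []]. Qed.
Lemma phi_is1 x : is1 x -> phi1 x = 1.
Proof. by case: x => [[] []]. Qed.
Lemma phi2_is0 x : is0_2 x -> phi2 x = 0.
Proof. by move=> /andP[/phi_is0 E /phi_is0 E']; rewrite /phi2 E E' mul0r addr0. Qed.
Lemma phi2_is1 x : is1_2 x -> phi2 x = 1.
Proof. by move=> /andP[/phi_is1 E /phi_is0 E']; rewrite /phi2 E E' mul0r addr0. Qed.
Lemma phi2_z : phi2 el2_0 = 0. Proof. by rewrite phi2_is0. Qed.
Lemma phi2_one : phi2 el2_1 = 1. Proof. by rewrite phi2_is1. Qed.
Lemma phi2_embed x : phi2 (embed x) = phi1 x.
Proof. by rewrite /phi2 /= phi0 mul0r addr0. Qed.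

Lemma phi_opp x : phi1 (opp ma em x) = - phi1 x.
Proof. by rewrite phi_ma phi0 phi_em add0r mulN1r. Qed.

Lemma phi_muladd1_twice q q' s t r :
  phi1 (muladd1_twice ma q q' s t r) = phi1 r + phi1 q * phi1 s + phi1 q' * phi1 t.
Proof. by rewrite /muladd1_twice !phi_ma addrAC. Qed.

Lemma phi_muladd2 q s r : phi2 (muladd2 ma nr q s r) = phi2 r + phi2 q * phi2 s.
Proof.
case: q s r => [q0 q1] [s0 s1] [r0 r1]; rewrite /phi2 /= !phi_ma phi0 -sqr_w; ring.
Qed.

Lemma phi_muladd2_twice q q' s t r :
  phi2 (muladd2_twice ma nr q q' s t r) = phi2 r + phi2 q * phi2 s + phi2 q' * phi2 t.
Proof.
case: q q' s t r => [q0 q1] [p0 p1] [s0 s1] [t0 t1] [r0 r1].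
rewrite /phi2 /= !phi_ma phi0 -sqr_w; ring.
Qed.

Lemma phi_mul2 x y : phi2 (mul2 ma nr x y) = phi2 x * phi2 y.
Proof. by rewrite phi_muladd2 phi2_z add0r. Qed.

Lemma phi_add2 x y : phi2 (add2 ma nr x y) = phi2 x + phi2 y.
Proof. by rewrite phi_muladd2 phi2_one mul1r addrC. Qed.

Lemma phi_opp2 x : phi2 (opp2 ma em x) = - phi2 x.
Proof. by rewrite /phi2 !phi_opp mulNr opprD. Qed.

Lemma phi_unit2 x : unit2 ma inv em nr x ->
  phi2 x != 0 /\ phi2 (inv2 ma inv em nr x) = (phi2 x)^-1.
Proof.
move=> /phi2_is1; rewrite phi_mul2 => E.
have x0 : phi2 x != 0.
  by apply/eqP=> x0; move/eqP: E; rewrite x0 mul0r eq_sym oner_eq0.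
by split=> //; apply: (mulfI x0); rewrite E divff.
Qed.

Notation lval := (listval phi2).

Lemma lval_poly_of_roots rs y :
  lval (poly_of_roots ma em nr rs) y = \prod_(r <- rs) (y - phi2 r).
Proof.
elim: rs => [|r rs IH]; rewrite ?big_nil ?big_cons.
  by rewrite /listval /= phi2_one mul0r add0r.
rewrite -IH -[poly_of_roots _ _ _ (r :: rs)]/(fuse el2_0 (muladd2_twice ma nr (opp2 ma em r) el2_1)
  el2_0 (poly_of_roots ma em nr rs) [::]) fuseE.
rewrite (listval_fuse1 phi2_z _ _ _ _ (phi_muladd2_twice _ _)).
by rewrite phi_opp2 phi2_one phi2_z -[lval [::] y]/(0 : K); ring.
Qed.

Lemma proportional_lval c d l l' y : proportional ma em nr c d l l' ->
  phi2 c * lval l y = phi2 d * lval l' y.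
Proof.
elim: l l' => [|x l IH] [|x' l'] //; first by rewrite /listval !mulr0.
move=> /andP[/phi2_is0 E /IH {}IH]; move/eqP: E.
rewrite phi_muladd2 phi_mul2 phi_opp2 mulNr addrC subr_eq0 => /eqP E.
by rewrite !listval_cons [LHS]mulrDr [RHS]mulrDr E !mulrA IH.
Qed.

Lemma only_rootsP D rs y : only_roots ma inv em nr D rs -> lval D y = 0 ->
  y \in map phi2 rs.
Proof.
move=> /andP[/phi_unit2[d0 _] /(proportional_lval y) E] Dy.
move: E; rewrite Dy mulr0 => /eqP; rewrite mulf_eq0 (negPf d0) /= lval_poly_of_roots.
rewrite prodf_seq_eq0 => /hasP[r rrs /=]; rewrite subr_eq0 => /eqP ->.
exact: map_f.
Qed.

Lemma phi_value_at u v r : phi2 (value_at ma nr u v r) = cubic (phi2 u) (phi2 v) (phi2 r).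
Proof. by rewrite phi_mul2 phi_muladd2 phi_add2 /cubic; ring. Qed.

Lemma phi_slope_at u v r : phi2 (slope_at ma nr u v r) = cubic' (phi2 u) (phi2 v) (phi2 r).
Proof. by rewrite 2!phi_muladd2 !phi_add2 /cubic'; ring. Qed.

Lemma phi_shift_root u r :
  (phi2 (shift_root ma nr u r).1, phi2 (shift_root ma nr u r).2) = shifted (phi2 u) (phi2 r).
Proof. by rewrite !(phi_add2, phi_mul2); congr (_, _); ring. Qed.

Lemma phi_modulus uv : unit2 ma inv em nr uv.2 ->
  phi2 (modulus ma inv em nr uv) = modulus_of (phi2 uv.1, phi2 uv.2).
Proof. by move=> /phi_unit2[_ E]; rewrite !phi_mul2 E /modulus_of expr2. Qed.

Lemma phi_param u v r : unit2 ma inv em nr (slope_at ma nr u v r) ->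
  (phi2 (param ma inv em nr u v r).1, phi2 (param ma inv em nr u v r).2)
    = param_at (phi2 u) (phi2 v) (phi2 r).
Proof.
move=> /phi_unit2[_]; have := phi_value_at u v r; have := phi_slope_at u v r.
lazy beta iota zeta delta [param fst snd].
move: (value_at _ _ _ _ _) (slope_at _ _ _ _ _) => g g' Eg' Eg; move: (inv2 _ _ _ _ _) => i Ei.
rewrite !phi_mul2 !phi_add2 Ei Eg Eg' /param_at -!exprVn; congr (_, _); ring.
Qed.

Definition phi2_pair (ab : elt2 * elt2) : K * K := (phi2 ab.1, phi2 ab.2).

Variables (k : nat) (cG cB : nat -> K).

Lemma curve_okP u v r rs G1 G2 D e (u' := phi2 u) (v' := phi2 v) :
  let c : curve := (u, v, r, rs, (G1, G2, D, e)) in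
  curve_ok ma inv em nr c ->
  [/\ phi2 e = trinomial_coef u' v' (3 * k + 2) (3 * k + 2),
      forall y, lval G1 y = (polyG u' v' k cG).[y],
      forall y, lval G2 y = (polyG u' v' k cG)^`().[y]
    & forall y, y != 0 -> (polyG u' v' k cG).[y] = 0 ->
        (polyG u' v' k cG)^`().[y] = 0 -> (polyB u' v' k cB).[y] = 0 -> lval D y = 0] ->
  certified k cG cB u' v' (phi2 r) (map phi2 rs) (map phi2 (moduli ma inv em nr c))
    (map phi2_pair (params ma inv em nr c)).
Proof.
move=> c /and5P[/phi2_is0 Hr vU sU s'U /and3P[/phi2_is0 He HD /allP Hrs]] [Ee EG1 EG2 ED].
have [v0 _] := phi_unit2 vU; have [s0 _] := phi_unit2 sU; have [s'0 _] := phi_unit2 s'U.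
split=> //.
- by rewrite -[RHS]Hr phi_muladd2 phi_add2 /u' /v'; ring.
- by rewrite -phi_shift_root.
- by rewrite -phi_add2 -phi_opp2 -phi_shift_root.
- by rewrite -Ee.
- by move=> x x0 Gx G'x Bx; apply: only_rootsP HD _; apply: ED.
- move=> ab /mapP[ab2 /mapP[x]]; rewrite mem_filter => /andP[/negbTE ns xrs] -> ->.
  have /Hrs := xrs; rewrite ns => /and4P[valU slopeU /phi2_is0 E1 /phi2_is0 E2].
  have [val0 _] := phi_unit2 valU; have [slope0 _] := phi_unit2 slopeU.
  exists (phi2 x); last by rewrite -phi_param.
  split; rewrite -?phi_value_at -?phi_slope_at //.
    by rewrite -EG1 -E1 (phi_evall phi_muladd2 phi2_z).
  by rewrite -EG2 -E2 (phi_evall phi_muladd2 phi2_z).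
- move=> _ /mapP[x xrs ->] val0 slope0.
  have ns : singular ma nr u v x = false.
    apply/norP; split; apply/negP => /phi2_is0; rewrite ?phi_value_at ?phi_slope_at => E.
      by rewrite E eqxx in val0.
    by rewrite E eqxx in slope0.
  have /Hrs := xrs; rewrite ns => /and4P[_ slopeU _ _].
  rewrite -phi_param //; apply: (map_f phi2_pair (x := param ma inv em nr u v x)).
  by apply: map_f; rewrite mem_filter ns.
by rewrite /= !phi_modulus // !phi_shift_root phi_opp2 phi_add2.
Qed.

End FieldSpec.

(** * Sequences of quotients and of binomial coefficients *)

Section FieldSequences.

Variables (K : fieldType) (phi1 : elt -> K) (ma : elt -> elt -> elt -> elt).
Hypothesis phi_ma : forall q s r, phi1 (ma q s r) = phi1 r + phi1 q * phi1 s.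
Hypotheses (phi0 : phi1 el0 = 0) (phi1_1 : phi1 el1 = 1).

Lemma size_ratios c d invs : size (ratios ma c d invs) = size invs.
Proof. by elim: invs c => //= y invs IH c; rewrite IH. Qed.

Lemma nth_ratios c d invs i : (i < size invs)%N ->
  phi1 (nth el0 (ratios ma c d invs) i) = (phi1 c + i%:R * phi1 d) * phi1 (nth el0 invs i).
Proof.
elim: invs c i => [|y invs IH] c [|i] //= Hi; first by rewrite phi_ma phi0; ring.
by rewrite IH // phi_ma phi1_1 mulrS; ring.
Qed.

Lemma size_partial_products b rs : size (partial_products ma b rs) = (size rs).+1.
Proof. by elim: rs b => //= r rs IH b; rewrite IH. Qed.

Lemma nth_partial_products b rs i : (i <= size rs)%N ->
  phi1 (nth el0 (partial_products ma b rs) i) = phi1 b * \prod_(j < i) phi1 (nth el0 rs j).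
Proof.
elim: rs b i => [|r rs IH] b [|i] // Hi; rewrite ?big_ord0 ?mulr1 //.
rewrite big_ord_recl /= -[partial_products _ _ _]/(partial_products ma _ _) IH //.
by rewrite phi_ma phi0 add0r mulrA.
Qed.

Lemma phi_power x n : phi1 (power ma x n) = phi1 x ^+ N.to_nat n.
Proof.
case: n => [|q]; first by rewrite phi1_1.
rewrite /power [N.to_nat _]/=; elim: q x => [q IH|q IH|] x /=.
- have -> : Pos.to_nat q~1 = (2 * Pos.to_nat q).+1 by lia.
  by rewrite phi_ma phi0 add0r IH phi_ma phi0 add0r exprS -expr2 -exprM.
- have -> : Pos.to_nat q~0 = (2 * Pos.to_nat q)%N by lia.
  by rewrite IH phi_ma phi0 add0r -expr2 -exprM.
- by rewrite expr1.
Qed.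

(** The ratio of C(n+i+1, i+1) to C(n+i, i) is (n+1+i)/(i+1), which makes sense in the field as long
    as i + 1 is invertible there. *)
Lemma phi_binomials c d n invs i :
  (i <= size invs)%N ->
  (forall j, (j < i)%N -> j.+1%:R * phi1 (nth el0 invs j) = 1) ->
  phi1 c = n.+1%:R -> phi1 d = 1 ->
  phi1 (nth el0 (partial_products ma el1 (ratios ma c d invs)) i) = 'C(n + i, i)%:R.
Proof.
move=> si Hinv Hc Hd; rewrite nth_partial_products ?size_ratios // phi1_1 mul1r.
elim: i si Hinv => [|i IH] si Hinv; first by rewrite big_ord0 bin0.
rewrite big_ord_recr /= IH; last 2 first.
- exact: ltnW.
- by move=> j ji; apply: Hinv; apply: ltnW.
rewrite nth_ratios // Hc Hd mulr1 -natrD.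
have H := Hinv i (leqnn _).
apply: (@mulrI _ i.+1%:R); first by apply/unitrPr; exists (phi1 (nth el0 invs i)).
transitivity ('C(n + i, i)%:R * (n.+1 + i)%:R * (i.+1%:R * phi1 (nth el0 invs i))); first by ring.
rewrite H mulr1 -!natrM addnS addSn; congr (_%:R).
by rewrite mulnC mul_bin_diag.
Qed.

End FieldSequences.

(** * Soundness of the certificates *)

Section Certificates.

Variables (K : fieldType) (phi1 : elt -> K) (k : nat).
Variables (ma : elt -> elt -> elt -> elt) (inv : elt -> elt) (em nr : elt) (w : K).
Hypothesis phi_ma : forall q s r, phi1 (ma q s r) = phi1 r + phi1 q * phi1 s.
Hypotheses (phi0 : phi1 el0 = 0) (phi1_1 : phi1 el1 = 1) (phi_em : phi1 em = -1).
Hypothesis sqr_w : w ^+ 2 = phi1 nr.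
Variables (fp al be bB bG : seq elt) (cB cG : nat -> K).
Let m := (3 * k + 2)%N.
Hypothesis (charK : (2 * m).+1%:R = 0 :> K).
Hypothesis natK : forall i, (i < m)%N -> i.+1%:R != 0 :> K.
Hypotheses (size_al : size al = m) (size_be : size be = m).
Hypotheses (size_bB : size bB = k.+1) (size_bG : size bG = (2 * k).+2).
Hypothesis phi_al : forall i, (i < m)%N -> i.+1%:R * phi1 (nth el0 al i) = m%:R - i%:R.
Hypothesis phi_be : forall i, (i < m)%N -> i.+1%:R * phi1 (nth el0 be i) = - i%:R.
Hypothesis phi_bB : forall i, (i <= k)%N -> phi1 (nth el0 bB i) = cB i.
Hypothesis phi_bG : forall i, (i <= (2 * k).+1)%N -> phi1 (nth el0 bG i) = cG i.

(** The square root w' of g is an argument because the same codes, read with -w for w, describe the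
    conjugate curve. *)
Definition certified_curve (w' : K) (c : curve) : Prop :=
  exists u v r rs, certified k cG cB u v r rs
    (map (phi2 phi1 w') (moduli ma inv em nr c))
    (map (phi2_pair phi1 w') (params ma inv em nr c)).

Lemma listval_embed l y : listval (phi2 phi1 w) (map embed l) y = listval phi1 l y.
Proof.
rewrite /listval -map_comp; congr (horner_rec _ _); apply: eq_map => x /=.
exact: phi2_embed.
Qed.

Lemma curve1_certified x :
  let c := curve1 ma inv em fp k al be bB bG x in
  curve_ok ma inv em nr c -> certified_curve w c.
Proof.
move=> c; rewrite {}/c; case: x => [[mu rho] rs]; rewrite /curve1.
case: (if _ then _ else _) => u v.
case E: (curve_polys _ _ _ _ _ _ _ _ _ _ _ _ _ _) => [[[G1 G2] D] e] ok.
have H := @curve_polys_spec _ _ phi1 ma (muladd1_twice ma) el0 el1 is0 forced1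
  (fun x => opp ma em (inv x)) phi_ma (phi_muladd1_twice phi_ma) phi0 phi1_1
  (phi_is0 phi0) u v k al be bB bG cB cG charK natK size_al size_be size_bB
  size_bG phi_al phi_be phi_bB phi_bG _ _ _ _ _ E.
have [|Ee EG1 EG2 ED] := H; first by case.
do 4 eexists; apply: curve_okP ok _ => //; rewrite !phi2_embed //.
split=> [|y|y|y]; rewrite ?listval_embed; [exact: Ee|exact: EG1|exact: EG2|exact: ED].
Qed.

Lemma curve2_certified x :
  let c := curve2 ma inv em nr fp k al be bB bG x in
  curve_ok ma inv em nr c -> certified_curve w c.
Proof.
move=> c; rewrite {}/c; case: x => [lam rs]; rewrite /curve2.
move: (read2 _ _) => v; set u := opp2 _ _ _.
have nthE l i : (i < size l)%N ->
    phi2 phi1 w (nth el2_0 (map embed l) i) = phi1 (nth el0 l i).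
  by move=> Hi; rewrite (nth_map el0) // phi2_embed.
case E: (curve_polys _ _ _ _ _ _ _ _ _ _ _ _ _ _) => [[[G1 G2] D] e] ok.
have := @curve_polys_spec _ _ (phi2 phi1 w) (muladd2 ma nr) (muladd2_twice ma nr)
  el2_0 el2_1 is0_2 forced2 (fun x => opp2 ma em (inv2 ma inv em nr x)) 
  (phi_muladd2 phi_ma phi0 sqr_w) (phi_muladd2_twice phi_ma phi0 sqr_w)
  (phi2_z w phi0) (phi2_one w phi0 phi1_1) (phi2_is0 w phi0) u v k
  (map embed al) (map embed be) (map embed bB) (map embed bG) cB cG charK natK.
rewrite !size_map => /(_ size_al size_be size_bB size_bG) H.
have [i Hi|i Hi|i Hi|i Hi||Ee EG1 EG2 ED] := H _ _ _ _ _ _ _ _ _ E.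
- by rewrite nthE ?size_al ?phi_al.
- by rewrite nthE ?size_be ?phi_be.
- by rewrite nthE ?size_bB ?phi_bB.
- by rewrite nthE ?size_bG ?phi_bG.
- by case=> [[? ?] [? ?]].
by do 4 eexists; apply: curve_okP ok _; try exact: phi_ma.
Qed.

End Certificates.

Section CheckSoundness.

Variables (K : closedFieldType) (k : nat) (pN count g : N).
Variables (l1 : seq certificate1) (l2 : seq certificate2).
Let p := N.to_nat pN.
Let m := (3 * k + 2)%N.
Hypotheses (p_eq : p = (6 * k + 5)%N) (p_pr : prime p) (p_le : (p <= 1024)%N).
Hypothesis charK : p \in [pchar K].
Hypothesis checked : check (pN, count, g, l1, l2).

Definition certified_by (Q : seq K -> seq (K * K) -> Prop) : Prop :=
  exists u v r rs ms abs,
    certified k (fun i => 'C((4 * k).+2 + i, i)%:R) (fun i => 'C((8 * k).+2.+4 + i, i)%:R)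
      u v r rs ms abs /\ Q ms abs.

(** Curves over F_p carry candidates closed under conjugation; a curve over F_(p^2) stands also for
    its conjugate, certified by reading its codes with -w. The first clauses count distinct values,
    the last two attach a certified curve to each listed modulus and each listed parameter. *)
Lemma check_sound : exists (ms : seq K) (abs : seq (K * K)),
  [/\ [/\ uniq ms, size [seq x <- ms | x != 0] = m./2 & 0 \in ms \/ ~~ odd m],
      [/\ uniq abs, size abs = N.to_nat count &
          {in abs, forall ab, ab.1 ^+ (p ^ 2) = ab.1 /\ ab.2 ^+ (p ^ 2) = ab.2}],
      {in ms, forall mu, certified_by (fun ms' abs' => mu \in ms' /\ {subset abs' <= abs})}
    & {in abs, forall ab, certified_by (fun ms' abs' => ab \in abs')}].
Proof.
have p0 : p%:R = 0 :> K by apply/eqP; rewrite -(dvdn_pcharf charK).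
have natK n : (0 < n < p)%N -> n%:R != 0 :> K.
  move=> /andP[n0 np]; rewrite -(dvdn_pcharf charK); apply/negP => /(dvdn_leq n0).
  by rewrite leqNgt np.
have p_rng : (0 < p <= 1024)%N by rewrite prime_gt0.
pose phi1 := valR K.
have phi_ma q s r : phi1 (muladd p q s r) = phi1 r + phi1 q * phi1 s.
  exact: valR_muladd.
have phi0 : phi1 el0 = 0 by [].
have phi1_1 : phi1 el1 = 1 by [].
move: checked; rewrite /check -/p; lazy zeta.
have -> : ((p - 5) %/ 6 = k)%N by rewrite p_eq; lia.
have -> : ((3 * k).+2 = m)%N by rewrite /m; lia.
set fp := take p elts; set ma := muladd p; set nr := read fp g.
set em := nth el0 fp p.-1; set invs := map _ (behead fp); set inv := table _ _.
set bB := partial_products ma el1 (ratios ma (nth el0 fp (2 * k).+2) _ _).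
set bG := partial_products ma el1 (ratios ma (nth el0 fp (4 * k).+3) _ _).
set al := ratios ma (nth el0 fp m) _ _; set be := ratios ma el0 _ _.
set cs1 := map (curve1 _ _ _ _ _ _ _ _ _) _; set cs2 := map (curve2 _ _ _ _ _ _ _ _ _ _) _.
set mod_of := moduli _ _ _ _; set par_of := params _ _ _ _; set conj := conj2 ma em.
set ms := undup (_ ++ _ ++ map conj _); set ps := undup (_ ++ _ ++ map _ _).
pose small x := N.ltb (elt_code x) pN; pose small2 (x : elt2) := small x.1 && small x.2.
move=> /andP[/allP Hok /andP[Hinv /andP[/eqP Hnr /andP[/allP Hsm /andP[/eqP Hsz]]]]].
move=> /andP[H0 /andP[/allP Hsp /eqP Hcount]].
have size_fp : size fp = p by rewrite size_takel // size_elts.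
have phi_fp i : (i < p)%N -> phi1 (nth el0 fp i) = i%:R.
  by move=> Hi; rewrite nth_take // /phi1 /valR rank_elts // (leq_trans Hi).
have phi_em : phi1 em = -1.
  rewrite phi_fp; last by rewrite prednK // prime_gt0.
  by apply/eqP; rewrite -addr_eq0 -mulrSr prednK ?prime_gt0 // p0.
have size_invs : size invs = p.-1 by rewrite size_map size_behead size_fp.
have Hinvs i : (i < p.-1)%N -> i.+1%:R * phi1 (nth el0 invs i) = 1.
  move=> Hi; have Hi1 : (i.+1 < p)%N by rewrite -(prednK (prime_gt0 p_pr)) ltnS.
  have /(phi_is1 phi1_1) : is1 (ma (nth el0 (behead fp) i) (nth el0 invs i) el0).
    move: Hinv; rewrite all2E => /andP[_ /(all_nthP (el0, el0)) /(_ i)].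
    rewrite size_zip size_behead size_fp size_invs minnn => /(_ Hi).
    by rewrite nth_zip // size_behead size_fp size_invs.
  by rewrite phi_ma nth_behead phi_fp // phi0 add0r => ->.
have [w sqr_w] : exists w : K, w ^+ 2 = phi1 nr.
  have [w /=] := @solve_monicpoly K 2 (fun i => if i == 0 then phi1 nr else 0) isT.
  by rewrite !big_ord_recr big_ord0 /= mul0r add0r mulr1 addr0 => ?; exists w.
have pE : p = (2 * m).+1 by rewrite p_eq /m; lia.
have charK' : (2 * m).+1%:R = 0 :> K by rewrite -pE.
have natKm i : (i < m)%N -> i.+1%:R != 0 :> K by move=> Hi; apply: natK; rewrite pE; lia.
have take_invs n i : (i < n)%N -> nth el0 (take n invs) i = nth el0 invs i by move=> Hi;
  rewrite nth_take.
have size_invs' n : (n < p)%N -> size (take n invs) = n.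
  by move=> Hn; rewrite size_takel // size_invs -ltnS prednK // prime_gt0.
have size_al : size al = m by rewrite size_ratios size_invs' // pE; lia.
have size_be : size be = m by rewrite size_ratios size_invs' // pE; lia.
have size_bB : size bB = k.+1 by rewrite size_partial_products size_ratios size_invs' // p_eq; lia.
have size_bG : size bG = (2 * k).+2 by rewrite size_partial_products size_ratios size_invs' //
  p_eq; lia.
have phi_al i : (i < m)%N -> i.+1%:R * phi1 (nth el0 al i) = m%:R - i%:R.
  move=> Hi; rewrite (nth_ratios phi_ma) ?size_invs' ?phi_em ?phi_fp ?take_invs //;
    try by rewrite pE; lia.
  by rewrite mulrCA Hinvs ?mulr1 ?mulrN1 // pE; lia.
have phi_be i : (i < m)%N -> i.+1%:R * phi1 (nth el0 be i) = - i%:R.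
  move=> Hi; rewrite (nth_ratios phi_ma) ?size_invs' ?phi_em ?take_invs //; try by rewrite pE; lia.
  by rewrite mulrCA Hinvs ?mulr1 ?mulrN1 ?phi0 ?add0r // pE; lia.
have phi_bB i : (i <= k)%N -> phi1 (nth el0 bB i) = 'C((8 * k).+2.+4 + i, i)%:R.
  move=> Hi; apply: (phi_binomials phi_ma) => //.
  - by rewrite size_invs' // p_eq; lia.
  - by move=> j ji; rewrite take_invs ?Hinvs // ?p_eq; lia.
  rewrite phi_fp; last by rewrite p_eq; lia.
  by rewrite -[LHS]addr0 -p0 -natrD p_eq; congr (_%:R); lia.
have phi_bG i : (i <= (2 * k).+1)%N -> phi1 (nth el0 bG i) = 'C((4 * k).+2 + i, i)%:R.
  move=> Hi; apply: (phi_binomials phi_ma) => //.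
  - by rewrite size_invs' // p_eq; lia.
  - by move=> j ji; rewrite take_invs ?Hinvs // ?p_eq; lia.
  by rewrite phi_fp // p_eq; lia.
have Hcert w' c : w' ^+ 2 = phi1 nr -> c \in cs1 ++ cs2 ->
    certified_curve phi1 k ma inv em nr (fun i => 'C((8 * k).+2.+4 + i, i)%:R)
      (fun i => 'C((4 * k).+2 + i, i)%:R) w' c.
  move=> sqr_w' Hc; have := Hok c Hc; move: Hc; rewrite mem_cat.
  move=> /orP[] /mapP[x _ ->] ok.
    by apply: curve1_certified ok; try exact: phi_ma.
  by apply: curve2_certified ok; try exact: phi_ma.
have frob x : phi1 x ^+ p = phi1 x.
  by rewrite -(pFrobenius_autE charK) /phi1 /valR rmorph_nat.
have nr_m : phi1 nr ^+ m = -1 by rewrite -phi_em -Hnr (phi_power phi_ma) // Nat2N.id.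
have w_p : w ^+ p = - w by rewrite pE exprS exprM sqr_w nr_m mulrN1.
have w_notF : w ^+ p != w.
  rewrite w_p eq_sym -addr_eq0 -mulr2n -mulr_natl mulf_neq0 //.
    by apply: natK; rewrite p_eq; lia.
  apply/eqP => w0; move/eqP: nr_m; rewrite -sqr_w w0 expr0n expr0n /=.
  have -> : (m == 0) = false by rewrite /m; lia.
  by rewrite eq_sym oppr_eq0 oner_eq0.
have frobB (x y : K) : (x - y) ^+ p = x ^+ p - y ^+ p by rewrite -!(pFrobenius_autE charK) rmorphB.
have frobD (x y : K) : (x + y) ^+ p = x ^+ p + y ^+ p by rewrite -!(pFrobenius_autE charK) rmorphD.
have frobN (x : K) : (- x) ^+ p = - x ^+ p by rewrite -!(pFrobenius_autE charK) rmorphN.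
have phi2_frob w' x : w' ^+ p = - w' -> phi2 phi1 w' x ^+ p = phi2 phi1 (- w') x.
  by move=> Hw'; rewrite /phi2 frobD exprMn !frob Hw'.
have phi2_conj w' x : phi2 phi1 w' (conj x) = phi2 phi1 (- w') x.
  by rewrite /phi2 /conj (phi_opp phi_ma) // mulrN mulNr.
have phi2_p2 x : phi2 phi1 w x ^+ (p ^ 2) = phi2 phi1 w x.
  rewrite expnS expn1 exprM (phi2_frob w x w_p) phi2_frob ?opprK //.
  by rewrite frobN w_p opprK.
have smallE x : small x -> (rank x < p)%N by rewrite /small elt_codeE => /N.ltb_lt; rewrite /p; lia.
have small0 : small el0.
  by apply: (proj2 (N.ltb_lt _ _)); rewrite elt_codeE -[rank el0]/0%N; move: p_rng; rewrite /p; lia.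
have phi1_inj x y : small x -> small y -> phi1 x = phi1 y -> x = y.
  by move=> /smallE Hx /smallE Hy; apply: valR_inj natK Hx Hy.
(* If the w-components differed, w would be a quotient of elements fixed by the Frobenius, whereas
   w^p = -w. *)
have phi2_inj x y : small2 x -> small2 y -> phi2 phi1 w x = phi2 phi1 w y -> x = y.
  case: x y => [x0 x1] [y0 y1] /andP[/= sx0 sx1] /andP[/= sy0 sy1]; rewrite /phi2 /= => E.
  have E1 : phi1 x1 = phi1 y1.
    apply/eqP; rewrite -subr_eq0; apply: contraNT w_notF => d0.
    have -> : w = (phi1 y0 - phi1 x0) / (phi1 x1 - phi1 y1).
      apply: (mulIf d0); rewrite divfK // mulrC mulrBl; apply/eqP.
      by rewrite subr_eq addrAC eq_sym subr_eq [X in _ == X]addrC E addrC.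
    by rewrite expr_div_n !frobB !frob.
  by congr (_, _); apply: phi1_inj => //; apply: (addIr (phi1 x1 * w)); rewrite {2}E1.
exists (map (phi2 phi1 w) ms), (map (phi2_pair phi1 w) ps); split.
- split; first by rewrite map_inj_in_uniq ?undup_uniq // => x y /Hsm sx /Hsm sy; apply: phi2_inj.
    rewrite filter_map size_map -Hsz; congr size; apply: eq_in_filter => x /Hsm sx /=.
    congr (~~ _); apply/eqP/idP => [|/(phi2_is0 w phi0)//].
    rewrite -(phi2_z w phi0) => /(phi2_inj _ _ sx) -> //.
    by rewrite /small2 small0.
  case/orP: H0 => H; [left|right] => //.
  by apply/mapP; exists el2_0; rewrite ?phi2_z.
- split=> [||ab /mapP[x _ ->]]; last by rewrite /= !phi2_p2.
    rewrite map_inj_in_uniq ?undup_uniq // => x y /Hsp /andP[s1 s2] /Hsp /andP[s3 s4].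
    by case: x y s1 s2 s3 s4 => [x1 x2] [y1 y2] /= s1 s2 s3 s4 [] /(phi2_inj _ _ s1 s3)->
      /(phi2_inj _ _ s2 s4)->.
  by rewrite size_map Hcount.
- have Hw' : (- w) ^+ 2 = phi1 nr by rewrite sqrrN.
  move=> mu /mapP[x]; rewrite mem_undup !mem_cat => /or3P[/flattenP|/flattenP|/mapP[y /flattenP]].
  + move=> [_ /mapP[c Hc ->] Hx] ->.
    have [|u [v [r [rs H]]]] := Hcert w c sqr_w; first by rewrite mem_cat Hc.
    do 6 eexists; split; [exact: H|split; first exact: map_f].
    move=> _ /mapP[ab Hab ->]; apply: map_f; rewrite mem_undup mem_cat; apply/orP; left.
    by apply/flattenP; exists (par_of c) => //; apply: map_f.
  + move=> [_ /mapP[c Hc ->] Hx] ->.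
    have [|u [v [r [rs H]]]] := Hcert w c sqr_w; first by rewrite mem_cat Hc orbT.
    do 6 eexists; split; [exact: H|split; first exact: map_f].
    move=> _ /mapP[ab Hab ->]; apply: map_f; rewrite mem_undup !mem_cat; apply/or3P; apply: Or32.
    by apply/flattenP; exists (par_of c) => //; apply: map_f.
  (* A conjugate modulus is a modulus of the same curve read with -w. *)
  move=> [_ /mapP[c Hc ->] Hx] -> ->; rewrite phi2_conj.
  have [|u [v [r [rs H]]]] := Hcert (- w) c Hw'; first by rewrite mem_cat Hc orbT.
  do 6 eexists; split; [exact: H|split; first exact: map_f].
  move=> _ /mapP[ab Hab ->]; rewrite /phi2_pair -!phi2_conj.
  apply: (map_f (phi2_pair phi1 w) (x := (conj ab.1, conj ab.2))).
  rewrite mem_undup !mem_cat; apply/or3P; apply: Or33.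
  apply: (map_f (fun ab => (conj ab.1, conj ab.2))).
  by apply/flattenP; exists (par_of c) => //; apply: map_f.
- have Hw' : (- w) ^+ 2 = phi1 nr by rewrite sqrrN.
  move=> mu /mapP[x]; rewrite mem_undup !mem_cat => /or3P[/flattenP|/flattenP|/mapP[y /flattenP]].
  + move=> [_ /mapP[c Hc ->] Hx] ->.
    have [|u [v [r [rs H]]]] := Hcert w c sqr_w; first by rewrite mem_cat Hc.
    by do 6 eexists; split; [exact: H|exact: map_f].
  + move=> [_ /mapP[c Hc ->] Hx] ->.
    have [|u [v [r [rs H]]]] := Hcert w c sqr_w; first by rewrite mem_cat Hc orbT.
    by do 6 eexists; split; [exact: H|exact: map_f].
  move=> [_ /mapP[c Hc ->] Hx] -> ->; rewrite /phi2_pair !phi2_conj.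
  have [|u [v [r [rs H]]]] := Hcert (- w) c Hw'; first by rewrite mem_cat Hc orbT.
  by do 6 eexists; split; [exact: H|exact: (map_f (phi2_pair phi1 (- w)) Hx)].
Qed.

End CheckSoundness.

(** * Polynomials over an algebraically closed field *)

Section ClosedFieldPolynomials.

Variable K : closedFieldType.
Implicit Types P Q : {poly K}.

Lemma poly_eq_horner_neq0 P Q : (forall x, x != 0 -> P.[x] = Q.[x]) -> P = Q.
Proof.
move=> H; apply/eqP; rewrite -subr_eq0; apply: contraT => PQ0.
have /closed_nonrootP[x] : 'X * (P - Q) != 0 by rewrite mulf_neq0 ?polyX_eq0.
by rewrite rootM rootE hornerX rootE hornerD hornerN => /norP[x0]; rewrite H // subrr eqxx.
Qed.

Lemma poly_eq_horner P Q : (forall x, P.[x] = Q.[x]) -> P = Q.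
Proof. by move=> H; apply: poly_eq_horner_neq0. Qed.

Lemma closed_field_root (n : nat) (y : K) : (0 < n)%N -> exists x, x ^+ n = y.
Proof.
move=> n0; have [x /=] := @solve_monicpoly K n (fun i => if i == 0%N then y else 0) n0.
case: n n0 => // n _; rewrite big_ord_recl big1 /= ?mulr1 ?addr0 => [<-|i _]; first by exists x.
by rewrite mul0r.
Qed.

Lemma separable_closedP P :
  reflect (forall x, P.[x] = 0 -> P^`().[x] <> 0) (separable_poly P).
Proof.
rewrite unlock; apply: (iffP (Pdiv.ClosedField.coprimepP _ _)) => H x Px.
  by apply/eqP; apply: H; rewrite rootE Px.
by apply/eqP; apply: H; apply/eqP.
Qed.

(** Taylor's formula. The divided derivative, unlike n! times it, still carries the coefficient when
    n is at least p. *)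
Lemma coef_comp_linear P (d c : K) n :
  (P \Po (d *: 'X + c%:P))`_n = d ^+ n * P^`N(n).[c].
Proof.
have -> : P \Po (d *: 'X + c%:P) = \poly_(i < size P) (d ^+ i * P^`N(i).[c]).
  apply: poly_eq_horner => x; rewrite horner_comp hornerD hornerZ hornerX hornerC addrC.
  rewrite nderiv_taylor; last exact: mulrC.
  by rewrite horner_poly; apply: eq_bigr => i _; rewrite exprMn; ring.
rewrite coef_poly; case: ltnP => // Hn.
by rewrite nderivn_poly0 // horner0 mulr0.
Qed.

End ClosedFieldPolynomials.

(** * The polynomial R and the powers of f *)

Section ReversedCubic.

Variable K : closedFieldType.
Implicit Types a b : K.

Definition hrev a b : {poly K} := 1 + 'X + a *: 'X^2 + b *: 'X^3.

Lemma hrevE a b x : (hrev a b).[x] = 1 + x + a * x ^+ 2 + b * x ^+ 3.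
Proof. by rewrite /hrev !hornerE /=; ring. Qed.

Lemma deriv_hrevE a b x : (hrev a b)^`().[x] = 1 + 2%:R * a * x + 3%:R * b * x ^+ 2.
Proof. by rewrite /hrev !derivE !hornerE /=; ring. Qed.

Lemma HpolyE a b x : (Hpoly a b).[x] = x ^+ 10 + x ^+ 7 + a * x ^+ 4 + b * x.
Proof. by rewrite /Hpoly !hornerE /=; ring. Qed.

Lemma deriv_HpolyE a b x :
  (Hpoly a b)^`().[x] = 10%:R * x ^+ 9 + 7%:R * x ^+ 6 + 4%:R * a * x ^+ 3 + b.
Proof. by rewrite /Hpoly !derivE !hornerE /=; ring. Qed.

Lemma horner_Hpoly a b x : x != 0 ->
  (Hpoly a b).[x] = x ^+ 10 * (hrev a b).[x ^- 3].
Proof. by move=> x0; rewrite HpolyE hrevE; field. Qed.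

Lemma hrev_size a b : (size (hrev a b) <= 4)%N.
Proof.
apply/leq_sizeP => j Hj; rewrite !(coefD, coefZ, coefX, coefXn, coef1).
by case: j Hj => [|[|[|[|j]]]] //= _; ring.
Qed.

Lemma hrev_coef a b : [/\ (hrev a b)`_0 = 1, (hrev a b)`_1 = 1,
  (hrev a b)`_2 = a & (hrev a b)`_3 = b].
Proof.
rewrite !(coefD, coefZ, coefX, coefXn, coef1) /=; split; ring.
Qed.

Lemma size_exp_hrev a b m : (size (hrev a b ^+ m) <= (3 * m).+1)%N.
Proof.
apply: leq_trans (size_poly_exp_leq _ _) _; rewrite ltnS leq_mul //.
by have := hrev_size a b; lia.
Qed.

Lemma exp_Hpoly a b m :
  Hpoly a b ^+ m = \sum_(n < (3 * m).+1) (hrev a b ^+ m)`_n *: 'X^(10 * m - 3 * n).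
Proof.
apply: poly_eq_horner_neq0 => x x0.
rewrite horner_exp horner_Hpoly // exprMn -horner_exp.
rewrite (horner_coef_wide _ (size_exp_hrev a b m)) mulr_sumr horner_sum.
apply: eq_bigr => n _; rewrite hornerZ hornerXn mulrCA; congr (_ * _).
rewrite -exprM -exprVn -exprM exprVn; apply: (mulIf (expf_neq0 (3 * n) x0)).
rewrite divfK ?expf_neq0 // -exprD subnK //; move: (ltn_ord n); lia.
Qed.

Lemma coef_exp_Hpoly a b m n : (n <= 3 * m)%N ->
  (Hpoly a b ^+ m)`_(10 * m - 3 * n) = (hrev a b ^+ m)`_n.
Proof.
move=> Hn; rewrite exp_Hpoly coef_sum -ltnS in Hn *.
rewrite (bigD1 (Ordinal Hn)) //= big1 ?addr0 => [|i ni].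
  by rewrite coefZ coefXn eqxx mulr1.
rewrite coefZ coefXn; case: eqP => [E|_]; last by rewrite mulr0.
case/eqP: ni; apply: val_inj => /=; move: E (ltn_ord i) Hn; rewrite !ltnS; lia.
Qed.

Lemma coef_exp_Hpoly0 a b m t :
  (forall n, (n <= 3 * m)%N -> t = (10 * m - 3 * n)%N -> (hrev a b ^+ m)`_n = 0) ->
  (Hpoly a b ^+ m)`_t = 0.
Proof.
move=> H; rewrite exp_Hpoly coef_sum big1 // => i _.
rewrite coefZ coefXn; case: eqP => [E|_]; last by rewrite mulr0.
by rewrite (H i) ?mul0r // -ltnS.
Qed.

(** At 0 the derivative of f is b. Away from 0, differentiating x^10 R(x^-3) at a root leaves -3 x^6
    R'(x^-3), and every root of R is some x^-3 because R(0) = 1. *)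
Lemma separable_Hpoly a b : 3%:R != 0 :> K ->
  separable_poly (Hpoly a b) <-> b != 0 /\ separable_poly (hrev a b).
Proof.
move=> K3.
have dH x : x != 0 -> (Hpoly a b)^`().[x] =
    10%:R * x ^+ 9 * (hrev a b).[x ^- 3] - 3%:R * x ^+ 6 * (hrev a b)^`().[x ^- 3].
  by move=> x0; rewrite deriv_HpolyE deriv_hrevE hrevE; field.
split.
- move/separable_closedP => H; split.
    apply/eqP => b0; by apply: (H 0); rewrite ?HpolyE ?deriv_HpolyE b0; ring.
  apply/separable_closedP => y Ry dRy.
  have y0 : y != 0.
    apply/eqP => y0; move/eqP: Ry; rewrite y0 horner_coef0; have [-> _ _ _] := hrev_coef a b.
    by rewrite oner_eq0.
  have [x Hx] := closed_field_root (y^-1) (isT : 0 < 3)%N.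
  have x0 : x != 0 by apply: contraNneq y0 => x0; rewrite -invr_eq0 -Hx x0 expr0n.
  have yE : x ^- 3 = y by rewrite Hx invrK.
  by apply: (H x); rewrite ?horner_Hpoly // ?dH // yE Ry ?dRy !mulr0 ?subr0.
move=> [b0 /separable_closedP H]; apply/separable_closedP => x Hx dHx.
have [x0|x0] := eqVneq x 0.
  by move: b0; rewrite -dHx x0 deriv_HpolyE => /eqP[]; ring.
have R0 : (hrev a b).[x ^- 3] = 0.
  by move/eqP: Hx; rewrite horner_Hpoly // mulf_eq0 expf_eq0 /= (negPf x0) => /eqP.
apply: (H _ R0); move/eqP: dHx; rewrite dH // R0 mulr0 sub0r oppr_eq0.
by rewrite mulf_eq0 mulf_eq0 (negPf K3) (expf_eq0 x 6) (negPf x0) => /eqP.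
Qed.

End ReversedCubic.

(** * The differential operator that annihilates R^m *)

Section PowerOperator.

Variables (K : closedFieldType) (R : {poly K}) (m : nat).
Implicit Types y : {poly K}.

Definition power_op y : {poly K} := R * y^`() - m%:R *: (R^`() * y).

Lemma power_opB y z : power_op (y - z) = power_op y - power_op z.
Proof. by rewrite /power_op derivB -!mul_polyC; ring. Qed.

Lemma power_opZ c y : power_op (c *: y) = c *: power_op y.
Proof. by rewrite /power_op derivZ -!mul_polyC; ring. Qed.

Lemma power_op_exp : power_op (R ^+ m) = 0.
Proof.
rewrite /power_op deriv_exp scaler_nat mulrnAr; case: m => [|n]; first by rewrite !mulr0n subrr.
by rewrite /= exprS mulrCA subrr.
Qed.

(** In characteristic p this allows a truncation to be shifted by p degrees and compared with
    another one. *)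
Lemma power_op_Xp p y : p%:R = 0 :> K -> power_op ('X^p * y) = 'X^p * power_op y.
Proof.
move=> p0; rewrite /power_op derivM derivXn -(mulr_natl _ p) -polyC_natr p0.
by rewrite -!mul_polyC !polyC0; ring.
Qed.

(** If y = z R^j with j < m, the equation becomes R z' = (m - j) R' z. As R is prime to R' and m - j
    is invertible, R divides z, and j can be raised up to m. *)
Lemma power_op_dvd y : separable_poly R -> (forall i, (0 < i <= m)%N -> i%:R != 0 :> K) ->
  power_op y = 0 -> R ^+ m %| y.
Proof.
rewrite unlock => sepR natK Dy.
suff H j : (j <= m)%N -> R ^+ j %| y by exact: H.
elim: j => [|j IH] jm; first by rewrite dvd1p.
have /dvdpP[z yE] := IH (ltnW jm).
have R0 : R != 0.
  by apply/eqP => R0; move: sepR; rewrite R0 deriv0 coprime0p -size_poly_eq1 size_poly0.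
have E : R * z^`() = (m - j)%:R *: (R^`() * z).
  apply: (mulIf (expf_neq0 j R0)); apply/eqP; rewrite -subr_eq0 -Dy yE /power_op.
  rewrite derivM deriv_exp natrB ?(ltnW jm) // -!mul_polyC polyCB !polyC_natr; apply/eqP.
  by case: (j) => [|i]; rewrite ?mulr0n ?exprS /=; ring.
have /dvdpP[z' zE] : R %| z.
  rewrite -(Gauss_dvdpr z sepR) -(dvdpZr _ _ (natK (m - j)%N _)) ?subn_gt0 ?jm ?leq_subr //.
  by rewrite -E dvdp_mulr.
by rewrite yE zE exprS -mulrA dvdp_mull.
Qed.

(** Thanks to the two zeros, the truncation agrees with P up to degree n+1, so its image agrees with
    that of P, which is 0, up to degree n. Its own degree is below n and R has degree at most 3, so
    the image has degree at most n+1. *)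
Lemma power_op_take n (P := R ^+ m) : (0 < n)%N -> (size R <= 4)%N -> P`_n = 0 -> P`_n.+1 = 0 ->
  power_op (take_poly n P) = (power_op (take_poly n P))`_n.+1 *: 'X^(n.+1).
Proof.
move=> n0 sR Pn Pn1; apply/polyP=> i; rewrite coefZ coefXn; set L := take_poly n P.
have LP j : (j < n.+2)%N -> L`_j = P`_j.
  move=> Hj; rewrite coef_take_poly; case: ltngtP => // [|->]; last by rewrite Pn.
  by move=> nj; have -> : j = n.+1 by lia; rewrite Pn1.
case: eqP => [->|/eqP ni]; rewrite ?mulr1 // mulr0.
have [ni1|ni1] := ltnP i n.+1.
  transitivity ((power_op P)`_i); last by rewrite power_op_exp coef0.
  rewrite !coefB !coefZ !coefM; congr (_ - _ * _); apply: eq_bigr => j _.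
    by rewrite !coef_deriv LP //; move: (ltn_ord j); lia.
  by rewrite LP //; move: (ltn_ord j); lia.
have {ni ni1}ni : (n.+2 <= i)%N by rewrite ltn_neqAle eq_sym ni.
have sL : (size L <= n)%N by apply: size_take_poly.
have sD (Q : {poly K}) : (size Q^`() <= (size Q).-1)%N.
  by apply/leq_sizeP => j Hj; rewrite coef_deriv nth_default ?mul0rn // (leq_trans (leqSpred _)).
have sL' := sD L; have sR' := sD R.
have sR3 : (size R^`() <= 3)%N by apply: leq_trans sR' _; rewrite -subn1 leq_subLR.
have sLn : (size L^`() <= n.-1)%N by apply: leq_trans sL' _; rewrite -!subn1 leq_sub2r.
rewrite coefB coefZ !nth_default ?mulr0 ?subr0 //; apply: leq_trans (size_polyMleq _ _) _;
  rewrite -subn1 leq_subLR.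
  by apply: leq_trans (leq_add sR3 sL) _; rewrite add1n; lia.
by apply: leq_trans (leq_add sR sLn) _; rewrite add1n; lia.
Qed.

End PowerOperator.

(** * Consequences of two consecutive vanishing coefficients of R^m *)

Section Gaps.

Variables (K : closedFieldType) (a b : K) (p : nat).
Hypotheses (charK : p \in [pchar K]) (b0 : b != 0).
Hypothesis sepR : separable_poly (hrev a b).
Let R := hrev a b.

Lemma natf_lt_char i : (0 < i < p)%N -> i%:R != 0 :> K.
Proof.
move=> /andP[i0 ip]; rewrite -(dvdn_pcharf charK); apply/negP => /(dvdn_leq i0).
by rewrite leqNgt ip.
Qed.

Lemma size_hrev : size R = 4.
Proof.
apply/eqP; rewrite eqn_leq hrev_size ltnNge; apply/negP => /leq_sizeP/(_ 3 (leqnn _)).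
by have [_ _ _ ->] := hrev_coef a b => /eqP; rewrite (negPf b0).
Qed.

Lemma hrev_neq0 : R != 0.
Proof. by rewrite -size_poly_eq0 size_hrev. Qed.

Lemma size_hrev_exp m : size (R ^+ m) = (3 * m).+1.
Proof.
have := size_exp R m; rewrite size_hrev /= => <-.
by rewrite prednK // lt0n size_poly_eq0 expf_neq0 // hrev_neq0.
Qed.

Lemma hrev_exp_coef0 m : (R ^+ m)`_0 = 1.
Proof. by rewrite -horner_coef0 horner_exp hrevE; rewrite !expr0n /= !mulr0 !addr0 expr1n. Qed.

(** By degrees y is a constant multiple of R^m, whose constant term is 1. *)
Lemma hrev_exp_dvd m y : R ^+ m %| y -> (size y <= (3 * m).+1)%N -> y`_0 = 0 -> y = 0.
Proof.
move=> /dvdpP[q yE] sy y0; have Rm0 : R ^+ m != 0 by rewrite expf_neq0 ?hrev_neq0.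
have [q0|q0] := eqVneq q 0; first by rewrite yE q0 mul0r.
move: sy; rewrite yE size_mul // size_hrev_exp => sq.
have /size_poly1P[c c0 qE] : size q == 1%N.
  by rewrite eqn_leq lt0n size_poly_eq0 q0 andbT; move: sq;
    rewrite addnS /= -(add1n (3 * m)) leq_add2r.
by move/eqP: y0; rewrite yE qE coefCM hrev_exp_coef0 mulr1 (negPf c0).
Qed.

Lemma hrev_exp_coef_last m : (R ^+ m)`_(3 * m) != 0.
Proof.
by have := lead_coef_eq0 (R ^+ m); rewrite /lead_coef size_hrev_exp /= => ->;
  rewrite expf_neq0 ?hrev_neq0.
Qed.

Let p0 : p%:R = 0 :> K.
Proof. by apply/eqP; rewrite -(dvdn_pcharf charK). Qed.

(** The low part L of P and its high part U satisfy D L = A X^(2k) and D U = B X^(8k+1) for the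
    operator D. Multiplication by X^p commutes with D and carries the first exponent to the second,
    so B X^p L - A U lies in the kernel. *)
Lemma no_double_gap k (P := R ^+ (3 * k)) : p = (6 * k).+1 -> (0 < k)%N ->
  P`_(2 * k).-1 = 0 -> P`_(2 * k) = 0 -> P`_(8 * k) = 0 -> P`_(8 * k).+1 = 0 -> False.
Proof.
move=> pE k0 P1 P2 P3 P4.
pose L := take_poly (2 * k).-1 P; pose U := P - take_poly (8 * k) P.
pose D := power_op R (3 * k).
have [A DL] : exists A, D L = A *: 'X^(2 * k).
  have := @power_op_take K R (3 * k) (2 * k).-1 _ (hrev_size a b) P1.
  by rewrite prednK ?muln_gt0 // => H; rewrite /D H //; [by eexists|lia].
have [B DU] : exists B, D U = B *: 'X^((8 * k).+1).
  have := @power_op_take K R (3 * k) (8 * k) _ (hrev_size a b) P3 P4.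
  rewrite /D /U power_opB power_op_exp sub0r => ->; [rewrite -scaleNr; by eexists|lia].
have natK i : (0 < i <= 3 * k)%N -> i%:R != 0 :> K.
  by move=> Hi; apply: natf_lt_char; move: Hi; rewrite pE; lia.
have coefL i : L`_i = if (i < (2 * k).-1)%N then P`_i else 0 by rewrite coef_take_poly.
have coefU i : U`_i = if (i < 8 * k)%N then 0 else P`_i.
  by rewrite coefB coef_take_poly; case: ifP; rewrite ?subrr ?subr0.
have sL : (size L <= (2 * k).-1)%N by apply: size_take_poly.
have sU : (size U <= (9 * k).+1)%N.
  by apply/leq_sizeP => j Hj; rewrite coefU nth_default ?if_same // size_hrev_exp; lia.
(* W has degree at most 9k, the degree of P, and no constant term, so being in the kernel it is
   0. *)
pose W := B *: ('X^p * L) - A *: U.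
have W0 : W = 0.
  apply: (@hrev_exp_dvd (3 * k)).
  - apply: (power_op_dvd sepR natK).
    rewrite power_opB !power_opZ power_op_Xp // -/D DL DU !scalerA -scalerAr scalerA mulrC -exprD.
    by rewrite pE; have -> : ((6 * k).+1 + 2 * k = (8 * k).+1)%N by [lia]; rewrite subrr.
  - apply/leq_sizeP => j Hj; rewrite coefB !coefZ coefXnM coefL coefU.
    have -> : (j < p)%N = false by rewrite pE; lia.
    have -> : (j - p < (2 * k).-1)%N = false by rewrite pE; lia.
    by rewrite [P`_j]nth_default ?size_hrev_exp ?if_same ?mulr0 ?subrr //; lia.
  rewrite coefB !coefZ coefXnM coefU; have -> : (0 < p)%N by rewrite pE.
  by have -> : (0 < 8 * k)%N by [lia]; rewrite !mulr0 subrr.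
(* Degree p lies below 8k, where U starts, while X^p L has coefficient 1 there. *)
have B0 : B = 0.
  have := congr1 (fun Q : {poly K} => Q`_p) W0.
  rewrite coef0 coefB !coefZ coefXnM ltnn subnn coefL coefU.
  have -> : (0 < (2 * k).-1)%N by lia.
  have -> : (p < 8 * k)%N by rewrite pE; lia.
  by rewrite hrev_exp_coef0 mulr1 mulr0 subr0.
have U0 : U = 0.
  apply: (@hrev_exp_dvd (3 * k)).
  - by apply: (power_op_dvd sepR natK); rewrite -/D DU B0 scale0r.
  - by apply: leq_trans sU _; lia.
  by rewrite coefU; have -> : (0 < 8 * k)%N by lia.
(* With B = 0 the high part U itself is in the kernel and vanishes, although it contains the leading
   term of P. *)
have := hrev_exp_coef_last (3 * k); rewrite -/P.
have := congr1 (fun Q : {poly K} => Q`_(3 * (3 * k))) U0.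
rewrite coef0 coefU; have -> : (3 * (3 * k) < 8 * k)%N = false by lia.
by move=> ->; rewrite eqxx.
Qed.

(* For a truncation L of R^m at 4k+2, (L R^(m+1))' is a multiple of X^(4k+3) R^m, and a derivative
   has no terms of degree p-1 and 2p-1. *)
Lemma gap_reflection k (m := (3 * k + 2)%N) (P := R ^+ m) : p = (6 * k + 5)%N ->
  P`_(4 * k).+2 = 0 -> P`_(4 * k).+3 = 0 -> P`_(2 * k).+1 = 0 /\ P`_(8 * k + 6) = 0.
Proof.
move=> pE P1 P2.
pose L := take_poly (4 * k).+2 P; pose D := power_op R m.
have [A DL] : exists A, D L = A *: 'X^((4 * k).+3).
  by rewrite /D power_op_take ?hrev_size //; eexists.
have natK i : (0 < i <= m)%N -> i%:R != 0 :> K.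
  by move=> Hi; apply: natf_lt_char; move: Hi; rewrite pE /m; lia.
(* Otherwise R^m would divide L, which has smaller degree and constant term 1. *)
have A0 : A != 0.
  apply/eqP => A0; have L0 : L = 0.
    have : R ^+ m %| L by apply: (power_op_dvd sepR natK); rewrite -/D DL A0 scale0r.
    move/dvdp_leq => H; apply/eqP; apply: contraT => /H HL.
    by have := leq_trans HL (size_take_poly _ _); rewrite size_hrev_exp /m; lia.
  have := congr1 (fun Q : {poly K} => Q`_0) L0.
  by rewrite coef0 coef_take_poly /= hrev_exp_coef0 => /eqP; rewrite oner_eq0.
have pm : (p - m = m.+1)%N by rewrite pE /m; lia.
have E : (L * R ^+ m.+1)^`() = A *: ('X^((4 * k).+3) * P).
  rewrite scalerAl -DL derivM deriv_exp /= /D /power_op /P.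
  (* As 2m + 1 = p, the operator applied to L is, up to the factor R^m, the derivative of L
     R^(m+1). *)
  have -> : m%:R = - (m.+1)%:R :> K.
    by apply/eqP; rewrite -addr_eq0 -natrD -p0 pE /m; apply/eqP; congr (_%:R); lia.
  by rewrite -!mul_polyC polyCN !polyC_natr exprS; ring.
have coefE n : (p %| n.+1)%N -> ((4 * k).+3 <= n)%N -> P`_(n - (4 * k).+3) = 0.
  move=> pn kn; have := congr1 (fun Q : {poly K} => Q`_n) E.
  rewrite coef_deriv coefZ coefXnM ltnNge kn /= -mulr_natr.
  have -> : n.+1%:R = 0 :> K by apply/eqP; rewrite -(dvdn_pcharf charK).
  by rewrite mulr0 => /esym/eqP; rewrite mulf_eq0 (negPf A0) => /eqP.
split.
- have := coefE p.-1; rewrite prednK ?dvdnn; last by rewrite pE addnS.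
  have -> : (p.-1 - (4 * k).+3 = (2 * k).+1)%N by rewrite pE; lia.
  by apply; rewrite // pE; lia.
have := coefE (2 * p).-1; rewrite prednK; last by rewrite pE; lia.
have -> : ((2 * p).-1 - (4 * k).+3 = 8 * k + 6)%N by rewrite pE; lia.
by apply; rewrite ?dvdn_mull // pE; lia.
Qed.

End Gaps.

(** * The Cartier-Manin conditions as coefficients of R^m *)

Section Superspecial.

Variables (K : closedFieldType) (a b : K) (p : nat).
Hypothesis charK : p \in [pchar K].
Let R := hrev a b.

Lemma not_superspecial_mod1 k : p = (6 * k).+1 -> (0 < k)%N ->
  separable_poly (Hpoly a b) -> ~ superspecial 4 p (Hpoly a b).
Proof.
move=> pE k0 sep ss.
have K3 : 3%:R != 0 :> K by apply: (natf_lt_char charK); lia.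
have [b0 sepR] := (separable_Hpoly a b K3).1 sep.
have H i j n : (1 <= i <= 4)%N -> (1 <= j <= 4)%N -> (n <= 9 * k)%N ->
    (i * p - j = 30 * k - 3 * n)%N -> (R ^+ (3 * k))`_n = 0.
  move=> Hi Hj Hn E; rewrite -coef_exp_Hpoly; last by lia.
  have -> : (10 * (3 * k) = 30 * k)%N by lia.
  have mE : ((p - 1) %/ 2 = 3 * k)%N by rewrite pE; lia.
  by rewrite -E -mE; apply: ss.
apply: (no_double_gap charK b0 sepR pE k0).
(* The indices n with i p - j = 10 m - 3 n for (i, j) = (4,1), (4,4), (1,1), (1,4) are 2k-1, 2k, 8k
   and 8k+1. *)
- by apply: (H 4%N 1%N) => //; rewrite ?pE; lia.
- by apply: (H 4%N 4%N) => //; rewrite ?pE; lia.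
- by apply: (H 1%N 1%N) => //; rewrite ?pE; lia.
- by apply: (H 1%N 4%N) => //; rewrite ?pE; lia.
Qed.

(** All exponents in f^m are congruent to 10 m modulo 3. This leaves the entries (4,3), (3,1),
    (3,4), (2,2) and (1,3), in the order of the five conditions; the others vanish for every f. *)
Lemma superspecial_mod5 k (P := R ^+ (3 * k + 2)) : p = (6 * k + 5)%N ->
  superspecial 4 p (Hpoly a b) <->
  [/\ P`_(2 * k).+1 = 0, P`_(4 * k).+2 = 0, P`_(4 * k).+3 = 0, P`_(6 * k + 4) = 0 &
      P`_(8 * k + 6) = 0].
Proof.
move=> pE; have mE : ((p - 1) %/ 2 = 3 * k + 2)%N by rewrite pE; lia.
split=> [ss|[P1 P2 P3 P4 P5] i j Hi Hj].
  have H i j n : (1 <= i <= 4)%N -> (1 <= j <= 4)%N -> (n <= 9 * k + 6)%N ->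
      (i * p - j = 30 * k + 20 - 3 * n)%N -> P`_n = 0.
    move=> Hi Hj Hn E; rewrite /P -coef_exp_Hpoly; last by lia.
    have -> : (10 * (3 * k + 2) = 30 * k + 20)%N by lia.
    by rewrite -E -mE; apply: ss.
  split.
  - by apply: (H 4%N 3%N) => //; rewrite ?pE; lia.
  - by apply: (H 3%N 1%N) => //; rewrite ?pE; lia.
  - by apply: (H 3%N 4%N) => //; rewrite ?pE; lia.
  - by apply: (H 2%N 2%N) => //; rewrite ?pE; lia.
  - by apply: (H 1%N 3%N) => //; rewrite ?pE; lia.
rewrite mE; apply: coef_exp_Hpoly0 => n Hn E; rewrite -/R -/P.
case: i Hi E => [|[|[|[|[|i]]]]] // _ E; move: E Hn; rewrite pE => E Hn.
- by have -> : n = (8 * k + 6)%N by lia.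
- by have -> : n = (6 * k + 4)%N by lia.
- have [->|->] : n = (4 * k).+2 \/ n = (4 * k).+3 by lia.
    by [].
  by [].
by have -> : n = (2 * k).+1 by lia.
Qed.

End Superspecial.

(** * Expansions of the powers of an elliptic cubic *)

Section EllipticParameters.

Variable K : closedFieldType.

Definition cubic_poly (u v : K) : {poly K} := 'X * ('X^2 + u *: 'X + v%:P).

Lemma cubic_polyE u v x : (cubic_poly u v).[x] = cubic u v x.
Proof. by rewrite /cubic_poly /cubic !hornerE /=; ring. Qed.

Lemma hrev_param u v x (g := cubic u v x) (g' := cubic' u v x) : g != 0 -> g' != 0 ->
  hrev (param_at u v x).1 (param_at u v x).2 =
    g^-1 *: (cubic_poly u v \Po ((g / g') *: 'X + x%:P)).
Proof.
move=> g0 g'0; apply: poly_eq_horner => s; rewrite hrevE hornerZ horner_comp.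
rewrite cubic_polyE [_.[s]](_ : _ = g / g' * s + x); last by rewrite !hornerE.
rewrite /param_at /= -/g -/g'.
have -> : cubic u v (g / g' * s + x) =
   g + g' * (g / g' * s) + (3%:R * x + u) * (g / g' * s) ^+ 2 + (g / g' * s) ^+ 3.
  by rewrite /g /g' /cubic /cubic'; ring.
by field; rewrite g0 g'0.
Qed.

Lemma coef_exp_hrev_param m u v x n (g := cubic u v x) (g' := cubic' u v x) :
  g != 0 -> g' != 0 ->
  ((hrev (param_at u v x).1 (param_at u v x).2 ^+ m)`_n == 0) =
    ((cubic_poly u v ^+ m)^`N(n).[x] == 0).
Proof.
move=> g0 g'0; rewrite hrev_param // exprZn coefZ -rmorphXn /= coef_comp_linear.
have c0 : g^-1 ^+ m != 0 by apply: expf_neq0; apply: invr_neq0.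
have d0 : (g / g') ^+ n != 0 by apply: expf_neq0; apply: mulf_neq0 => //; apply: invr_neq0.
by rewrite mulf_eq0 (negPf c0) mulf_eq0 (negPf d0).
Qed.

Lemma coef_exp_cubic m u v j : (j <= 2 * m)%N ->
  (cubic_poly u v ^+ m)`_(m + j) = trinomial_coef u v m (2 * m - j).
Proof.
move=> Hj; rewrite /cubic_poly exprMn coefXnM addKn.
have -> : (m + j < m)%N = false by lia.
have sT : (size (1 + u *: 'X + v *: 'X^2 : {poly K})%R <= 3)%N.
  apply/leq_sizeP => i Hi; rewrite !(coefD, coefZ, coefX, coefXn, coef1).
  by case: i Hi => [|[|[|i]]] //= _; ring.
have -> : ('X^2 + u *: 'X + v%:P) ^+ m = \poly_(i < (2 * m).+1) trinomial_coef u v m (2 * m - i).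
  apply: poly_eq_horner_neq0 => x x0; rewrite horner_exp !hornerE /=.
  have -> : x ^+ 2 + u * x + v = x ^+ 2 * (1 + u *: 'X + v *: 'X^2).[x^-1].
    by rewrite !hornerE /=; field.
  rewrite exprMn -horner_exp (@horner_coef_wide _ (2 * m).+1); last first.
    by apply: leq_trans (size_poly_exp_leq _ _) _; rewrite ltnS leq_mul // -subn1 leq_subLR.
  rewrite mulr_sumr horner_poly (reindex_inj rev_ord_inj) /=.
  apply: eq_bigr => i _; rewrite subSS mulrCA; congr (_ * _).
  rewrite -exprM exprVn; apply: (mulIf (expf_neq0 (2 * m - i) x0)).
  by rewrite mulfVK ?expf_neq0 // -exprD subnKC // -ltnS.
by rewrite coef_poly ltnS Hj.
Qed.

(** Substitute c X for X: u has weight 1 and v has weight 2. *)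
Lemma trinomial_coef_scale m (c u v : K) i :
  trinomial_coef (c * u) (c ^+ 2 * v) m i = c ^+ i * trinomial_coef u v m i.
Proof.
rewrite /trinomial_coef.
have -> : 1 + (c * u) *: 'X + (c ^+ 2 * v) *: 'X^2 = (1 + u *: 'X + v *: 'X^2) \Po (c *: 'X + 0%:P).
  apply: poly_eq_horner => s; rewrite horner_comp !hornerE /=; ring.
rewrite -rmorphXn /= coef_comp_linear; congr (_ * _).
by rewrite horner_coef0 coef_nderivn addn0 binn.
Qed.

(** The substitution of v X for X in X^2 + u X + v gives v times the reversed trinomial, so the
    coefficients of its m-th power are symmetric about m up to powers of v. *)
Lemma trinomial_coef_reverse m (u v : K) i : v != 0 -> (i <= m)%N ->
  trinomial_coef u v m (m + i) = v ^+ i * trinomial_coef u v m (m - i).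
Proof.
move=> v0 Hi.
have E : ('X^2 + u *: 'X + v%:P) \Po (v *: 'X + 0%:P) = v *: (1 + u *: 'X + v *: 'X^2).
  by apply: poly_eq_horner => s; rewrite horner_comp !hornerE /=; ring.
have := congr1 (fun P : {poly K} => (P ^+ m)`_(m - i)) E.
have := @coef_exp_cubic m u v (m - i).
rewrite /cubic_poly exprMn coefXnM ltnNge leq_addr /= addKn => H.
rewrite exprZn coefZ -rmorphXn /= coef_comp_linear horner_coef0 coef_nderivn addn0 binn mulr1n.
rewrite H; last by lia.
have -> : (2 * m - (m - i) = m + i)%N by lia.
move=> E1; apply: (mulfI (expf_neq0 (m - i) v0)).
by rewrite E1 mulrA -exprD subnK.
Qed.

Lemma size_exp_cubic m u v : (size (cubic_poly u v ^+ m) <= (3 * m).+1)%N.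
Proof.
apply: leq_trans (size_poly_exp_leq _ _) _; rewrite ltnS leq_mul //.
have : (size (cubic_poly u v) <= 4)%N; last by case: (size _).
apply/leq_sizeP => i Hi; rewrite /cubic_poly coefXM !(coefD, coefZ, coefX, coefXn, coefC).
by case: i Hi => [|[|[|[|i]]]] //= _; ring.
Qed.

End EllipticParameters.

Lemma deriv_nderivn (R : nzRingType) (P : {poly R}) n :
  P^`N(n)^`() = P^`N(n.+1) *+ n.+1.
Proof.
apply/polyP=> i; rewrite coef_deriv coefMn !coef_nderivn -!mulrnA addnS addSn.
congr (_ *+ _); rewrite [RHS]mulnC mul_bin_left mulnC; congr (_ * _)%N; lia.
Qed.

Lemma bin_addn n i : 'C(n + i, n) = 'C(n + i, i).
Proof. by rewrite -(bin_sub (leq_addr i n)) addKn. Qed.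

(** * Divided derivatives in characteristic p = 6k+5 *)

Section CharacteristicP.

Variables (K : closedFieldType) (p k : nat).
Hypotheses (charK : p \in [pchar K]) (pE : p = (6 * k + 5)%N).
Let m := (3 * k + 2)%N.

Lemma natr_fact_neq0 n : (n < p)%N -> n`!%:R != 0 :> K.
Proof.
elim: n => [|n IH] np; first by rewrite oner_eq0.
by rewrite factS natrM mulf_neq0 ?IH ?(natf_lt_char charK) ?np // ltnW.
Qed.

(** The case of Kummer's theorem in which the addition of two one-digit numbers carries in base
    p. *)
Lemma bin_carry n i : (n < p)%N -> (i < p)%N -> (p <= n + i)%N -> 'C(n + i, n)%:R = 0 :> K.
Proof.
move=> np ip pni; apply/eqP; have := bin_fact (leq_addr i n); rewrite addKn.
move/(congr1 (fun j => j%:R : K)); rewrite !natrM => /eqP.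
have -> : (n + i)`!%:R = 0 :> K.
  apply/eqP; rewrite -(dvdn_pcharf charK) dvdn_fact //.
  by rewrite prime_gt0 ?pni // (pcharf_prime charK).
by rewrite !mulf_eq0 (negPf (natr_fact_neq0 np)) (negPf (natr_fact_neq0 ip)) !orbF.
Qed.

Variables (u v : K).
Let Q := cubic_poly u v ^+ m.
Local Notation E := (trinomial_coef u v m).

Let Q0 j : (3 * m < j)%N -> Q`_j = 0.
Proof. by move=> Hj; rewrite nth_default // (leq_trans (size_exp_cubic _ _ _)). Qed.

(** The order is p - 1, so every binomial factor beyond the constant term carries and vanishes. The
    constant term is the coefficient of x^(p-1) in c^m, the Hasse invariant. *)
Lemma nderivn_supersingular : Q^`N(6 * k + 4) = (E m)%:P.
Proof.
have p_prime := pcharf_prime charK.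
apply/polyP=> i; rewrite coef_nderivn coefC; case: i => [|i] /=.
  rewrite addn0 binn mulr1n; have -> : (6 * k + 4 = m + m)%N by rewrite /m; lia.
  by rewrite coef_exp_cubic ?mul2n -?addnn ?addnK ?leq_addr.
have [im|im] := leqP i.+1 m; last by rewrite Q0 ?mul0rn //; move: im; rewrite /m; lia.
by rewrite -mulr_natr bin_carry ?mulr0 // pE; move: im; rewrite /m; lia.
Qed.

Lemma nderivn_polyB : Q^`N(8 * k + 6) = polyB u v k (fun i => 'C((8 * k).+2.+4 + i, i)%:R).
Proof.
apply/polyP=> i; rewrite coef_nderivn coef_poly; case: ltnP => ik; last first.
  by rewrite Q0 ?mul0rn // /m; lia.
have -> : (8 * k + 6 + i = m + (5 * k + 4 + i))%N by rewrite /m; lia.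
rewrite coef_exp_cubic; last by rewrite /m; lia.
rewrite mulr_natl; have -> : (2 * m - (5 * k + 4 + i) = k - i)%N by rewrite /m; lia.
have -> : (m + (5 * k + 4 + i) = (8 * k).+2.+4 + i)%N by rewrite /m; lia.
by have -> : (8 * k + 6 = (8 * k).+2.+4)%N by [lia]; rewrite bin_addn.
Qed.

Hypotheses (v0 : v != 0) (Em : E m = 0).
Let polyG := polyG u v k (fun i => 'C((4 * k).+2 + i, i)%:R).

(** For i at most 2k+1 the trinomial coefficient is reflected about m, which produces the power of
    v. At i = 2k+2 it is e_m, zero by supersingularity. Beyond that 4k+2+i reaches p and the
    binomial carries. *)
Lemma nderivn_polyG : Q^`N((4 * k).+2) = v *: polyG.
Proof.
apply/polyP=> i; rewrite coef_nderivn coefZ coef_poly -/m.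
have [im|im] := leqP ((4 * k).+2 + i) (3 * m); last first.
  by rewrite Q0 // mul0rn; case: ifP; rewrite ?mulr0 //; move: im; rewrite /m; lia.
have -> : Q`_((4 * k).+2 + i) = E (5 * k + 4 - i).
  have -> : ((4 * k).+2 + i = m + (k + i))%N by rewrite /m; lia.
  rewrite coef_exp_cubic; last by move: im; rewrite /m; lia.
  by congr E; rewrite /m; lia.
have [ik|ik] := ltnP i (2 * k).+2.
  have -> : (5 * k + 4 - i = m + (2 * k + 2 - i))%N by rewrite /m; lia.
  rewrite trinomial_coef_reverse //; last by rewrite /m; lia.
  have -> : (m - (2 * k + 2 - i) = k + i)%N by rewrite /m; lia.
  have -> : (2 * k + 2 - i = ((2 * k).+1 - i).+1)%N by lia.
  by rewrite bin_addn -mulr_natr exprS; ring.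
rewrite mulr0; have [->|ik2] := eqVneq i (2 * k).+2.
  by have -> : (5 * k + 4 - (2 * k).+2 = m)%N; [rewrite /m; lia|rewrite Em mul0rn].
by rewrite -mulr_natr bin_carry ?mulr0 // pE; move: im; rewrite /m; lia.
Qed.

Lemma nderivn_deriv_polyG : Q^`N((4 * k).+3) *+ (4 * k).+3 = v *: polyG^`().
Proof. by rewrite -deriv_nderivn nderivn_polyG derivZ. Qed.

End CharacteristicP.

(** * The conditions on an expansion point *)

Section ParameterConditions.

Variables (K : closedFieldType) (p k : nat) (u v x : K).
Hypotheses (charK : p \in [pchar K]) (pE : p = (6 * k + 5)%N).
Let m := (3 * k + 2)%N.
Hypotheses (v0 : v != 0) (g0 : cubic u v x != 0) (g'0 : cubic' u v x != 0).
Let P := hrev (param_at u v x).1 (param_at u v x).2 ^+ m.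
Let polyG := polyG u v k (fun i => 'C((4 * k).+2 + i, i)%:R).
Let polyB := polyB u v k (fun i => 'C((8 * k).+2.+4 + i, i)%:R).

Lemma supersingular_param : (P`_(6 * k + 4) == 0) = (trinomial_coef u v m m == 0).
Proof. by rewrite coef_exp_hrev_param // (nderivn_supersingular charK) // hornerC. Qed.

Lemma polyB_param : (P`_(8 * k + 6) == 0) = (polyB.[x] == 0).
Proof. by rewrite coef_exp_hrev_param // (nderivn_polyB charK). Qed.

Hypothesis Em : trinomial_coef u v m m = 0.

Lemma polyG_param : (P`_(4 * k).+2 == 0) = (polyG.[x] == 0).
Proof.
rewrite coef_exp_hrev_param // (nderivn_polyG charK) // hornerZ mulf_eq0.
by rewrite (negPf v0).
Qed.

Lemma deriv_polyG_param : (P`_(4 * k).+3 == 0) = (polyG^`().[x] == 0).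
Proof.
have K0 : (4 * k).+3%:R != 0 :> K by apply: (natf_lt_char charK); rewrite pE; lia.
have := congr1 (horner^~ x) (nderivn_deriv_polyG charK pE v0 Em).
rewrite /= hornerMn hornerZ -mulr_natl => E.
rewrite coef_exp_hrev_param //; apply/eqP/eqP => E0.
  by apply/eqP; move/eqP: E; rewrite E0 mulr0 eq_sym mulf_eq0 (negPf v0).
by apply/eqP; move/eqP: E; rewrite E0 mulr0 mulf_eq0 (negPf K0).
Qed.

End ParameterConditions.

(** * The polynomial of supersingular moduli *)

Section Moduli.

Variables (K : closedFieldType) (m : nat).

(** The Hasse invariant of the representative u = v = t of the modulus t, divided by a power of t.
    It is the analogue, for one marked 2-torsion point, of Deuring's polynomial for the Legendre
    form. *)
Definition modulus_poly : {poly K} :=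
  \poly_(i < m./2.+1) ('C(m, uphalf m + i)%:R * 'C(uphalf m + i, m - (uphalf m + i))%:R).

Lemma modulus_poly_neq0 : modulus_poly != 0.
Proof.
apply/eqP => E; have := congr1 (fun P : {poly K} => P`_(m./2)) E.
rewrite coef_poly leqnn coef0; have -> : (uphalf m + m./2 = m)%N by rewrite uphalf_half -addnA
  addnn odd_double_half.
by rewrite subnn bin0 binn mulr1 => /eqP; rewrite oner_eq0.
Qed.

Lemma coef_exp_1DX (R : nzRingType) n i : (((1 + 'X) : {poly R}) ^+ n)`_i = 'C(n, i)%:R.
Proof.
rewrite exprDn_comm; last exact: commr1 || (apply: commr_sym; exact: commr1).
have -> : \sum_(j < n.+1) (1 ^+ (n - j) * 'X^j *+ 'C(n, j)) = \poly_(j < n.+1) 'C(n,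
  j)%:R :> {poly R}.
  by rewrite poly_def; apply: eq_bigr => j _; rewrite expr1n mul1r scaler_nat.
by rewrite coef_poly ltnS; case: leqP => // /bin_small ->.
Qed.

(** Expand (1 + t X (1 + X))^m binomially; the factor C(j, m-j) vanishes when 2 j < m, so t^j occurs
    only from the upper half of m on. *)
Lemma trinomial_coef_modulus (t : K) :
  trinomial_coef t t m m = t ^+ uphalf m * modulus_poly.[t].
Proof.
have -> : trinomial_coef t t m m = \sum_(0 <= j < m.+1) 'C(m, j)%:R * t ^+ j * 'C(j, m - j)%:R.
  rewrite /trinomial_coef.
  have -> : 1 + t *: 'X + t *: 'X^2 = 1 + t%:P * 'X * (1 + 'X) :> {poly K}.
    by rewrite -!mul_polyC; ring.
  rewrite exprDn coef_sum big_mkord; apply: eq_bigr => j _.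
  rewrite expr1n mul1r coefMn !exprMn -mulrA -rmorphXn /= coefCM coefXnM coef_exp_1DX.
  by rewrite ltnNge -ltnS ltn_ord /= mulr_natl mulrnAl.
have hm : (uphalf m <= m.+1)%N by rewrite uphalf_half; have := odd_double_half m; rewrite -mul2n;
  case: (odd m) => /=; lia.
rewrite (@big_cat_nat _ _ _ (uphalf m)) //= big_nat_cond big1 ?add0r => [|j]; last first.
  rewrite andbT => /andP[_ jm]; rewrite (@bin_small j) ?mulr0 //.
  by move: jm; rewrite uphalf_half; have := odd_double_half m; rewrite -mul2n; case: (odd m) => /=;
    lia.
rewrite -{1}[uphalf m]add0n big_addn.
have -> : (m.+1 - uphalf m = m./2.+1)%N.
  by rewrite uphalf_half; have := odd_double_half m; rewrite -mul2n; case: (odd m) => /=; lia.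
rewrite big_mkord horner_poly mulr_sumr; apply: eq_bigr => i _.
by rewrite addnC exprD; ring.
Qed.

Lemma trinomial_coef_even (v : K) : ~~ odd m ->
  trinomial_coef 0 v m m = 'C(m, m./2)%:R * v ^+ m./2.
Proof.
move=> odm; rewrite /trinomial_coef scale0r addr0 exprDn coef_sum.
have hm : (m./2 < m.+1)%N by have := odd_double_half m; rewrite -mul2n; lia.
rewrite (bigD1 (Ordinal hm)) //= big1 ?addr0 => [|j jm].
  rewrite expr1n mul1r coefMn exprZn coefZ -exprM coefXn.
  by rewrite mul2n even_halfK // eqxx mulr1 mulr_natl.
rewrite expr1n mul1r coefMn exprZn coefZ -exprM coefXn; case: eqP => [E|];
  rewrite ?mulr0 ?mul0rn //.
by case/eqP: jm; apply: val_inj => /=; have := odd_double_half m; rewrite -mul2n (negbTE odm);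
  move: E; lia.
Qed.

End Moduli.

(** * Change of the marked 2-torsion point *)

Section Translation.

Variables (K : closedFieldType) (p k : nat) (u v r : K).
Hypotheses (charK : p \in [pchar K]) (pE : p = (6 * k + 5)%N).
Hypothesis Hr : r ^+ 2 + u * r + v = 0.
Let u' := (shifted u r).1.
Let v' := (shifted u r).2.
Let m := (3 * k + 2)%N.

Lemma shifted_v : v' = 3%:R * r ^+ 2 + 2%:R * u * r + v.
Proof. by rewrite /v' /shifted /= -[LHS]addr0 -Hr; ring. Qed.

Lemma cubic_shift x : cubic u' v' x = cubic u v (x + r).
Proof.
transitivity (cubic u v (x + r) - r * (r ^+ 2 + u * r + v)); last by rewrite Hr mulr0 subr0.
by rewrite shifted_v /cubic /u' /shifted /=; ring.
Qed.

Lemma cubic'_shift x : cubic' u' v' x = cubic' u v (x + r).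
Proof. by rewrite shifted_v /cubic' /u' /shifted /=; ring. Qed.

Lemma param_at_shift x : param_at u' v' x = param_at u v (x + r).
Proof.
rewrite /param_at cubic_shift cubic'_shift; congr (_ * _ / _, _).
by rewrite /u' /shifted /=; ring.
Qed.

(** The Hasse invariant is the divided derivative of order p - 1 of c^m; that polynomial is
    constant, so its values at 0 and at r agree. *)
Lemma supersingular_shift : trinomial_coef u' v' m m = trinomial_coef u v m m.
Proof.
have E : cubic_poly u' v' = cubic_poly u v \Po (1 *: 'X + r%:P).
  apply: poly_eq_horner => x; rewrite horner_comp !cubic_polyE cubic_shift.
  by congr cubic; rewrite !hornerE.
have := coef_exp_cubic (m := m) u' v' (j := m).
rewrite mul2n -addnn addnK => <-; rewrite ?leq_addr // E -rmorphXn /= coef_comp_linear.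
have -> : (m + m = 6 * k + 4)%N by rewrite /m; lia.
by rewrite (nderivn_supersingular charK pE) hornerC expr1n mul1r.
Qed.

End Translation.

Lemma param_at_scale (K : fieldType) (c u v x : K) : c != 0 ->
  cubic u v x != 0 -> cubic' u v x != 0 ->
  param_at (c * u) (c ^+ 2 * v) (c * x) = param_at u v x.
Proof.
move=> c0 g0 g'0; rewrite /param_at.
have -> : cubic (c * u) (c ^+ 2 * v) (c * x) = c ^+ 3 * cubic u v x by rewrite /cubic; ring.
have -> : cubic' (c * u) (c ^+ 2 * v) (c * x) = c ^+ 2 * cubic' u v x by rewrite /cubic'; ring.
by congr (_, _); field; rewrite c0 g'0.
Qed.

(** The scaling factor is u/u', or a square root of v/v' when u' = 0. *)
Lemma modulus_of_eq (K : closedFieldType) (u v u' v' : K) : v != 0 -> v' != 0 ->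
  modulus_of (u, v) = modulus_of (u', v') ->
  exists c, [/\ c != 0, u = c * u' & v = c ^+ 2 * v'].
Proof.
rewrite /modulus_of /= => v0 v'0 E.
have [u'0|u'0] := eqVneq u' 0.
  have u0 : u = 0.
    apply/eqP; move/eqP: E; rewrite u'0 expr0n mul0r mulf_eq0 invr_eq0 (negPf v0) orbF.
    by rewrite expf_eq0.
  have [c Hc] := closed_field_root (v / v') (isT : 0 < 2)%N.
  exists c; rewrite u0 u'0 mulr0 Hc divfK //; split=> //.
  apply/eqP => c0; move/eqP: Hc; rewrite c0 expr0n eq_sym mulf_eq0 invr_eq0.
  by rewrite (negPf v0) (negPf v'0).
have u0 : u != 0.
  apply/eqP => u0; move/eqP: E; rewrite u0 expr0n mul0r eq_sym mulf_eq0 invr_eq0.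
  by rewrite (negPf v'0) orbF expf_eq0 (negPf u'0).
exists (u / u'); split; rewrite ?mulf_neq0 ?invr_neq0 ?divfK //.
have -> : v = u ^+ 2 / (u ^+ 2 / v) by field; rewrite v0 u0.
by rewrite E; field; rewrite v'0 u'0.
Qed.

(** * The certified lists give all superspecial parameters *)

Section Classification.

Variables (K : closedFieldType) (p k : nat).
Hypotheses (charK : p \in [pchar K]) (pE : p = (6 * k + 5)%N).
Let m := (3 * k + 2)%N.

(** The constants v of the three translated cubics are the values of c' at the roots 0, r and -(r +
    u) of c. Hence c is separable, and so is the polynomial obtained from it by an affine
    substitution. *)
Lemma certified_separable (u v r x : K) rs ms abs :
  certified k (fun i => 'C((4 * k).+2 + i, i)%:R)
    (fun i => 'C((8 * k).+2.+4 + i, i)%:R) u v r rs ms abs ->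
  cubic u v x != 0 -> cubic' u v x != 0 ->
  separable_poly (hrev (param_at u v x).1 (param_at u v x).2) :> Prop.
Proof.
move=> [v0 Hr s0 s'0 _ _ _ _ _] g0 g'0; apply/separable_closedP => y.
have d0 : cubic u v x / cubic' u v x != 0 by apply: mulf_neq0 => //; apply: invr_neq0.
rewrite hrev_param // derivZ deriv_comp !hornerZ hornerM !horner_comp.
set d := _ / _ in d0 *; set y' := (_ *: _ + _).[y].
have -> : (d *: 'X + x%:P)^`() = d%:P :> {poly K} by rewrite !derivE addr0 alg_polyC.
have -> : (cubic_poly u v)^`().[y'] = cubic' u v y'.
  by rewrite /cubic_poly /cubic' !derivE !hornerE /=; ring.
have unit_g : (cubic u v x)^-1 != 0 by apply: invr_neq0.
rewrite cubic_polyE hornerC => /eqP; rewrite mulf_eq0 (negPf unit_g) /= => /eqP gy.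
move/eqP; rewrite mulf_eq0 (negPf unit_g) /= mulf_eq0 (negPf d0) orbF => /eqP g'y.
have : y' * ((y' - r) * (y' + r + u)) = 0.
  transitivity (cubic u v y' - y' * (r ^+ 2 + u * r + v)); first by rewrite /cubic; ring.
  by rewrite gy Hr mulr0 subr0.
have Hr' : (- (r + u)) ^+ 2 + u * - (r + u) + v = 0 by rewrite -Hr; ring.
move/eqP; rewrite !mulf_eq0 => /or3P[] /eqP E.
- by move: v0; rewrite -g'y E /cubic' => /eqP[]; ring.
- move: s0; rewrite (shifted_v Hr) => /eqP[]; rewrite -[RHS]g'y.
  by have -> : y' = r by apply/eqP; rewrite -subr_eq0 E.
move: s'0; rewrite (shifted_v Hr') => /eqP[]; rewrite -[RHS]g'y.
by have -> : y' = - (r + u) by apply/eqP; rewrite -addr_eq0 addrA E.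
Qed.

(** For a root s of R take the monic cubic R(X + s)/b, which vanishes at 0, and expand it at -s: its
    value and its slope there are both 1/b, because R starts with 1 + X. *)
Lemma hrev_root_param (a b : K) : b != 0 -> separable_poly (hrev a b) ->
  exists u v x, [/\ v != 0, cubic u v x != 0, cubic' u v x != 0 & (a, b) = param_at u v x].
Proof.
move=> b0 /separable_closedP sepR.
have [s /rootP Hs] : exists s, root (hrev a b) s by apply/closed_rootP; rewrite size_hrev.
have := sepR _ Hs; rewrite deriv_hrevE => /eqP R'0; move: Hs; rewrite hrevE => Hs.
pose u := (a + 3%:R * b * s) / b.
pose v := (1 + 2%:R * a * s + 3%:R * b * s ^+ 2) / b.
have gE : cubic u v (- s) = b^-1.
  apply: (mulIf b0); rewrite mulVf // -[LHS]addr0 -Hs /cubic /u /v; field.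
  exact: b0.
have g'E : cubic' u v (- s) = b^-1.
  by rewrite /cubic' /u /v; field.
exists u, v, (- s); rewrite gE g'E; split; rewrite ?invr_eq0 //.
  by apply: mulf_neq0; rewrite ?invr_eq0.
by rewrite /param_at gE g'E /u; congr (_, _); field; rewrite b0 oner_neq0.
Qed.

Variables (ms : seq K) (abs : seq (K * K)).
Hypothesis uniq_ms : uniq ms.
Hypothesis size_ms : size [seq x <- ms | x != 0] = m./2.
Hypothesis ms0 : 0 \in ms \/ ~~ odd m.
Hypothesis cert_ms :
  {in ms, forall mu, certified_by k (fun ms' abs' => mu \in ms' /\ {subset abs' <= abs})}.
Hypothesis cert_abs : {in abs, forall ab, certified_by k (fun ms' abs' => ab \in abs')}.

(** Scaling by u/v makes both coefficients equal to u^2/v without affecting the vanishing of the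
    Hasse invariant. *)
Lemma supersingular_modulus (u v : K) : u != 0 -> v != 0 ->
  trinomial_coef u v m m = 0 -> root (modulus_poly K m) (modulus_of (u, v)).
Proof.
move=> u0 v0 Em; rewrite /modulus_of /=; set mu := _ / _.
have mu0 : mu != 0 by rewrite mulf_neq0 ?invr_neq0 ?expf_neq0.
have := trinomial_coef_scale m (u / v) u v m.
have -> : u / v * u = mu by rewrite /mu; field.
have -> : (u / v) ^+ 2 * v = mu by rewrite /mu; field.
rewrite Em mulr0 trinomial_coef_modulus => /eqP.
by rewrite mulf_eq0 (negPf (expf_neq0 _ mu0)).
Qed.

(** All nonzero listed moduli are roots of [modulus_poly], of degree m/2 rounded down; their number
    leaves no room for another root. When u = 0 and m is even, the Hasse invariant is C(m, m/2)
    v^(m/2), nonzero because m < p; when m is odd, 0 is in the list. *)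
Lemma moduli_complete (u v : K) : v != 0 -> trinomial_coef u v m m = 0 ->
  modulus_of (u, v) \in ms.
Proof.
move=> v0 Em; have [u0|u0] := eqVneq u 0.
  rewrite u0 /modulus_of /= expr0n mul0r; case: ms0 => // odm.
  move/eqP: Em; rewrite u0 trinomial_coef_even // mulf_eq0 expf_eq0 (negPf v0) andbF orbF.
  have : m`!%:R != 0 :> K by apply: (natr_fact_neq0 charK); rewrite /m pE; lia.
  rewrite -(@bin_fact m m./2); last by have := odd_double_half m; rewrite -mul2n; lia.
  by rewrite natrM mulf_eq0 negb_or => /andP[/negPf->].
apply: contraT => mu_ms.
have mu0 : modulus_of (u, v) != 0 by rewrite /modulus_of mulf_neq0 ?invr_neq0 ?expf_neq0.
have roots : all (root (modulus_poly K m)) (modulus_of (u, v) :: [seq x <- ms | x != 0]).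
  apply/allP => t; rewrite inE mem_filter => /orP[/eqP->|/andP[t0 /cert_ms]].
    exact: supersingular_modulus.
  move=> [u1 [v1 [r [rs [ms' [abs' [[v10 Hr s0 s'0 E1 _ _ _ ->] [tms _]]]]]]]].
  have H w : w.2 != 0 -> trinomial_coef w.1 w.2 m m = 0 -> t = modulus_of w ->
      root (modulus_poly K m) t.
    move=> w0 Ew tw; rewrite tw [w]surjective_pairing; apply: supersingular_modulus => //.
    by apply: contraNneq t0; rewrite tw /modulus_of => ->; rewrite expr0n mul0r.
  have Hr' : (- (r + u1)) ^+ 2 + u1 * - (r + u1) + v1 = 0 by rewrite -Hr; ring.
  move: tms; rewrite !inE => /or3P[] /eqP; apply: H => //.
    by rewrite (supersingular_shift charK pE Hr).
  by rewrite (supersingular_shift charK pE Hr').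
have := max_poly_roots (modulus_poly_neq0 K m) roots.
rewrite /= mem_filter mu0 (negPf mu_ms) filter_uniq // size_ms => /(_ isT).
by have := size_poly m./2.+1 (fun i => 'C(m, uphalf m + i)%:R * 'C(uphalf m + i,
  m - (uphalf m + i))%:R : K); rewrite -/(modulus_poly K m) leqNgt => /negbTE ->.
Qed.

Theorem classification ab : ab \in abs <->
  separable_poly (Hpoly ab.1 ab.2) /\ superspecial 4 p (Hpoly ab.1 ab.2).
Proof.
have K3 : 3%:R != 0 :> K by apply: (natf_lt_char charK); rewrite pE; lia.
split.
  move=> /cert_abs[u [v [r [rs [ms' [abs' [C abC]]]]]]].
  have [x [g0 g'0 Gx G'x] ->] := certified_sound C abC.
  have sepR := certified_separable C g0 g'0; have v0 := certified_v C.
  have b0 : (param_at u v x).2 != 0.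
    by rewrite /param_at /= mulf_neq0 ?invr_neq0 // expf_neq0.
  have Em := certified_supersingular C.
  split; first by apply/(separable_Hpoly _ _ K3).
  have P1 : (hrev (param_at u v x).1 (param_at u v x).2 ^+ m)`_(4 * k).+2 = 0.
    by apply/eqP; rewrite (polyG_param charK pE) // Gx.
  have P2 : (hrev (param_at u v x).1 (param_at u v x).2 ^+ m)`_(4 * k).+3 = 0.
    by apply/eqP; rewrite (deriv_polyG_param charK pE) // G'x.
  (* The double root gives two of the five conditions; the reflection supplies those at 2k+1 and
     8k+6. *)
  have [P3 P4] := gap_reflection charK b0 sepR pE P1 P2.
  apply/(superspecial_mod5 _ _ charK pE); split=> //.
  by apply/eqP; rewrite (supersingular_param charK pE) // Em.
case: ab => a b /= [/(separable_Hpoly _ _ K3)[b0 sepR]].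
move=> /(superspecial_mod5 _ _ charK pE)[_ P2 P3 P4 P5].
have [u1 [v1 [x1 [v10 g10 g'10 abE]]]] := hrev_root_param b0 sepR.
have E1 : trinomial_coef u1 v1 m m = 0.
  by apply/eqP; rewrite -(supersingular_param charK pE g10 g'10) -abE P4.
have /cert_ms[u [v [r [rs [ms' [abs' [C [muC subC]]]]]]]] := moduli_complete v10 E1.
suff [x [g0 g'0 abx]] : exists x, [/\ cubic u v x != 0, cubic' u v x != 0 & (a,
  b) = param_at u v x].
  apply: subC; rewrite abx; apply: (certified_params C) => //.
  have v0 := certified_v C; have Em := certified_supersingular C.
  apply: (certified_complete C).
  - by apply: contraNneq g0 => ->; rewrite /cubic mul0r.
  - by apply/eqP; rewrite -(polyG_param charK pE) // -abx P2.
  - by apply/eqP; rewrite -(deriv_polyG_param charK pE) // -abx P3.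
  - by apply/eqP; rewrite -(polyB_param charK pE) // -abx P5.
(* The modulus matches the listed curve with one of its 2-torsion points marked: w is its cubic
   translated by s, and a scaling carries the given expansion point to it. *)
have H (w : K * K) s : w.2 != 0 -> modulus_of (u1, v1) = modulus_of w ->
    (forall x, cubic w.1 w.2 x = cubic u v (x + s)) ->
    (forall x, cubic' w.1 w.2 x = cubic' u v (x + s)) ->
    (forall x, param_at w.1 w.2 x = param_at u v (x + s)) ->
    exists x, [/\ cubic u v x != 0, cubic' u v x != 0 & (a, b) = param_at u v x].
  case: w => u2 v2 /= v20 E Hg Hg' Hp.
  have [c [c0 uE vE]] := modulus_of_eq v10 v20 E.
  have xE : x1 = c * (x1 / c) by rewrite mulrC divfK.
  have g20 : cubic u2 v2 (x1 / c) != 0.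
    apply: contraNneq g10 => g20.
    rewrite xE uE vE [X in X == 0](_ : _ = c ^+ 3 * cubic u2 v2 (x1 / c)); last by rewrite /cubic;
      ring.
    by rewrite g20 mulr0.
  have g'20 : cubic' u2 v2 (x1 / c) != 0.
    apply: contraNneq g'10 => g'20.
    rewrite xE uE vE [X in X == 0](_ : _ = c ^+ 2 * cubic' u2 v2 (x1 / c));
      last by rewrite /cubic'; ring.
    by rewrite g'20 mulr0.
  exists (x1 / c + s); rewrite -Hg -Hg' -Hp; split=> //.
  by rewrite abE {1}xE uE vE param_at_scale.
have Hr := certified_root C.
have Hr' : (- (r + u)) ^+ 2 + u * - (r + u) + v = 0 by rewrite -Hr; ring.
have := certified_moduli C => msE; move: muC; rewrite msE !inE => /or3P[] /eqP E.
- apply: (H _ 0 _ E) => [|x|x|x]; rewrite ?addr0 //.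
  exact: certified_v C.
- by apply: (H _ _ (certified_shift C) E) => x;
  rewrite ?(cubic_shift Hr) ?(cubic'_shift Hr) ?(param_at_shift Hr).
by apply: (H _ _ (certified_shift' C) E) => x;
  rewrite ?(cubic_shift Hr') ?(cubic'_shift Hr') ?(param_at_shift Hr').
Qed.

End Classification.

(** * Functions on the affine curve y^2 = f(x) *)

Section CurveFunctions.

Variable K : closedFieldType.
Implicit Types (f g s N D e c : {poly K}).

(** Parity of orders at x: the order of s^2 f is odd, that of N^2 even. The proof divides s and N by
    X - x until one of them is nonzero at x. *)
Lemma double_root_simple f s N g (x : K) :
  f.[x] = 0 -> f^`().[x] != 0 -> N != 0 -> s ^+ 2 * f = N ^+ 2 * g -> g.[x] = 0.
Proof.
move=> fx f'x; have [n] := ubnP (size N); elim: n s N => // n IH s N sN N0 E.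
have [Nx|Nx] := eqVneq N.[x] 0; last first.
  have := congr1 (horner^~ x) E; rewrite /= !(hornerM, horner_exp) fx mulr0 => /esym/eqP.
  by rewrite mulf_eq0 -expr2 expf_eq0 (negPf Nx) => /eqP.
have [sx|sx] := eqVneq s.[x] 0; last first.
  have := congr1 (fun P : {poly K} => P^`().[x]) E.
  rewrite !expr2 !derivM !(hornerD, hornerM) fx Nx !(mulr0, mul0r, addr0, add0r) => /eqP.
  by rewrite mulf_eq0 (negPf f'x) orbF mulf_eq0 orbb (negPf sx).
have /factor_theorem[N1 N1E] : root N x by apply/eqP.
have /factor_theorem[s1 s1E] : root s x by apply/eqP.
have X0 : 'X - x%:P != 0 :> {poly K} by rewrite polyXsubC_eq0.
have N10 : N1 != 0 by apply: contraNneq N0; rewrite N1E => ->; rewrite mul0r.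
apply: (IH s1 N1) => //.
  by move: sN; rewrite N1E size_Mmonic ?monicXsubC // size_XsubC addn2.
apply: (mulfI (expf_neq0 2 X0)); move: E; rewrite N1E s1E => E.
by transitivity ((s1 * ('X - x%:P)) ^+ 2 * f); [|rewrite E]; ring.
Qed.

Variable f : {poly K}.
Hypotheses (sepf : forall x, f.[x] = 0 -> f^`().[x] != 0) (f0 : f.[0] = 0).

Lemma curve_poly_neq0 : f != 0.
Proof. by apply/eqP => E; have := sepf f0; rewrite E deriv0 horner0 eqxx. Qed.

Lemma cofinite_zero D c : D != 0 -> (forall x, D.[x] != 0 -> c.[x] = 0) -> c = 0.
Proof.
move=> D0 H; apply/eqP; have : D * c = 0.
  apply: poly_eq_horner => x; rewrite hornerM horner0.
  by have [->|/H->] := eqVneq D.[x] 0; rewrite ?mul0r ?mulr0.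
by move/eqP; rewrite mulf_eq0 (negPf D0).
Qed.

Lemma cofinite_exists D : D != 0 -> exists2 x, D.[x] != 0 & f.[x] != 0.
Proof.
move=> D0; have /closed_nonrootP[x] : D * f != 0 by rewrite mulf_neq0 // curve_poly_neq0.
by rewrite rootM => /norP[Dx fx]; exists x.
Qed.

Hypothesis K2 : 2%:R != 0 :> K.

(** Add and subtract the relations at (x, y) and (x, -y), for the infinitely many x with f(x)
    nonzero. *)
Lemma curve_fun_eq0 D e0 e1 : D != 0 ->
  (forall x y, D.[x] != 0 -> y ^+ 2 = f.[x] -> e0.[x] + e1.[x] * y = 0) -> e0 = 0 /\ e1 = 0.
Proof.
move=> D0 H.
have Df0 : D * f != 0 by rewrite mulf_neq0 // curve_poly_neq0.
have H2 x : (D * f).[x] != 0 -> e0.[x] = 0 /\ e1.[x] = 0.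
  rewrite hornerM mulf_eq0 => /norP[Dx fx].
  have [y Hy] := closed_field_root f.[x] (isT : 0 < 2)%N.
  have y0 : y != 0 by apply: contraNneq fx => y0; rewrite -Hy y0 expr0n.
  have E1 := H x y Dx Hy; have E2 := H x (- y) Dx.
  rewrite sqrrN in E2; have {}E2 := E2 Hy.
  have E0 : e0.[x] = 0.
    apply: (mulfI K2); rewrite mulr0 -[RHS]addr0 -{1}E1 -E2; ring.
  by split=> //; move/eqP: E1; rewrite E0 add0r mulf_eq0 (negPf y0) orbF => /eqP.
by split; apply: (cofinite_zero Df0) => x /H2[].
Qed.

(** The simple root 0 of f prevents f from being the square of a rational function. *)
Lemma curve_norm_neq0 e0 e1 : (e0, e1) != (0, 0) -> e0 ^+ 2 - e1 ^+ 2 * f != 0.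
Proof.
apply: contraNneq => /eqP; rewrite subr_eq0 => /eqP E.
have [e00|e00] := eqVneq e0 0.
  rewrite e00 expr0n in E; move/esym/eqP: E.
  by rewrite e00 mulf_eq0 (negPf curve_poly_neq0) orbF expf_eq0 /= => /eqP->.
have := @double_root_simple f e1 e0 1 0 f0 (sepf f0) e00.
by rewrite mulr1 => /(_ (esym E)) /eqP; rewrite hornerC oner_eq0.
Qed.

Lemma curve_normE e0 e1 x y : y ^+ 2 = f.[x] ->
  (e0 ^+ 2 - e1 ^+ 2 * f).[x] = (e0.[x] + e1.[x] * y) * (e0.[x] - e1.[x] * y).
Proof. by move=> Hy; rewrite !hornerE -Hy /=; ring. Qed.

(** Membership in the coordinate ring K[x] + K[x] y. *)
Definition curve_fun (h : K -> K -> K) :=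
  exists e0 e1, forall x y, y ^+ 2 = f.[x] -> h x y = e0.[x] + e1.[x] * y.

Lemma curve_fun_poly e : curve_fun (fun x _ => e.[x]).
Proof. by exists e, 0 => x y _; rewrite horner0 mul0r addr0. Qed.

Lemma curve_fun_y : curve_fun (fun _ y => y).
Proof. by exists 0, 1 => x y _; rewrite horner0 hornerC add0r mul1r. Qed.

Lemma curve_funM h1 h2 : curve_fun h1 -> curve_fun h2 -> curve_fun (fun x y => h1 x y * h2 x y).
Proof.
move=> [e0 [e1 H1]] [c0 [c1 H2]]; exists (e0 * c0 + e1 * c1 * f), (e0 * c1 + e1 * c0) => x y Hy.
by rewrite H1 // H2 // !hornerE /= -Hy; ring.
Qed.

Lemma curve_funX h n : curve_fun h -> curve_fun (fun x y => h x y ^+ n).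
Proof.
move=> Hh; elim: n => [|n IH]; first by have [e0 [e1 H]] := curve_fun_poly 1;
  exists e0, e1 => x y Hy; rewrite -H ?hornerC.
have [e0 [e1 H]] := curve_funM Hh IH; exists e0, e1 => x y Hy.
by rewrite exprS H.
Qed.

End CurveFunctions.

(** * A function of degree at most 2 in both directions lies in K(x) *)

Section Correspondence.

Variable K : closedFieldType.

Lemma primitive_triple (A B C : {poly K}) : A != 0 ->
  exists h A0 B0 C0, [/\ h != 0, A = h * A0, B = h * B0, C = h * C0 &
    forall e, ~ [/\ A0.[e] = 0, B0.[e] = 0 & C0.[e] = 0]].
Proof.
have [n] := ubnP (size A); elim: n A B C => // n IH A B C sA A0.
have [[e [eA eB eC]]|H] := EM (exists e, [/\ A.[e] = 0, B.[e] = 0 & C.[e] = 0]); last first.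
  exists 1, A, B, C; rewrite !mul1r oner_neq0; split=> // e He; apply: H; by exists e.
have /factor_theorem[A1 A1E] : root A e by apply/eqP.
have /factor_theorem[B1 B1E] : root B e by apply/eqP.
have /factor_theorem[C1 C1E] : root C e by apply/eqP.
have X0 : 'X - e%:P != 0 :> {poly K} by rewrite polyXsubC_eq0.
have A10 : A1 != 0 by apply: contraNneq A0; rewrite A1E => ->; rewrite mul0r.
have [|h [A2 [B2 [C2 [h0 A2E B2E C2E H]]]]] := IH A1 B1 C1 _ A10.
  by move: sA; rewrite A1E size_Mmonic ?monicXsubC // size_XsubC addn2.
exists (h * ('X - e%:P)), A2, B2, C2; split=> //; first by rewrite mulf_neq0.
- by rewrite A1E A2E; ring.
- by rewrite B1E B2E; ring.
- by rewrite C1E C2E; ring.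
Qed.

(** Gauss's lemma: F is primitive, so each linear factor of s divides all the coefficients of Q. *)
Lemma strip_content (s : {poly K}) (G Q F : {poly {poly K}}) : s != 0 ->
  (forall e, map_poly (horner_eval e) F != 0) -> s *: G = Q * F -> exists Q', G = Q' * F.
Proof.
have [n] := ubnP (size s); elim: n s Q => // n IH s Q sn s0 primF E.
have [/eqP/size_poly1P[c c0 sE]|s1] := eqVneq (size s) 1%N.
  exists (c^-1%:P *: Q); rewrite -scalerAl -E sE scalerA -polyCM mulVf // polyC1 scale1r //.
have /closed_rootP[e /factor_theorem[t tE]] := s1.
have X0 : 'X - e%:P != 0 :> {poly K} by rewrite polyXsubC_eq0.
have Qe : map_poly (horner_eval e) Q = 0.
  have := congr1 (map_poly (horner_eval e)) E.
  rewrite rmorphM map_polyZ tE rmorphM /= /horner_eval !hornerE subrr mulr0 scale0r.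
  by move/esym/eqP; rewrite mulf_eq0 (negPf (primF e)) orbF => /eqP.
pose Q1 : {poly {poly K}} := \poly_(i < size Q) (Q`_i %/ ('X - e%:P)).
have QE : Q = ('X - e%:P) *: Q1.
  apply/polyP=> i; rewrite coefZ coef_poly; case: ltnP => Hi; last by rewrite mulr0 nth_default.
  rewrite mulrC divpK // dvdp_XsubCl; apply/eqP.
  by have := congr1 (fun P : {poly K} => P`_i) Qe; rewrite coef_map coef0.
apply: (IH t Q1) => //.
- by move: sn; rewrite tE size_Mmonic ?monicXsubC ?size_XsubC ?addn2 //; apply: contraNneq s0;
  rewrite tE => ->; rewrite mul0r.
- by apply: contraNneq s0; rewrite tE => ->; rewrite mul0r.
apply/polyP=> i; apply: (mulfI X0); have := congr1 (fun P : {poly {poly K}} => P`_i) E.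
by rewrite tE QE -scalerAl !coefZ => H; rewrite -H; ring.
Qed.

Lemma horner2_eq (s : {poly K}) (G Q F R : {poly {poly K}}) : s *: G = Q * F + R ->
  forall t x, s.[x] * G.[t%:P].[x] = Q.[t%:P].[x] * F.[t%:P].[x] + R.[t%:P].[x].
Proof. by move=> E t x; rewrite -!hornerM -!hornerD -E hornerZ. Qed.

Variable f : {poly K}.
Hypotheses (sepf : forall x, f.[x] = 0 -> f^`().[x] != 0) (f0 : f.[0] = 0).
Hypothesis K2 : 2%:R != 0 :> K.
Variable rs : seq K.
Hypotheses (uniq_rs : uniq rs) (root_rs : all (root f) rs) (size_rs : (4 < size rs)%N).

(* If t = (a0 + a1 y) / (b0 + b1 y) is not in K(x),
  its minimal equation over K[x] divides an equation
   of degree 2 in x, so its discriminant has degree at most 4; but it vanishes at the roots of f. *)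
Lemma quadratic_correspondence (D a0 a1 b0 b1 g0 g1 g2 : {poly K}) : D != 0 -> g2 != 0 ->
  (forall x y, D.[x] != 0 -> y ^+ 2 = f.[x] -> b0.[x] + b1.[x] * y != 0 /\
     let t := (a0.[x] + a1.[x] * y) / (b0.[x] + b1.[x] * y) in
     g2.[t] * x ^+ 2 + g1.[t] * x + g0.[t] = 0) ->
  a1 * b0 = a0 * b1.
Proof.
move=> D0 g20 H; apply/eqP; rewrite -subr_eq0; apply: contraT; set v := _ - _ => v0.
(* al t^2 + be t + ga is the norm of (b0 + b1 y) t - (a0 + a1 y), a quadratic equation for t over
   K[x]. *)
pose al := b0 ^+ 2 - b1 ^+ 2 * f; pose be := - 2%:R *: (a0 * b0 - a1 * b1 * f).
pose ga := a0 ^+ 2 - a1 ^+ 2 * f.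
have f_neq0 := curve_poly_neq0 sepf f0.
have al0 : al != 0.
  apply: curve_norm_neq0 sepf f0 _ _ _; apply/eqP => -[b00 b10].
  have [x Dx fx] := cofinite_exists sepf f0 D0.
  have [y Hy] := closed_field_root f.[x] (isT : 0 < 2)%N.
  by have [] := H x y Dx Hy; rewrite b00 b10 !horner0 mul0r addr0 eqxx.
have [h [A [B [C [h0 alE beE gaE prim]]]]] := primitive_triple be ga al0.
(* The outer variable is t and the coefficients are polynomials in x: F is the primitive equation of
   t, G the given quadratic equation of x over K[t]. *)
pose F : {poly {poly K}} := A *: 'X^2 + B *: 'X + C%:P.
pose G : {poly {poly K}} := 'X^2 *: map_poly polyC g2 + 'X *: map_poly polyC g1 + map_poly polyC g0.
have evF x t : F.[t%:P].[x] = A.[x] * t ^+ 2 + B.[x] * t + C.[x].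
  by rewrite /F !hornerE /=; ring.
have evC g t : (map_poly polyC g).[t%:P] = g.[t]%:P by rewrite horner_map.
have evG x t : G.[t%:P].[x] = g2.[t] * x ^+ 2 + g1.[t] * x + g0.[t].
  by rewrite /G !(hornerD, hornerZ, evC, hornerM, hornerC, hornerX, hornerXn); ring.
have coefF i : F`_i = if i is 0 then C else if i is 1%N then B else if i is 2 then A else 0.
  rewrite !coefD !coefZ coefXn coefX coefC.
  by case: i => [|[|[|i]]] /=; rewrite ?mulr1 ?mulr0 ?addr0 ?add0r.
have A_neq0 : A != 0 by apply: contraNneq al0; rewrite alE => ->; rewrite mulr0.
have sizeF : size F = 3.
  apply/eqP; rewrite eqn_leq; apply/andP; split.
    by apply/leq_sizeP => i; rewrite coefF; case: i => [|[|[|i]]].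
  by rewrite ltnNge; apply/negP => /leq_sizeP/(_ 2 (leqnn _)); rewrite coefF; apply/eqP.
have F0 : F != 0 by rewrite -size_poly_eq0 sizeF.
have primF e : map_poly (horner_eval e) F != 0.
  apply/eqP => E; apply: (prim e).
  have H' i : (F`_i).[e] = 0 by have := congr1 (fun P : {poly K} => P`_i) E; rewrite coef_map coef0.
  by split; [have := H' 2%N|have := H' 1%N|have := H' 0%N]; rewrite coefF.
have v_disc : be ^+ 2 - 4%:R * al * ga = (2%:R * v) ^+ 2 * f.
  by rewrite /be /al /ga /v -mul_polyC polyCN polyC_natr; ring.
(* h^2 times this discriminant is (2 v)^2 f, so a simple root of f is a root of it. *)
have disc_root e : root f e -> (B ^+ 2 - 4%:R * A * C).[e] = 0.
  move=> /rootP fe; apply: (@double_root_simple K f (2%:R * v) h _ e fe (sepf fe) h0).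
  by rewrite -v_disc alE beE gaE; ring.
pose Q := divp G F; pose R := modp G F.
have GE : lead_coef F ^+ scalp G F *: G = Q * F + R.
  exact: Pdiv.Idomain.divp_eq.
have sR : (size R <= 2)%N by have := Pdiv.CommonIdomain.ltn_modpN0 G F0; rewrite sizeF ltnS.
have RE x t : R.[t%:P].[x] = (R`_0).[x] + (R`_1).[x] * t.
  rewrite (horner_coef_wide _ sR) !big_ord_recl big_ord0 /= addr0 expr0 mulr1 expr1.
  by rewrite !hornerE.
(* The remainder has degree at most 1 in t and vanishes at the two conjugate values of t, which are
   distinct when v(x) and y are nonzero. *)
have R_eq0 : R = 0.
  pose E := D * f * h * v * al.
  have E0 : E != 0 by rewrite !mulf_neq0.
  have HR x : E.[x] != 0 -> (R`_0).[x] = 0 /\ (R`_1).[x] = 0.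
    rewrite /E !hornerM !mulf_eq0 !negb_or => /andP[/andP[/andP[/andP[Dx fx] hx] vx] alx].
    have [y Hy] := closed_field_root f.[x] (isT : 0 < 2)%N.
    have y0 : y != 0 by apply: contraNneq fx => y0; rewrite -Hy y0 expr0n.
    have Rt z : z ^+ 2 = f.[x] -> b0.[x] + b1.[x] * z != 0 /\
       (R`_0).[x] * (b0.[x] + b1.[x] * z) + (R`_1).[x] * (a0.[x] + a1.[x] * z) = 0.
      move=> Hz; have [Bz] := H x z Dx Hz; set t := _ / _ => /= Gt; split=> //.
      have Ft : F.[t%:P].[x] = 0.
        apply: (mulfI hx); rewrite mulr0 evF !mulrDr !mulrA -!hornerM -alE -beE -gaE.
        apply: (mulIf (expf_neq0 2 Bz)); rewrite mul0r.
        have -> : al.[x] = b0.[x] ^+ 2 - b1.[x] ^+ 2 * z ^+ 2 by rewrite /al !hornerE -Hz /=; ring.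
        have -> : be.[x] = - 2%:R * (a0.[x] * b0.[x] - a1.[x] * b1.[x] * z ^+ 2) by rewrite /be
          !hornerE -Hz /=; ring.
        have -> : ga.[x] = a0.[x] ^+ 2 - a1.[x] ^+ 2 * z ^+ 2 by rewrite /ga !hornerE -Hz /=; ring.
        by rewrite /t; field.
      have : R.[t%:P].[x] = 0.
        by have := horner2_eq GE t x; rewrite Ft evG Gt !mulr0 add0r => <-.
      rewrite RE => /(congr1 (fun c => c * (b0.[x] + b1.[x] * z))).
      by rewrite mul0r => <-; rewrite /t; field.
    have [B1 E1] := Rt y Hy; have [B2 E2] := Rt (- y) (etrans (sqrrN y) Hy).
    have R1 : (R`_1).[x] = 0.
      apply: (mulfI (mulf_neq0 K2 (mulf_neq0 y0 vx))); rewrite mulr0.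
      rewrite -[RHS](subrr 0) -{1}(mul0r (b0.[x] - b1.[x] * y)) -{1}E1.
      rewrite -(mul0r (b0.[x] + b1.[x] * y)) -E2 /v !hornerE /=; ring.
    split=> //; move/eqP: E1; rewrite R1 mul0r addr0 mulf_eq0 (negPf B1) orbF => /eqP//.
  apply/polyP=> i; rewrite coef0; case: i => [|[|i]].
  - by apply: (cofinite_zero E0) => x /HR[].
  - by apply: (cofinite_zero E0) => x /HR[].
  by rewrite nth_default // (leq_trans sR).
have s0 : lead_coef F ^+ scalp G F != 0 by rewrite expf_neq0 // lead_coef_eq0.
have [Q' GE'] : exists Q', G = Q' * F.
  by apply: (strip_content s0 primF (Q := Q)); rewrite GE R_eq0 addr0.
have sYG : (sizeY G <= 3)%N.
  apply/bigmax_leqP => i _; rewrite /G !coefD !coefZ !coef_map /=.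
  apply/leq_sizeP => j Hj; rewrite !coefD !coefMC !coefC !coefXn coefX.
  by case: j Hj => [|[|[|j]]] //= _; rewrite !mul0r !addr0.
have G0 : G != 0.
  apply: contraNneq g20 => G0; apply/eqP/polyP => i; rewrite coef0.
  have := congr1 (fun P : {poly {poly K}} => (P`_i)`_2) G0.
  rewrite !(coefD, coefZ, coef_map) /= !(coefMC, coefXn, coefX, coefC,
    coef0) /= ?mul1r ?mul0r ?addr0.
  by rewrite if_same coef0.
(* G has degree at most 2 in x, hence so has its divisor F. *)
have sYF : (sizeY F <= 3)%N.
  apply: leq_trans sYG; rewrite !sizeYE GE' rmorphM /=.
  have Q'0 : Q' != 0 by apply: contraNneq G0; rewrite GE' => ->; rewrite mul0r.
  have sw (P : {poly {poly K}}) : P != 0 -> swapXY P != 0 by apply: contraNneq => E;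
    rewrite -(swapXYK P) E rmorph0.
  rewrite size_mul ?sw //; have : (0 < size (swapXY Q'))%N by rewrite lt0n size_poly_eq0 sw.
  by case: (size (swapXY Q')) => // n _; rewrite addSn /= leq_addl.
have sz i : (size (F`_i)%R <= 3)%N by apply: leq_trans (max_size_coefXY _ _) sYF.
have sA : (size A <= 3)%N by have := sz 2%N; rewrite coefF.
have sB : (size B <= 3)%N by have := sz 1%N; rewrite coefF.
have sC : (size C <= 3)%N by have := sz 0%N; rewrite coefF.
have sM (P P' : {poly K}) : (size P <= 3)%N -> (size P' <= 3)%N -> (size (P * P')%R <= 5)%N.
  move=> sP sP'; apply: leq_trans (size_polyMleq _ _) _; rewrite -subn1 leq_subLR.
  exact: leq_trans (leq_add sP sP') _.
have disc0 : B ^+ 2 - 4%:R * A * C = 0.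
  apply/eqP; apply: contraT => disc0.
  have /(max_poly_roots disc0)/(_ uniq_rs) : all (root (B ^+ 2 - 4%:R * A * C)) rs.
    by apply/allP => e /(allP root_rs)/disc_root/rootP.
  rewrite ltnNge => /negP[]; apply: leq_trans _ size_rs.
  rewrite -mulrA expr2 -(polyC_natr _ 4) mul_polyC.
  apply: leq_trans (size_polyD _ _) _; rewrite size_polyN geq_max sM //.
  by apply: leq_trans (size_scale_leq _ _) _; apply: sM.
have : (2%:R * v) ^+ 2 * f = 0.
  rewrite -v_disc alE beE gaE; transitivity (h ^+ 2 * (B ^+ 2 - 4%:R * A * C)); first by ring.
  by rewrite disc0 mulr0.
move/eqP; rewrite mulf_eq0 (negPf f_neq0) orbF expf_eq0 /= mulf_eq0 (negPf v0) orbF.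
by rewrite -(polyC_natr _ 2) polyC_eq0 (negPf K2).
Qed.

End Correspondence.

(** * A rational map with a rational inverse is a Moebius map *)

Section Moebius.

Variable K : closedFieldType.

Lemma size2_poly (P : {poly K}) : (size P <= 2)%N -> P = P`_1 *: 'X + (P`_0)%:P.
Proof.
move=> sP; apply/polyP=> i; rewrite coefD coefZ coefX coefC.
case: i => [|[|i]] /=; rewrite ?mulr0 ?mulr1 ?addr0 ?add0r //.
by rewrite nth_default // (leq_trans sP).
Qed.

Lemma dvdp_big_sum (Q : {poly K}) n (F : 'I_n -> {poly K}) :
  (forall i, Q %| F i) -> Q %| \sum_(i < n) F i.
Proof.
by move=> H; apply: (big_ind (fun P => Q %| P)) => // *; apply: dvdp_add.
Qed.

Lemma coprime_pair (A B : {poly K}) : A != 0 ->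
  exists h A0 B0, [/\ h != 0, A = h * A0, B = h * B0 & coprimep A0 B0].
Proof.
move=> A0; exists (gcdp A B), (A %/ gcdp A B), (B %/ gcdp A B); split.
- by rewrite gcdp_eq0 negb_and A0.
- by rewrite mulrC divpK ?dvdp_gcdl.
- by rewrite mulrC divpK ?dvdp_gcdr.
by apply: coprimep_div_gcd; rewrite A0.
Qed.

(** The rational root argument: t = N/Q in lowest terms satisfies an equation with coefficients c_i
    = N'_i - x Q'_i of degree at most 1 in x, so Q divides c_d and N divides c_0. *)
Lemma moebius_of_rational (D n q n' q' : {poly K}) : D != 0 ->
  (forall x, D.[x] != 0 -> q.[x] != 0 /\
     let t := n.[x] / q.[x] in q'.[t] != 0 /\ x * q'.[t] = n'.[t]) ->
  exists al be ga de : K, al * de - be * ga != 0 /\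
    n * (ga *: 'X + de%:P) = q * (al *: 'X + be%:P).
Proof.
move=> D0 H.
have [x0 Dx0] : exists x0, D.[x0] != 0 by have /closed_nonrootP[x] := D0; exists x.
have [qx0 [q't0 _]] := H x0 Dx0.
have q0 : q != 0 by apply: contraNneq qx0 => ->; rewrite horner0.
have q'0 : q' != 0 by apply: contraNneq q't0 => ->; rewrite horner0.
have [h [Q [N [h0 qE nE cop]]]] := coprime_pair n q0.
have [h' [Q' [N' [h'0 q'E n'E cop']]]] := coprime_pair n' q'0.
have Q0 : Q != 0 by apply: contraNneq q0; rewrite qE => ->; rewrite mulr0.
have Q'0 : Q' != 0 by apply: contraNneq q'0; rewrite q'E => ->; rewrite mulr0.
have {}H x : D.[x] != 0 -> h.[x] != 0 /\ Q.[x] != 0 /\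
     let t := N.[x] / Q.[x] in Q'.[t] != 0 /\ x * Q'.[t] = N'.[t].
  move=> /H; rewrite qE nE q'E n'E !hornerM mulf_eq0 negb_or => -[/andP[hx Qx]] /=.
  have -> : h.[x] * N.[x] / (h.[x] * Q.[x]) = N.[x] / Q.[x] by field; rewrite Qx hx.
  set t := _ / _; rewrite !hornerM mulf_eq0 negb_or => -[/andP[h't Q't] E]; do 3 split=> //.
  by apply: (mulfI h't); rewrite -E; ring.
pose d := (maxn (size N') (size Q')).-1.
have dS : d.+1 = maxn (size N') (size Q').
  by rewrite prednK // (leq_trans _ (leq_maxr _ _)) // lt0n size_poly_eq0.
pose c i : {poly K} := - (Q'`_i) *: 'X + (N'`_i)%:P.
have sum0 : \sum_(i < d.+1) c i * (N ^+ i * Q ^+ (d - i)) = 0.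
  apply: (cofinite_zero D0) => x /H[_ [Qx /=]]; set t := _ / _ => -[Q't E].
  have sumE (P : {poly K}) : (size P <= d.+1)%N ->
      \sum_(i < d.+1) P`_i * (N.[x] ^+ i * Q.[x] ^+ (d - i)) = Q.[x] ^+ d * P.[t].
    move=> sP; rewrite (horner_coef_wide _ sP) mulr_sumr; apply: eq_bigr => i _.
    rewrite [RHS]mulrCA; congr (_ * _); rewrite /t expr_div_n.
    apply: (mulIf (expf_neq0 i Qx)); rewrite -mulrA -exprD subnK -1?ltnS //.
    by rewrite -mulrA divfK ?expf_neq0 // mulrC.
  rewrite horner_sum.
  transitivity (\sum_(i < d.+1) (N'`_i * (N.[x] ^+ i * Q.[x] ^+ (d - i))
      - x * (Q'`_i * (N.[x] ^+ i * Q.[x] ^+ (d - i))))).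
    by apply: eq_bigr => i _; rewrite /c !(hornerM, hornerD, hornerZ, hornerX, hornerC,
      horner_exp); ring.
  rewrite sumrB -mulr_sumr !sumE ?dS ?leq_maxl ?leq_maxr //.
  by rewrite -E; ring.
have size_c i : (size (c i) <= 2)%N.
  apply/leq_sizeP => j Hj; rewrite coefD coefZ coefX coefC.
  by case: j Hj => [|[|j]] //= _; rewrite mulr0 addr0.
have c_neq0 i : (N'`_i != 0) || (Q'`_i != 0) -> c i != 0.
  have <- : (c i)`_0 = N'`_i by rewrite coefD coefZ coefX coefC mulr0 add0r.
  have -> : Q'`_i = - (c i)`_1 by rewrite coefD coefZ coefX coefC mulr1 addr0 opprK.
  by apply: contraTneq => ->; rewrite !coef0 oppr0 eqxx.
have sQ : (size Q <= 2)%N.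
  apply: leq_trans (size_c d); apply: dvdp_leq.
    apply: c_neq0; rewrite /d; have := lead_coef_eq0 Q'; have := lead_coef_eq0 N'.
    rewrite /lead_coef; case: (leqP (size N') (size Q')) => Hs; first by move=> _ ->;
      rewrite Q'0 orbT.
    by move=> -> _; rewrite -size_poly_eq0 -lt0n (leq_trans _ Hs).
  rewrite -(@Gauss_dvdpl _ _ (N ^+ d)); last by rewrite coprimep_expr.
  have := sum0; rewrite big_ord_recr /= subnn expr0 mulr1 => /eqP; rewrite addr_eq0 => /eqP E.
  rewrite -dvdpNr -E; apply: dvdp_big_sum => i; rewrite mulrA dvdp_mull //.
  by rewrite -(subnSK (ltn_ord i)) exprS dvdp_mulr.
have sN : (size N <= 2)%N.
  apply: leq_trans (size_c 0%N); apply: dvdp_leq.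
    apply: c_neq0; rewrite -negb_and; apply/negP => /andP[/eqP N0 /eqP Q00].
    have := Pdiv.ClosedField.coprimepP _ _ cop' 0; rewrite rootE horner_coef0 Q00 => /(_ (eqxx _)).
    by rewrite horner_coef0 N0 eqxx.
  rewrite -(@Gauss_dvdpl _ _ (Q ^+ d)); last by rewrite coprimep_expr // coprimep_sym.
  have := sum0; rewrite big_ord_recl /= expr0 mul1r subn0 => /eqP; rewrite addr_eq0 => /eqP ->.
  by rewrite dvdpNr; apply: dvdp_big_sum => i;
    rewrite /bump add1n exprS mulrCA dvdp_mulr // dvdp_mulr.
exists N`_1, N`_0, Q`_1, Q`_0; split; last first.
  by rewrite -!size2_poly // nE qE; ring.
have [x1 Dx1] : exists x1, (D * ('X - x0%:P)).[x1] != 0.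
  have /closed_nonrootP[x] : D * ('X - x0%:P) != 0 by rewrite mulf_neq0 // polyXsubC_eq0.
  by exists x.
move: Dx1; rewrite hornerM mulf_eq0 negb_or hornerXsubC => /andP[Dx1 x10].
have [_ [Qx0 [Qt0 E0]]] := H x0 Dx0; have [_ [Qx1 [Qt1 E1]]] := H x1 Dx1.
apply/eqP => det0.
(* With zero determinant t would be constant, although t determines x. *)
have Et : N.[x0] / Q.[x0] = N.[x1] / Q.[x1].
  apply/eqP; rewrite eqr_div // (size2_poly sN) (size2_poly sQ).
  rewrite !(hornerM, hornerD, hornerZ, hornerX, hornerC); rewrite -subr_eq0.
  apply/eqP; transitivity ((N`_1 * Q`_0 - N`_0 * Q`_1) * (x0 - x1)); first by ring.
  by rewrite det0 mul0r.
move: x10; rewrite subr_eq0 => /eqP; apply; apply: (mulIf Qt1); rewrite E1.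
by rewrite -Et E0.
Qed.

End Moebius.

(** * Branch points go to branch points *)

Section BranchPoints.

Variables (K : closedFieldType) (f f' n q : {poly K}).
Hypotheses (sepf : forall x, f.[x] = 0 -> f^`().[x] != 0) (f0 : f.[0] = 0).
Hypotheses (K2 : 2%:R != 0 :> K) (q0 : q != 0).

(** This is q^10 f'(n/q) for f' of degree at most 10. *)
Definition pulled_back : {poly K} := \sum_(i < 11) f'`_i *: (n ^+ i * q ^+ (10 - i)).

(** Multiplying C by q^5 and by the fifth power of the conjugate of B gives r + s y with square N^10
    times the pull-back, N being the norm of B. The right-hand side has no term in y, so r s = 0. *)
Lemma branch_points (D a0 a1 b0 b1 c0 c1 : {poly K}) : D != 0 ->
  (forall x y, D.[x] != 0 -> y ^+ 2 = f.[x] ->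
     let A := a0.[x] + a1.[x] * y in let B := b0.[x] + b1.[x] * y in
     let C := c0.[x] + c1.[x] * y in
     [/\ B != 0, A * q.[x] = B * n.[x], C ^+ 2 = \sum_(i < 11) f'`_i * A ^+ i * B ^+ (10 - i) &
       y != 0 -> C * (b0.[x] - b1.[x] * y) ^+ 5 != (c0.[x] - c1.[x] * y) * B ^+ 5]) ->
  forall e, f.[e] = 0 -> pulled_back.[e] = 0.
Proof.
move=> D0 H.
have H1 : curve_fun f (fun x y => q.[x] ^+ 5 * (c0.[x] + c1.[x] * y) * (b0.[x] - b1.[x] * y) ^+ 5).
  apply: curve_funM; first apply: curve_funM.
  - by exists (q ^+ 5), 0 => x y _; rewrite horner0 mul0r addr0 horner_exp.
  - by exists c0, c1.
  by apply: curve_funX; exists b0, (- b1) => x y _; rewrite hornerN mulNr.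
have [r [s rsE]] := H1; pose N := b0 ^+ 2 - b1 ^+ 2 * f.
have NE x y : y ^+ 2 = f.[x] -> N.[x] = (b0.[x] + b1.[x] * y) * (b0.[x] - b1.[x] * y).
  exact: curve_normE.
have pbE x y : D.[x] != 0 -> y ^+ 2 = f.[x] ->
    (r.[x] + s.[x] * y) ^+ 2 = N.[x] ^+ 10 * pulled_back.[x].
  move=> Dx Hy; have [B0 AE CE _] := H x y Dx Hy; rewrite -rsE // (NE x y Hy).
  set A := _ + _ in AE CE; set B := _ + _ in B0 AE CE *; set C := _ + _ in CE *.
  have HS : q.[x] ^+ 10 * C ^+ 2 = B ^+ 10 * pulled_back.[x].
    rewrite CE /pulled_back horner_sum !mulr_sumr; apply: eq_bigr => i _.
    rewrite hornerZ hornerM !horner_exp; have Hi : (i <= 10)%N by rewrite -ltnS.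
    have E10 (z : K) : z ^+ 10 = z ^+ i * z ^+ (10 - i) by rewrite -exprD subnKC.
    rewrite !E10.
    transitivity (f'`_i * (A * q.[x]) ^+ i * (B * q.[x]) ^+ (10 - i)); first by rewrite !exprMn;
      ring.
    by rewrite AE !exprMn; ring.
  transitivity (q.[x] ^+ 10 * C ^+ 2 * (b0.[x] - b1.[x] * y) ^+ 10); first by ring.
  by rewrite HS; ring.
have [E0 E1] : r ^+ 2 + s ^+ 2 * f - N ^+ 10 * pulled_back = 0 /\ 2%:R *: (r * s) = 0.
  apply: (curve_fun_eq0 sepf f0 K2 D0) => x y Dx Hy.
  have EP (P : {poly K}) : (r ^+ 2 + s ^+ 2 * f - P).[x] + (2%:R *: (r * s)).[x] * y
      = (r.[x] + s.[x] * y) ^+ 2 - P.[x].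
    by rewrite !(hornerD, hornerN, hornerM, hornerZ, horner_exp) -Hy; ring.
  by rewrite EP (pbE x y Dx Hy) hornerM horner_exp subrr.
have N0 : N != 0.
  apply: (curve_norm_neq0 sepf f0); apply/eqP => -[b00 b10].
  have [x Dx _] := cofinite_exists sepf f0 D0.
  have [y Hy] := closed_field_root f.[x] (isT : 0 < 2)%N.
  by have [] := H x y Dx Hy; rewrite b00 b10 !horner0 mul0r addr0 eqxx.
(* If r = 0, a simple root of f is a root of the pull-back. If s = 0, the second coordinate is
   invariant under y -> -y, which the last clause of the hypothesis forbids. *)
move/eqP: E1; rewrite scaler_eq0 (negPf K2) /= mulf_eq0 => /orP[/eqP r0|/eqP s0] e fe.
  apply: (@double_root_simple K f s (N ^+ 5) _ e fe (sepf fe)); first by rewrite expf_neq0.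
  by apply/eqP; rewrite -exprM -subr_eq0; move/eqP: E0; rewrite r0 expr0n add0r.
have [x] := cofinite_exists sepf f0 (mulf_neq0 D0 q0).
rewrite hornerM mulf_eq0 negb_or => /andP[Dx qx] fx.
have [y Hy] := closed_field_root f.[x] (isT : 0 < 2)%N.
have y0 : y != 0 by apply: contraNneq fx => y0; rewrite -Hy y0 expr0n.
have [_ _ _ /(_ y0)/eqP[]] := H x y Dx Hy.
apply: (mulfI (expf_neq0 5 qx)).
have := rsE x y Hy; have := rsE x (- y) (etrans (sqrrN y) Hy).
rewrite s0 horner0 !mul0r addr0 => E2 E3.
transitivity (q.[x] ^+ 5 * (c0.[x] + c1.[x] * y) * (b0.[x] - b1.[x] * y) ^+ 5); first by ring.
by rewrite E3 -E2; ring.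
Qed.

End BranchPoints.

(** * Morphisms in affine coordinates *)

Section WeightedPoints.

Variable K : closedFieldType.
Implicit Types (f : {poly K}) (P Q : 3.-tuple K) (A B C : {mpoly K[3]}).

Notation pt x z y := [tuple x; z; y].
Notation same_point := (@same_point K 4).
Notation on_curve := (@on_curve K 4).

Lemma forall_coord (T : 'I_3 -> Prop) : T iX -> T iZ -> T iY -> forall i, T i.
Proof.
move=> HX HZ HY [[|[|[|i]]] Hi] //.
- by rewrite (_ : Ordinal Hi = iX) //; apply: val_inj.
- by rewrite (_ : Ordinal Hi = iZ) //; apply: val_inj.
by rewrite (_ : Ordinal Hi = iY) //; apply: val_inj.
Qed.

Lemma same_pointP P Q : same_point P Q <-> exists2 c, c != 0 &
  [/\ tnth Q iX = c * tnth P iX, tnth Q iZ = c * tnth P iZ & tnth Q iY = c ^+ 5 * tnth P iY].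
Proof.
split=> [[c c0 H]|[c c0 [HX HZ HY]]]; exists c => //.
apply: (@forall_coord (fun i => tnth Q i = c ^+ weight 4 i * tnth P i)).
- exact: HX.
- exact: HZ.
exact: HY.
Qed.

Lemma same_point_sym P Q : same_point P Q -> same_point Q P.
Proof.
move=> [c c0 H]; exists c^-1; first by rewrite invr_eq0.
by move=> i; rewrite H mulrA exprVn mulVf ?mul1r // expf_neq0.
Qed.

Lemma same_point_trans P Q R : same_point P Q -> same_point Q R -> same_point P R.
Proof.
move=> [c c0 H] [d d0 H']; exists (d * c); first by rewrite mulf_neq0.
by move=> i; rewrite H' H exprMn mulrA.
Qed.

Lemma homogenization_scale f c x z :
  homogenization 4 f (c * x) (c * z) = c ^+ 10 * homogenization 4 f x z.
Proof.
rewrite /homogenization mulr_sumr; apply: eq_bigr => i _.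
have Hi : (i <= 10)%N by rewrite -ltnS.
have -> : c ^+ 10 = c ^+ i * c ^+ (10 - i) by rewrite -exprD subnKC.
by rewrite !exprMn; ring.
Qed.

Lemma homogenization_affine f x : (size f <= 11)%N -> homogenization 4 f x 1 = f.[x].
Proof.
move=> sf; rewrite (horner_coef_wide _ sf); apply: eq_bigr => i _.
by rewrite expr1n mulr1.
Qed.

Lemma on_curve_affine f x y : (size f <= 11)%N -> on_curve f (pt x 1 y) <-> y ^+ 2 = f.[x].
Proof.
move=> sf; rewrite -homogenization_affine //; split=> [[_]//|H]; split=> //.
by exists iZ; rewrite oner_neq0.
Qed.

Lemma on_curve_same f P Q : same_point P Q -> on_curve f P -> on_curve f Q.
Proof.
move=> /[dup] [[c c0 H]] /same_pointP[c' c'0 [HX HZ HY]] [[i Pi] HP]; split.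
  by exists i; rewrite H mulf_neq0 // expf_neq0.
by rewrite HX HZ HY homogenization_scale -HP exprMn -exprM.
Qed.

Lemma meval_scale d A c P Q : weighted_homog 4 d A ->
  (forall i, tnth Q i = c ^+ weight 4 i * tnth P i) -> A.@[tnth Q] = c ^+ d * A.@[tnth P].
Proof.
move=> hA H; rewrite !mevalE mulr_sumr; apply: eq_big_seq => m /hA <-.
rewrite mulrCA; congr (_ * _).
rewrite (big_morph (GRing.exp c) (exprD c) (expr0 c)) -big_split /=.
by apply: eq_bigr => i _; rewrite H exprMn exprM.
Qed.

Lemma morphism_same f f' phi P Q : curve_morphism 4 f f' phi -> on_curve f P ->
  same_point P Q -> same_point (phi P) (phi Q).
Proof.
move=> [_ Hphi] HP PQ; have HQ := on_curve_same PQ HP.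
have [d [A [B [C [hA hB hC AB H]]]]] := Hphi P HP.
have [c c0 Hc] := PQ.
have EA := meval_scale hA Hc; have EB := meval_scale hB Hc; have EC := meval_scale hC Hc.
apply: same_point_trans (H P HP AB) _; apply: same_point_sym.
have [|e e0 He] := H Q HQ.
  by case: AB => AB; [left|right]; rewrite ?EA ?EB mulf_neq0 // expf_neq0.
apply: same_point_trans (ex_intro2 _ _ e e0 He) _; apply: same_point_sym.
apply/same_pointP; exists (c ^+ d); first by rewrite expf_neq0.
by rewrite !(tnth_nth 0) /= EA EB EC -exprM mulnC.
Qed.

Lemma curve_fun_meval f A : curve_fun f (fun x y => A.@[tnth (pt x 1 y)]).
Proof.
suff [e0 [e1 H]] : curve_fun f (fun x y => \sum_(m <- msupp A) A@_m * \prod_(i < 3) tnth (pt x 1 y)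
  i ^+ m i).
  by exists e0, e1 => x y Hy; rewrite mevalE H.
elim: (msupp A) => [|m s [e0 [e1 IH]]].
  by exists 0, 0 => x y _; rewrite big_nil !horner0 mul0r addr0.
have [c0 [c1 H]] : curve_fun f (fun x y => A@_m * \prod_(i < 3) tnth (pt x 1 y) i ^+ m i).
  have [c0 [c1 H]] : curve_fun f (fun x y => ((A@_m)%:P * 'X^(m iX)).[x] * y ^+ m iY).
    by apply: curve_funM; [apply: curve_fun_poly|apply/curve_funX/curve_fun_y].
  exists c0, c1 => x y Hy; rewrite -H // !big_ord_recl big_ord0 mulr1.
  rewrite hornerM hornerC hornerXn !(tnth_nth 0) /= expr1n mul1r mulrA.
  by congr (_ * _ ^+ m _ * _ ^+ m _); apply: val_inj.
exists (c0 + e0), (c1 + e1) => x y Hy; rewrite big_cons H // IH // !hornerD; ring.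
Qed.

Lemma on_curve_weighted f' P (x z y : K) : on_curve f' P -> same_point P (pt x z y) ->
  y ^+ 2 = homogenization 4 f' x z.
Proof. by move=> HP /on_curve_same/(_ HP)[_]; rewrite !(tnth_nth 0). Qed.

Variables (f f' : {poly K}) (phi : 3.-tuple K -> 3.-tuple K).
Hypotheses (sepf : forall x, f.[x] = 0 -> f^`().[x] != 0) (f0 : f.[0] = 0).
Hypotheses (sf : (size f <= 11)%N) (K2 : 2%:R != 0 :> K).
Hypothesis phiM : curve_morphism 4 f f' phi.
Hypothesis phi_inj : forall P Q, on_curve f P -> on_curve f Q ->
  same_point (phi P) (phi Q) -> same_point P Q.

Lemma affine_inj x y x' y' : y ^+ 2 = f.[x] -> y' ^+ 2 = f.[x'] ->
  same_point (phi (pt x 1 y)) (phi (pt x' 1 y')) -> x = x' /\ y = y'.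
Proof.
move=> Hy Hy' /(phi_inj (iffRL (on_curve_affine _ _ sf) Hy) (iffRL (on_curve_affine _ _ sf) Hy')).
move=> /same_pointP[c _ [EX EZ EY]]; move: EX EZ EY; rewrite !(tnth_nth 0) /=.
by rewrite mulr1 => -> <-; rewrite expr1n !mul1r => ->.
Qed.

(** Outside finitely many x, the formulas represent phi and the image avoids the zeros of E. The
    freedom in E is what allows two such representations to be composed. *)
Definition affine_rep (a0 a1 b0 b1 c0 c1 : {poly K}) :=
  forall E : {poly K}, E != 0 -> exists2 D, D != 0 & forall x y, D.[x] != 0 -> y ^+ 2 = f.[x] ->
    let A := a0.[x] + a1.[x] * y in let B := b0.[x] + b1.[x] * y in
    let C := c0.[x] + c1.[x] * y in
    [/\ B != 0, E.[A / B] != 0 & same_point (phi (pt x 1 y)) (pt (A / B) 1 (C / B ^+ 5))].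

Lemma exists_affine_rep : exists a0 a1 b0 b1 c0 c1, affine_rep a0 a1 b0 b1 c0 c1.
Proof.
(* The local formulas around the single point (0, 0) hold at almost all points of the curve. *)
have HP0 : on_curve f (pt 0 1 0) by apply/on_curve_affine; rewrite // f0 expr0n.
have [phiC Hphi] := phiM.
have [d [A [B [C [hA hB hC AB H]]]]] := Hphi _ HP0.
have [a0 [a1 EA]] := curve_fun_meval f A; have [b0 [b1 EB]] := curve_fun_meval f B.
have [c0 [c1 EC]] := curve_fun_meval f C; exists a0, a1, b0, b1, c0, c1.
have Hpt x y : y ^+ 2 = f.[x] -> on_curve f (pt x 1 y) by move/(on_curve_affine _ _ sf).
have y_0 : (0 : K) ^+ 2 = f.[0] by rewrite f0 expr0n.
have [N N0 HN] : exists2 N : {poly K}, N != 0 & forall x y, N.[x] != 0 -> y ^+ 2 = f.[x] ->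
    a0.[x] + a1.[x] * y != 0 \/ b0.[x] + b1.[x] * y != 0.
  case: AB => AB; [exists (a0 ^+ 2 - a1 ^+ 2 * f)|exists (b0 ^+ 2 - b1 ^+ 2 * f)].
  - apply: (curve_norm_neq0 sepf f0); apply: contraNneq AB => -[a00 a10].
    by rewrite EA // a00 a10 !horner0 mul0r addr0.
  - by move=> x y + Hy; rewrite (curve_normE _ _ Hy) mulf_eq0 negb_or => /andP[]; left.
  - apply: (curve_norm_neq0 sepf f0); apply: contraNneq AB => -[b00 b10].
    by rewrite EB // b00 b10 !horner0 mul0r addr0.
  by move=> x y + Hy; rewrite (curve_normE _ _ Hy) mulf_eq0 negb_or => /andP[]; right.
have Hrep x y : N.[x] != 0 -> y ^+ 2 = f.[x] -> same_point (phi (pt x 1 y))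
   (pt (a0.[x] + a1.[x] * y) (b0.[x] + b1.[x] * y) (c0.[x] + c1.[x] * y)).
  by move=> Nx Hy; rewrite -EA // -EB // -EC //; apply: H; [apply: Hpt|rewrite EA // EB //;
    apply: HN].
(* If la A + mu B vanished identically, phi would send almost every point to one of the at most two
   points over [mu : -la], while three points with different x have three different images. *)
have nonconst (la mu : K) : (la, mu) != (0, 0) ->
    (la *: a0 + mu *: b0, la *: a1 + mu *: b1) != (0, 0).
  move=> lm; apply/eqP => -[E0 E1].
  have [eta Heta] := closed_field_root (homogenization 4 f' mu (- la)) (isT : 0 < 2)%N.
  have Hsign x y : N.[x] != 0 -> y ^+ 2 = f.[x] -> exists b : bool,
      same_point (phi (pt x 1 y)) (pt mu (- la) ((-1) ^+ b * eta)).
    move=> Nx Hy; have AB0 := HN x y Nx Hy; have Hr := Hrep x y Nx Hy; move: AB0 Hr.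
    set a := _ + _ * y; set b := b0.[x] + _; set c := c0.[x] + _ => AB0 Hr.
    have Eab : la * a + mu * b = 0.
      have := congr1 (horner^~ x) E0; have := congr1 (horner^~ x) E1.
      rewrite /= !(hornerD, hornerZ) horner0 => H1 H0; rewrite /a /b.
      transitivity ((la * a0.[x] + mu * b0.[x]) + (la * a1.[x] + mu * b1.[x]) * y); first by ring.
      by rewrite H0 H1 mul0r addr0.
    have [ka [ka0 aE bE]] : exists ka, [/\ ka != 0, a = ka * mu & b = ka * (- la)].
      have [la0|la0] := eqVneq la 0.
        have mu0 : mu != 0 by apply: contraNneq lm => mu0; rewrite la0 mu0.
        have bz : b = 0.
          by apply/eqP; move/eqP: Eab; rewrite la0 mul0r add0r mulf_eq0 (negPf mu0).
        exists (a / mu); rewrite la0 oppr0 mulr0 divfK //; split=> //.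
        by rewrite mulf_neq0 ?invr_eq0 //; case: AB0; rewrite ?bz ?eqxx.
      have aE : a = - (b / la) * mu.
        by apply: (mulfI la0); apply/eqP; rewrite -subr_eq0 -Eab; apply/eqP; field.
      exists (- (b / la)); split=> //; last by field.
      rewrite oppr_eq0 mulf_neq0 ?invr_eq0 //.
      by case: AB0 => // a_n0; apply: contraNneq a_n0 => bz; rewrite aE bz mul0r oppr0 mul0r.
    have Hsame : same_point (phi (pt x 1 y)) (pt mu (- la) (c / ka ^+ 5)).
      apply: same_point_trans Hr _; apply: same_point_sym; apply/same_pointP; exists ka => //.
      by rewrite !(tnth_nth 0) /=; split=> //; rewrite mulrC divfK // expf_neq0.
    have := on_curve_weighted (phiC _ (Hpt x y Hy)) Hsame; rewrite -Heta => /eqP.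
    rewrite eqf_sqr => /orP[] /eqP Ec; [exists false|exists true]; rewrite -?Ec ?expr0 ?mul1r //.
    by rewrite expr1 mulN1r -Ec.
  have choose (D : {poly K}) : D != 0 -> exists x y b, [/\ D.[x] != 0, y ^+ 2 = f.[x] &
      same_point (phi (pt x 1 y)) (pt mu (- la) ((-1) ^+ (b : bool) * eta))].
    move=> D0; have [x] := cofinite_exists sepf f0 (mulf_neq0 D0 N0).
    rewrite hornerM mulf_eq0 negb_or => /andP[Dx Nx] _.
    have [y Hy] := closed_field_root f.[x] (isT : 0 < 2)%N.
    by have [b Hb] := Hsign x y Nx Hy; exists x, y, b.
  have [x1 [y1 [s1 [_ Hy1 H1]]]] := choose 1 (oner_neq0 _).
  have X1 : 'X - x1%:P != 0 :> {poly K} by rewrite polyXsubC_eq0.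
  have [x2 [y2 [s2 [Dx2 Hy2 H2]]]] := choose _ X1.
  have X2 : 'X - x2%:P != 0 :> {poly K} by rewrite polyXsubC_eq0.
  have [x3 [y3 [s3 [Dx3 Hy3 H3]]]] := choose _ (mulf_neq0 X1 X2).
  have same x y x' y' s : y ^+ 2 = f.[x] -> y' ^+ 2 = f.[x'] ->
      same_point (phi (pt x 1 y)) (pt mu (- la) ((-1) ^+ s * eta)) ->
      same_point (phi (pt x' 1 y')) (pt mu (- la) ((-1) ^+ s * eta)) -> x = x'.
    move=> Hy Hy' HP HP'; have [] // := affine_inj Hy Hy' (same_point_trans HP (same_point_sym
      HP')).
  move: Dx2 Dx3; rewrite hornerM mulf_eq0 !hornerXsubC !subr_eq0 negb_or => x21 /andP[x31 x32].
  have [E12|E12] := eqVneq s1 s2.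
    by case/eqP: x21; apply: (same x2 y2 x1 y1 s1) => //; rewrite E12.
  have [E13|E13] := eqVneq s1 s3.
    by case/eqP: x31; apply: (same x3 y3 x1 y1 s1) => //; rewrite E13.
  have E23 : s2 = s3 by move: E12 E13; case: (s1); case: (s2); case: (s3).
  by case/eqP: x32; apply: (same x3 y3 x2 y2 s2) => //; rewrite E23.
move=> E E0; have [ts Ets] := closed_field_poly_normal E.
(* The norm of la A + mu B. It is used for B itself and for A - t B, where t runs over the roots of
   E. *)
pose nrm (la mu : K) := (la *: a0 + mu *: b0) ^+ 2 - (la *: a1 + mu *: b1) ^+ 2 * f.
have nrm0 la mu : (la, mu) != (0, 0) -> nrm la mu != 0.
  by move=> /nonconst; apply: curve_norm_neq0 sepf f0 _ _.
have nrmE la mu x y : y ^+ 2 = f.[x] -> (nrm la mu).[x] != 0 ->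
    la * (a0.[x] + a1.[x] * y) + mu * (b0.[x] + b1.[x] * y) != 0.
  move=> Hy; rewrite (curve_normE _ _ Hy) mulf_eq0 negb_or => /andP[+ _].
  by apply: contraNneq => E1; rewrite -E1 !(hornerD, hornerZ); apply/eqP; ring.
have one0 (t : K) : ((1 : K), t) != (0, 0) by rewrite xpair_eqE oner_eq0.
exists (N * nrm 0 1 * \prod_(t <- ts) nrm 1 (- t)).
  rewrite !mulf_neq0 ?nrm0 ?xpair_eqE ?oner_eq0 ?andbF //.
  by rewrite prodf_seq_neq0; apply/allP => t _ /=; apply: nrm0.
move=> x y + Hy; rewrite !hornerM !mulf_eq0 !negb_or => /andP[/andP[Nx Bx] Px].
have B0 : b0.[x] + b1.[x] * y != 0 by have := nrmE _ _ _ _ Hy Bx; rewrite mul0r mul1r add0r.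
split=> //.
  rewrite Ets hornerZ mulf_neq0 ?lead_coef_eq0 // horner_prod prodf_seq_neq0.
  apply/allP => t tts /=; rewrite hornerXsubC.
  have : (nrm 1 (- t)).[x] != 0.
    by move: Px; rewrite horner_prod prodf_seq_neq0 => /allP/(_ t tts).
  move=> /(nrmE _ _ _ _ Hy); apply: contraNneq => /eqP; rewrite subr_eq0 => /eqP E1.
  by rewrite -E1; apply/eqP; field.
apply: same_point_trans (Hrep x y Nx Hy) _; apply: same_point_sym; apply/same_pointP.
exists (b0.[x] + b1.[x] * y) => //; rewrite !(tnth_nth 0) /= mulr1.
by rewrite ![_ * (_ / _)]mulrC !divfK // expf_neq0.
Qed.

End WeightedPoints.

(** * The x-coordinate of an isomorphism *)

Section Isomorphism.

Variable K : closedFieldType.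
Hypothesis K2 : 2%:R != 0 :> K.

Notation pt x z y := [tuple x; z; y].
Notation same_point := (@same_point K 4).
Notation on_curve := (@on_curve K 4).

Definition inverse_maps (f f' : {poly K}) phi psi :=
  [/\ curve_morphism 4 f f' phi, curve_morphism 4 f' f psi,
      forall P, on_curve f P -> same_point P (psi (phi P))
    & forall Q, on_curve f' Q -> same_point Q (phi (psi Q))].

Lemma inverse_maps_sym f f' phi psi : inverse_maps f f' phi psi -> inverse_maps f' f psi phi.
Proof. by case. Qed.

Lemma inverse_maps_inj f f' phi psi P Q : inverse_maps f f' phi psi ->
  on_curve f P -> on_curve f Q -> same_point (phi P) (phi Q) -> same_point P Q.
Proof.
move=> [phiM psiM H _] HP HQ E; apply: same_point_trans (H P HP) _.
apply: same_point_trans (same_point_sym (H Q HQ)); apply: morphism_same psiM _ E.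
exact: phiM.1.
Qed.

(** Degree 10 ensures that infinity is not a branch point; more than four roots is what a
    discriminant of degree at most 4 requires. *)
Record branch_curve (f : {poly K}) : Prop := BranchCurve {
  bc_sep : forall x, f.[x] = 0 -> f^`().[x] != 0;
  bc_root0 : f.[0] = 0;
  bc_size : (size f <= 11)%N;
  bc_lead : f`_10 = 1;
  bc_roots : exists rs, [/\ uniq rs, all (root f) rs & (4 < size rs)%N]
}.

Section Link.

Variables (f f' : {poly K}) (phi psi : 3.-tuple K -> 3.-tuple K).
Hypotheses (bf : branch_curve f) (bf' : branch_curve f').
Hypothesis inv : inverse_maps f f' phi psi.
Variables (a0 a1 b0 b1 c0 c1 a0' a1' b0' b1' c0' c1' : {poly K}).
Hypothesis rep : affine_rep f phi a0 a1 b0 b1 c0 c1.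
Hypothesis rep' : affine_rep f' psi a0' a1' b0' b1' c0' c1'.

(** The identity psi (phi P) = P in affine coordinates: the representation of psi at (t, y') gives
    back x. *)
Lemma affine_link (E : {poly K}) : E != 0 -> exists2 D, D != 0 &
  forall x y, D.[x] != 0 -> y ^+ 2 = f.[x] ->
    let A := a0.[x] + a1.[x] * y in let B := b0.[x] + b1.[x] * y in
    let C := c0.[x] + c1.[x] * y in let t := A / B in let y' := C / B ^+ 5 in
    [/\ B != 0, E.[t] != 0, same_point (phi (pt x 1 y)) (pt t 1 y'), y' ^+ 2 = f'.[t]
     & b0'.[t] + b1'.[t] * y' != 0 /\ x * (b0'.[t] + b1'.[t] * y') = a0'.[t] + a1'.[t] * y'].
Proof.
move=> E0; have [D' D'0 H'] := rep' (oner_neq0 _).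
have [D D0 H] := rep (mulf_neq0 E0 D'0); exists D => // x y Dx Hy; have := H x y Dx Hy.
move=> /= [B0]; set t := _ / _; set y' := _ / _ ^+ 5.
rewrite hornerM mulf_eq0 negb_or => /andP[Et D't] Hphi.
have [phiM psiM Hpsi _] := inv.
have HP : on_curve f (pt x 1 y) by apply/(on_curve_affine _ _ (bc_size bf)).
have HQ : on_curve f' (pt t 1 y') by apply: on_curve_same Hphi _; apply: phiM.1.
have Hy' : y' ^+ 2 = f'.[t] by apply/(on_curve_affine _ _ (bc_size bf')).
have [B'0 _ HQ'] := H' t y' D't Hy'.
have := same_point_trans (Hpsi _ HP) (same_point_trans (morphism_same psiM (phiM.1 _ HP) Hphi) HQ').
move=> /same_pointP[c _]; rewrite !(tnth_nth 0) /= mulr1 => -[Ex c1E _].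
split=> //; split=> //; move: Ex; rewrite -c1E mul1r => <-.
by rewrite divfK.
Qed.

Lemma affine_rep_neq0 : (b0, b1) != (0, 0).
Proof.
have [D D0 H] := rep (oner_neq0 _); apply/eqP => -[b00 b10].
have [x Dx _] := cofinite_exists (bc_sep bf) (bc_root0 bf) D0.
have [y Hy] := closed_field_root f.[x] (isT : 0 < 2)%N.
by have [] := H x y Dx Hy; rewrite b00 b10 !horner0 mul0r addr0 eqxx.
Qed.

End Link.

(** By the inverse map, x (b0' + b1' y') = a0' + a1' y' at t; taking norms eliminates y' and gives
    the quadratic equation of x over K[t]. *)
Lemma affine_rep_rational f f' phi psi a0 a1 b0 b1 c0 c1 a0' a1' b0' b1' c0' c1' :
  branch_curve f -> branch_curve f' -> inverse_maps f f' phi psi ->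
  affine_rep f phi a0 a1 b0 b1 c0 c1 -> affine_rep f' psi a0' a1' b0' b1' c0' c1' ->
  a1 * b0 = a0 * b1.
Proof.
move=> bf bf' inv rep rep'; have [D D0 H] := affine_link bf bf' inv rep rep' (oner_neq0 _).
have [rs [uniq_rs root_rs size_rs]] := bc_roots bf.
apply: (quadratic_correspondence (bc_sep bf) (bc_root0 bf) K2 uniq_rs root_rs size_rs
  (g0 := a0' ^+ 2 - a1' ^+ 2 * f') (g1 := - 2%:R *: (a0' * b0' - a1' * b1' * f'))
  (g2 := b0' ^+ 2 - b1' ^+ 2 * f') D0).
  exact: curve_norm_neq0 (bc_sep bf') (bc_root0 bf') _ _ (affine_rep_neq0 bf' rep').
move=> x y Dx Hy; have [B0 _ _ Hy' [_ E]] := H x y Dx Hy; split=> // t.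
have -> : (b0' ^+ 2 - b1' ^+ 2 * f').[t] = b0'.[t] ^+ 2 - b1'.[t] ^+ 2 * f'.[t] by rewrite !hornerE.
have -> : (- 2%:R *: (a0' * b0' - a1' * b1' * f')).[t] =
   - 2%:R * (a0'.[t] * b0'.[t] - a1'.[t] * b1'.[t] * f'.[t]) by rewrite !hornerE.
have -> : (a0' ^+ 2 - a1' ^+ 2 * f').[t] = a0'.[t] ^+ 2 - a1'.[t] ^+ 2 * f'.[t] by rewrite !hornerE.
move: Hy' E; rewrite -/t; set y' := _ / _ ^+ 5 => <- E.
have E1 : x * b0'.[t] - a0'.[t] = (a1'.[t] - x * b1'.[t]) * y'.
  apply/eqP; rewrite -subr_eq0; apply/eqP.
  transitivity (x * (b0'.[t] + b1'.[t] * y') - (a0'.[t] + a1'.[t] * y')); first by ring.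
  by rewrite E subrr.
transitivity ((x * b0'.[t] - a0'.[t]) ^+ 2 - ((a1'.[t] - x * b1'.[t]) * y') ^+ 2); first by ring.
by rewrite E1 subrr.
Qed.

(** Under the proportionality the quotient is a0/b0, or a1/b1 when b0 = 0. *)
Lemma rational_coordinate (a0 a1 b0 b1 : {poly K}) :
  (b0, b1) != (0, 0) -> a1 * b0 = a0 * b1 ->
  exists n q, q != 0 /\ forall x y,
    (a0.[x] + a1.[x] * y) * q.[x] = (b0.[x] + b1.[x] * y) * n.[x].
Proof.
move=> b_neq0 E; have Ex x : a1.[x] * b0.[x] = a0.[x] * b1.[x] by rewrite -!hornerM E.
have [b00|b00] := eqVneq b0 0; last first.
  exists a0, b0; split=> // x y.
  transitivity (a0.[x] * b0.[x] + (a1.[x] * b0.[x]) * y); first by ring.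
  by rewrite Ex; ring.
exists a1, b1; split=> [|x y]; first by apply: contraNneq b_neq0 => ->; rewrite b00.
transitivity (a0.[x] * b1.[x] + a1.[x] * b1.[x] * y); first by ring.
by rewrite -Ex; ring.
Qed.

Theorem isomorphism_moebius f f' : branch_curve f -> branch_curve f' ->
  curve_isomorphic 4 f f' -> exists al be ga de : K, al * de - be * ga != 0 /\
    forall e, f.[e] = 0 -> ga * e + de != 0 /\ f'.[(al * e + be) / (ga * e + de)] = 0.
Proof.
move=> bf bf' [phi [psi inv]]; have inv' := inverse_maps_sym inv.
have [phiM psiM _ _] := inv.
have phi_inj P Q := @inverse_maps_inj _ _ _ _ P Q inv.
have psi_inj P Q := @inverse_maps_inj _ _ _ _ P Q inv'.
have [a0 [a1 [b0 [b1 [c0 [c1 rep]]]]]] :=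
  exists_affine_rep (bc_sep bf) (bc_root0 bf) (bc_size bf) phiM phi_inj.
have [a0' [a1' [b0' [b1' [c0' [c1' rep']]]]]] :=
  exists_affine_rep (bc_sep bf') (bc_root0 bf') (bc_size bf') psiM psi_inj.
have [n [q [q0 nq]]] := rational_coordinate (affine_rep_neq0 bf rep)
  (affine_rep_rational bf bf' inv rep rep').
have [n' [q' [q'0 nq']]] := rational_coordinate (affine_rep_neq0 bf' rep')
  (affine_rep_rational bf' bf inv' rep' rep).
have [D D0 H] := affine_link bf bf' inv rep rep' q'0.
have Dq0 : D * q != 0 by rewrite mulf_neq0.
have tE x y : b0.[x] + b1.[x] * y != 0 -> q.[x] != 0 ->
    (a0.[x] + a1.[x] * y) / (b0.[x] + b1.[x] * y) = n.[x] / q.[x].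
  by move=> B0 qx; apply/eqP; rewrite eqr_div // nq mulrC.
have [|al [be [ga [de [det E]]]]] := @moebius_of_rational _ (D * q) n q n' q' Dq0.
  move=> x; rewrite hornerM mulf_eq0 negb_or => /andP[Dx qx]; split=> //.
  have [y Hy] := closed_field_root f.[x] (isT : 0 < 2)%N.
  have := H x y Dx Hy; rewrite /= => -[B0]; rewrite (tE _ _ B0 qx); set t := n.[x] / _.
  set y' := _ / _ ^+ 5 => q't _ _ [B'0 E]; split=> //.
  by apply: (mulIf B'0); rewrite mulrAC E nq' mulrC.
exists al, be, ga, de; split=> // e fe.
pose n1 : {poly K} := al *: 'X + be%:P; pose q1 : {poly K} := ga *: 'X + de%:P.
have n1E x : n1.[x] = al * x + be by rewrite !hornerE.
have q1E x : q1.[x] = ga * x + de by rewrite !hornerE.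
have q10 : q1 != 0.
  apply: contraNneq det => q10; have := congr1 (horner^~ 0) q10; have := congr1 (horner^~ 1) q10.
  rewrite /= !q1E !horner0 mulr0 add0r mulr1 => H1 H0.
  by move: H1; rewrite H0 addr0 => ->; rewrite !mulr0 subrr.
have Ex x : n.[x] * q1.[x] = q.[x] * n1.[x] by rewrite -!hornerM E.
have pb : (pulled_back f' n1 q1).[e] = 0.
  apply: (branch_points (bc_sep bf) (bc_root0 bf) K2 q10 (a0 := a0) (a1 := a1) (b0 := b0)
    (b1 := b1) (c0 := c0) (c1 := c1) Dq0) fe.
  move=> x y; rewrite hornerM mulf_eq0 negb_or => /andP[Dx qx] Hy A B C.
  have := H x y Dx Hy; rewrite /= -/A -/B -/C => -[B0 _ Hphi Hy' _]; split=> //.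
  - apply: (mulfI qx); transitivity (A * q.[x] * q1.[x]); first by ring.
    by rewrite nq -/B -mulrA Ex; ring.
  - have B50 : B ^+ 5 != 0 by rewrite expf_neq0.
    have -> : C ^+ 2 = B ^+ 10 * (C / B ^+ 5) ^+ 2 by field.
    rewrite Hy' (horner_coef_wide _ (bc_size bf')) mulr_sumr; apply: eq_bigr => i _.
    have Hi : (i <= 10)%N by rewrite -ltnS.
    have -> : B ^+ 10 = B ^+ i * B ^+ (10 - i) by rewrite -exprD subnKC.
    rewrite expr_div_n; field; exact: expf_neq0.
  (* Since t depends on x alone, equal second coordinates would identify the images of (x, y) and
     (x, -y), against injectivity. *)
  move=> y0; apply/eqP => Esym.
  have Hy2 : (- y) ^+ 2 = f.[x] by rewrite sqrrN.
  have := H x (- y) Dx Hy2; rewrite /= => -[B'0 _ Hphi' _ _].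
  have [_ /eqP] : x = x /\ y = - y.
    apply: (affine_inj (bc_size bf) phi_inj Hy Hy2); apply: same_point_trans Hphi _.
    apply: same_point_sym; move: Hphi'; rewrite (tE _ _ B'0 qx) /A /B (tE _ _ B0 qx).
    suff -> : (c0.[x] + c1.[x] * - y) / (b0.[x] + b1.[x] * - y) ^+ 5 = C / B ^+ 5 by [].
    apply/eqP; rewrite eqr_div ?expf_neq0 //; apply/eqP.
    by transitivity ((c0.[x] - c1.[x] * y) * B ^+ 5); [ring|rewrite -Esym; ring].
  by rewrite -addr_eq0 -mulr2n -mulr_natl mulf_eq0 (negPf K2) (negPf y0).
have pbE : (pulled_back f' n1 q1).[e] = \sum_(i < 11) f'`_i * n1.[e] ^+ i * q1.[e] ^+ (10 - i).
  by rewrite /pulled_back horner_sum; apply: eq_bigr => i _;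
    rewrite hornerZ hornerM !horner_exp mulrA.
(* At a zero of q1 the pull-back reduces to n1(e)^10, so n1 would vanish there too and the
   determinant would be 0. *)
have q1e : q1.[e] != 0.
  apply/eqP => q1e; move/eqP: pb; rewrite pbE q1e big_ord_recr big1 /=; last first.
    by move=> i _; rewrite expr0n subn_eq0 leqNgt (ltn_ord i) mulr0.
  rewrite (bc_lead bf') add0r mul1r subnn expr0 mulr1 expf_eq0 /= => /eqP n1e.
  have : (al * de - be * ga) = 0.
    move: q1e n1e; rewrite q1E n1E => q1e n1e.
    have [ga0|ga0] := eqVneq ga 0.
      by move: q1e; rewrite ga0 mul0r add0r => ->; rewrite !mulr0 subrr.
    transitivity (al * (ga * e + de) - ga * (al * e + be)); first by ring.
    by rewrite q1e n1e !mulr0 subrr.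
  by move/eqP; rewrite (negPf det).
rewrite -q1E -n1E; split=> //.
apply: (mulfI (expf_neq0 10 q1e)); rewrite mulr0 -pb pbE.
rewrite (horner_coef_wide _ (bc_size bf')) mulr_sumr; apply: eq_bigr => i _.
have Hi : (i <= 10)%N by rewrite -ltnS.
have -> : q1.[e] ^+ 10 = q1.[e] ^+ i * q1.[e] ^+ (10 - i) by rewrite -exprD subnKC.
rewrite expr_div_n; field; exact: expf_neq0.
Qed.

End Isomorphism.

Import GroupScope.
Local Open Scope ring_scope.

(** * Moebius maps between finite sets of points *)

Section MoebiusMaps.

Variables (K : closedFieldType) (n : nat).
Implicit Types e : 'I_n -> K.

(** The map induces s on the indices; the equation is cross-multiplied, and the denominators are
    nonzero because no point goes to infinity. *)
Definition moebius e e' (s : 'I_n -> 'I_n) := exists al be ga de : K,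
  al * de - be * ga != 0 /\
  forall i, ga * e i + de != 0 /\ al * e i + be = e' (s i) * (ga * e i + de).

Lemma moebius_id e : moebius e e id.
Proof.
exists 1, 0, 0, 1; rewrite mulr1 mul0r subr0 oner_neq0; split=> // i.
by rewrite mul0r add0r oner_neq0 mul1r addr0 mulr1.
Qed.

Lemma moebius_comp e e' e'' s t : moebius e e' s -> moebius e' e'' t -> moebius e e'' (t \o s).
Proof.
move=> [al [be [ga [de [det H]]]]] [al' [be' [ga' [de' [det' H']]]]].
exists (al' * al + be' * ga), (al' * be + be' * de), (ga' * al + de' * ga), (ga' * be + de' * de).
split.
  have -> : (al' * al + be' * ga) * (ga' * be + de' * de) -
     (al' * be + be' * de) * (ga' * al + de' * ga) =
     (al' * de' - be' * ga') * (al * de - be * ga) by ring.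
  by rewrite mulf_neq0.
move=> i; have [Q0 NE] := H i; have [Q'0 N'E] := H' (s i).
have QE : (ga' * al + de' * ga) * e i + (ga' * be + de' * de) =
    (ga' * e' (s i) + de') * (ga * e i + de).
  transitivity (ga' * (al * e i + be) + de' * (ga * e i + de)); first by ring.
  by rewrite NE; ring.
rewrite QE mulf_neq0 //; split=> //=.
transitivity (al' * (al * e i + be) + be' * (ga * e i + de)); first by ring.
by rewrite NE [RHS]mulrA -N'E; ring.
Qed.

Lemma moebius_inv e e' (s : {perm 'I_n}) : moebius e e' s -> moebius e' e (s^-1)%g.
Proof.
move=> [al [be [ga [de [det H]]]]]; exists de, (- be), (- ga), al; split.
  by have -> : de * al - - be * - ga = al * de - be * ga by ring.
move=> j; have [] := H ((s^-1)%g j); rewrite permKV => Q0 NE.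
have QE : (- ga * e' j + al) * (ga * e ((s^-1)%g j) + de) = al * de - be * ga.
  transitivity (- ga * (e' j * (ga * e ((s^-1)%g j) + de)) + al * (ga * e ((s^-1)%g j) + de)).
    by ring.
  by rewrite -NE; ring.
split; first by apply: contraNneq det => E; rewrite -QE E mul0r.
apply: (mulIf Q0).
transitivity (e ((s^-1)%g j) * ((- ga * e' j + al) * (ga * e ((s^-1)%g j) + de))); last by ring.
rewrite QE.
transitivity (de * (e' j * (ga * e ((s^-1)%g j) + de)) - be * (ga * e ((s^-1)%g j) + de)).
  by ring.
by rewrite -NE; ring.
Qed.

Lemma perm_of_map e e' (h : K -> K) : injective e -> {in codom e &, injective h} ->
  (forall i, exists j, e' j = h (e i)) -> exists s : {perm 'I_n}, forall i, e' (s i) = h (e i).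
Proof.
move=> e_inj h_inj /fin_all_exists[s Hs].
have s_inj : injective s.
  by move=> i j E; apply/e_inj/h_inj; rewrite ?codom_f // -!Hs E.
by exists (perm s_inj) => i; rewrite permE.
Qed.

Variable zeta : K.
Hypotheses (zeta3 : zeta ^+ 2 + zeta + 1 = 0) (zeta1 : zeta != 1).

(** The map turns multiplication by xi into multiplication by zeta. It sends the fixed point 0 to a
    fixed point, so be = 0. The relations at e and xi e then yield ga e xi (1 - zeta) = de (zeta -
    xi), and two different nonzero e force ga = 0. *)
Lemma rotation_moebius e e' (s r : 'I_n -> 'I_n) xi i0 i1 i2 : moebius e e' s ->
  injective e -> e i0 = 0 -> i1 != i0 -> i2 != i0 -> i1 != i2 -> xi != 0 ->
  (forall i, e (r i) = xi * e i) -> (forall i, e' (s (r i)) = zeta * e' (s i)) ->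
  exists2 u, u != 0 & forall i, e' (s i) = u * e i.
Proof.
move=> [al [be [ga [de [det H]]]]] e_inj e0 i10 i20 i12 xi0 er es.
have e'0 : e' (s i0) = 0.
  have r0 : r i0 = i0 by apply: e_inj; rewrite er e0 mulr0.
  have /eqP := es i0; rewrite r0 -subr_eq0 -{1}[e' _]mul1r -mulrBl mulf_eq0 subr_eq0 eq_sym.
  by rewrite (negPf zeta1) => /eqP.
have be0 : be = 0 by have [_] := H i0; rewrite e0 e'0 mulr0 add0r mul0r.
have al0 : al != 0 by apply: contraNneq det => ->; rewrite be0 !mul0r subrr.
have key i : i != i0 -> ga * e i * xi * (1 - zeta) = de * (zeta - xi).
  move=> ii0; have ei0 : e i != 0 by apply: contraNneq ii0 => E; apply/eqP/e_inj; rewrite E e0.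
  have [_ E1] := H i; have [_ E2] := H (r i); rewrite be0 addr0 in E1;
    rewrite be0 addr0 er es in E2.
  have E0 : e' (s i) != 0.
    apply/eqP => E; move/eqP: E1; rewrite E mul0r mulf_eq0.
    by rewrite (negPf al0) (negPf ei0).
  apply: (mulfI E0); apply/eqP; rewrite -subr_eq0; apply/eqP.
  transitivity (xi * (e' (s i) * (ga * e i + de)) - zeta * e' (s i) * (ga * (xi * e i) + de));
    first by ring.
  by rewrite -E1 -E2; ring.
have ga0 : ga = 0.
  have e12 : e i1 - e i2 != 0 by rewrite subr_eq0 (inj_eq e_inj).
  have z1 : 1 - zeta != 0 by rewrite subr_eq0 eq_sym.
  apply: (mulIf (mulf_neq0 e12 (mulf_neq0 xi0 z1))); rewrite mul0r -[RHS](subrr (de * (zeta - xi))).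
  by rewrite -{1}(key i1 i10) -(key i2 i20); ring.
have de0 : de != 0 by apply: contraNneq det => ->; rewrite ga0 !mulr0 subrr.
exists (al / de) => [|i]; first by rewrite mulf_neq0 ?invr_neq0.
have [_] := H i; rewrite be0 ga0 addr0 mul0r add0r => E.
by apply: (mulIf de0); rewrite -E mulrAC divfK.
Qed.

End MoebiusMaps.

(** * The rotation of order 3 generates a Sylow subgroup *)

Section SylowRotation.

Variables (K : closedFieldType) (e : 'I_10 -> K) (zeta : K) (sigma : {perm 'I_10}).
Hypotheses (e_inj : injective e) (e0 : exists i, e i = 0).
Hypotheses (zeta3 : zeta ^+ 2 + zeta + 1 = 0) (zeta1 : zeta != 1).
Hypothesis sigmaE : forall i, e (sigma i) = zeta * e i.
Hypothesis rigid : forall s u, (forall i, e (s i) = u * e i) -> u != 0 -> u ^+ 3 = 1.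

Lemma zeta_cube : zeta ^+ 3 = 1.
Proof.
transitivity ((zeta - 1) * (zeta ^+ 2 + zeta + 1) + 1); first by ring.
by rewrite zeta3 mulr0 add0r.
Qed.

Lemma zeta_neq0 : zeta != 0.
Proof. by apply: contraTneq (oner_neq0 K) => z0; rewrite -zeta_cube z0 expr0n eqxx. Qed.

Lemma sigmaX j i : e ((sigma ^+ j)%g i) = zeta ^+ j * e i.
Proof.
elim: j => [|j IH]; first by rewrite expg0 perm1 mul1r.
by rewrite expgSr permM sigmaE IH exprS mulrA.
Qed.

Lemma three_indices (i0 : 'I_10) : exists i1 i2, [/\ i1 != i0, i2 != i0 & i1 != i2].
Proof.
have H (x y : nat) (Hx : (x < 10)%N) (Hy : (y < 10)%N) : x != i0 -> y != i0 -> x != y ->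
    exists i1 i2, [/\ i1 != i0, i2 != i0 & i1 != i2].
  by move=> *; exists (Ordinal Hx), (Ordinal Hy).
have [E0|E0] := eqVneq (i0 : nat) 0%N; first by apply: (H 1%N 2%N) => //; rewrite E0.
have [E1|E1] := eqVneq (i0 : nat) 1%N; first by apply: (H 0%N 2%N) => //; rewrite E1.
by apply: (H 0%N 1%N) => //; rewrite eq_sym.
Qed.

Lemma order_sigma : #[sigma]%g = 3.
Proof.
apply: nt_prime_order => //.
  by apply/permP => i; apply: e_inj; rewrite sigmaX zeta_cube mul1r perm1.
have [i0 Ei0] := e0; have [i1 [_ [i10 _ _]]] := three_indices i0.
apply: contraNneq zeta1 => s1; have e10 : e i1 != 0.
  by apply: contraNneq i10 => E; apply/eqP/e_inj; rewrite E Ei0.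
by apply/eqP/(mulIf e10); rewrite -sigmaE s1 perm1 mul1r.
Qed.

Definition moebius_perms : {set {perm 'I_10}} := [set g : {perm 'I_10} | `[< moebius e e g >]].

Lemma moebius_permsP (g : {perm 'I_10}) : reflect (moebius e e g) (g \in moebius_perms).
Proof. by rewrite inE; apply: asboolP. Qed.

Lemma moebius_perms_group_set : group_set moebius_perms.
Proof.
apply/group_setP; split.
  apply/moebius_permsP; have [al [be [ga [de [det H]]]]] := moebius_id e.
  by exists al, be, ga, de; split=> // i; rewrite perm1.
move=> g h /moebius_permsP Hg /moebius_permsP Hh; apply/moebius_permsP.
have [al [be [ga [de [det H]]]]] := moebius_comp Hg Hh.
by exists al, be, ga, de; split=> // i; rewrite permM.
Qed.
Canonical moebius_perms_group := Group moebius_perms_group_set.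

Lemma sigma_in : sigma \in moebius_perms.
Proof.
apply/moebius_permsP; exists zeta, 0, 0, 1; rewrite mulr1 mul0r subr0 zeta_neq0.
by split=> // i; rewrite mul0r add0r oner_neq0 mulr1 addr0 sigmaE.
Qed.

(* A Moebius map commuting with the rotation is again a multiplication, hence a power of it. *)
Lemma cent_sigma (g : {perm 'I_10}) : g \in moebius_perms -> commute g sigma -> g \in <[sigma]>%g.
Proof.
move=> /moebius_permsP Hg comm; have [i0 Ei0] := e0.
have [i1 [i2 [i10 i20 i12]]] := three_indices i0.
have [|u u0 gE] := rotation_moebius zeta1 Hg e_inj Ei0 i10 i20 i12 zeta_neq0 sigmaE.
  by move=> i; rewrite -sigmaE -!permM comm.
have u3 := rigid gE u0.
have : (u - 1) * ((u - zeta) * (u - zeta ^+ 2)) == 0.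
  apply/eqP; transitivity (u ^+ 3 - 1 - (zeta ^+ 2 + zeta + 1) * (u ^+ 2 - u) +
     (zeta ^+ 3 - 1) * (u - 1)); first by ring.
  by rewrite u3 zeta_cube zeta3 !subrr !mul0r subr0 addr0.
have gX j : u = zeta ^+ j -> g \in <[sigma]>%g.
  move=> uE; suff -> : g = (sigma ^+ j)%g by apply: mem_cycle.
  by apply/permP => i; apply: e_inj; rewrite gE uE sigmaX.
rewrite !mulf_eq0 !subr_eq0 => /or3P[] /eqP E.
- by apply: (gX 0%N).
- by apply: (gX 1%N).
by apply: (gX 2%N).
Qed.

(** Let P be a Sylow 3-subgroup containing the rotation. Its centre is nontrivial and commutes with
    the rotation, so it is the group of order 3 that the rotation generates. The rotation is thus
    central in P, and P is contained in its centralizer, which is that same group. *)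
Lemma sigma_Sylow : 3.-Sylow(moebius_perms) <[sigma]>%g.
Proof.
have s3 : 3.-group <[sigma]>%g by rewrite /pgroup -orderE order_sigma.
have sG : <[sigma]>%g \subset moebius_perms by rewrite cycle_subG sigma_in.
have [P sylP sP] := Sylow_superset sG s3.
have pP := pHall_pgroup sylP; have PG := pHall_sub sylP.
have cent (h : {perm 'I_10}) : h \in P -> commute h sigma -> h \in <[sigma]>%g.
  by move=> hP; apply: cent_sigma; apply: (subsetP PG).
have sigmaP : sigma \in P by rewrite -cycle_subG.
have ZP : 'Z(P)%g \subset <[sigma]>%g.
  apply/subsetP => h /centerP[hP hC]; apply: cent => //; exact: hC.
have Z1 : 'Z(P)%g != 1%g.
  apply/eqP => /(trivg_center_pgroup pP) P1; move: sP; rewrite P1 => /trivgP s1.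
  by have := order_sigma; rewrite orderE s1 cards1.
have ZE : 'Z(P)%g = <[sigma]>%g.
  apply/eqP; rewrite eqEcard ZP -orderE order_sigma /=.
  have := cardSg ZP; rewrite -orderE order_sigma => /(primeP (isT : prime 3)).2/orP[] /eqP Hc.
    by move: Z1; rewrite -cardG_gt1 Hc.
  by rewrite Hc.
suff -> : <[sigma]>%g = P by [].
apply/eqP; rewrite eqEsubset sP; apply/subsetP => h hP; apply: cent => //.
have /centerP[_ /(_ h hP)] : sigma \in 'Z(P)%g by rewrite ZE cycle_id.
by move=> E; apply: commute_sym.
Qed.

Lemma conj_in_sigma (tau : {perm 'I_10}) : tau \in moebius_perms -> #[tau]%g = 3 ->
  exists2 x, x \in moebius_perms & exists2 j, (0 < j < 3)%N & (tau ^ x)%g = (sigma ^+ j)%g.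
Proof.
move=> tauG o3; have t3 : 3.-group <[tau]>%g by rewrite /pgroup -orderE o3.
have tG : <[tau]>%g \subset moebius_perms by rewrite cycle_subG.
have [x xG] := Sylow_Jsub sigma_Sylow tG t3.
rewrite -cycleJ cycle_subG => /cyclePmin[j]; rewrite order_sigma => j3 Ej.
exists x => //; exists j => //; rewrite j3 andbT lt0n; apply/eqP => j0.
by have := orderJ tau x; rewrite Ej j0 expg0 order1 o3.
Qed.

End SylowRotation.

(** * Isomorphic curves of the family have equal parameters *)

Section HpolyIsomorphisms.

Variable K : closedFieldType.

Lemma Hpoly_coef (a b : K) i : (Hpoly a b)`_i = (i == 10)%:R + (i == 7)%:R + a * (i == 4)%:R + b *
  (i == 1%N)%:R.
Proof. by rewrite !(coefD, coefZ, coefXn, coefX). Qed.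

Lemma size_Hpoly (a b : K) : size (Hpoly a b) = 11.
Proof.
apply/eqP; rewrite eqn_leq; apply/andP; split.
  apply/leq_sizeP => i Hi; rewrite Hpoly_coef.
  by do 11 (case: i Hi => [//|i] Hi); rewrite /= !mulr0 !addr0.
rewrite ltnNge; apply/negP => /leq_sizeP/(_ 10 (leqnn _)) /eqP.
by rewrite Hpoly_coef /= !mulr0 !addr0 oner_eq0.
Qed.

Lemma Hpoly_lead (a b : K) : (Hpoly a b)`_10 = 1.
Proof. by rewrite Hpoly_coef /= !mulr0 !addr0. Qed.

Lemma Hpoly_roots (a b : K) : separable_poly (Hpoly a b) ->
  exists2 e : 'I_10 -> K, injective e & forall x, (Hpoly a b).[x] = 0 <-> exists i, e i = x.
Proof.
move=> sep; have [ts E] := closed_field_poly_normal (Hpoly a b).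
have lc : lead_coef (Hpoly a b) = 1 by rewrite /lead_coef size_Hpoly Hpoly_lead.
rewrite lc scale1r in E; have sts : size ts = 10.
  by have := size_Hpoly a b; rewrite E size_prod_XsubC => -[].
have uts : uniq ts by rewrite -separable_prod_XsubC -E.
exists (fun i => ts`_i) => [i j /eqP|x].
  by rewrite nth_uniq ?sts // => /eqP/val_inj.
have -> : (Hpoly a b).[x] = 0 <-> x \in ts.
  by rewrite -root_prod_XsubC -E; split=> [/rootP|/rootP].
split=> [/(nthP 0)[i]|[i <-]]; rewrite ?mem_nth ?sts //.
by move=> Hi <-; exists (Ordinal Hi).
Qed.

Lemma Hpoly_branch_curve (a b : K) : separable_poly (Hpoly a b) -> branch_curve (Hpoly a b).
Proof.
move=> sep; have [e e_inj eE] := Hpoly_roots sep; split.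
- by move=> x Hx; apply/eqP; apply/separable_closedP: x Hx.
- by rewrite HpolyE !expr0n /= !mulr0 !addr0.
- by rewrite size_Hpoly.
- exact: Hpoly_lead.
exists (codom e); split; first by rewrite map_inj_uniq ?enum_uniq.
  by apply/allP => x /codomP[i ->]; apply/rootP/eE; exists i.
by rewrite size_codom card_ord.
Qed.

(** With w = u^3, the difference between the second polynomial at u x and u w^3 times the first at x
    is u Q(x). Q has degree at most 7 and ten roots, so it is 0: its coefficient w^2 - w^3 gives w =
    1, and the other two give the parameters. *)
Lemma Hpoly_scaled_roots (a b c d : K) (e : 'I_10 -> K) u : injective e -> u != 0 ->
  (forall i, (Hpoly a b).[e i] = 0) -> (forall i, (Hpoly c d).[u * e i] = 0) ->
  u ^+ 3 = 1 /\ (a, b) = (c, d).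
Proof.
move=> e_inj u0 He Hue; set w := u ^+ 3.
pose Q : {poly K} := (w ^+ 2 - w ^+ 3) *: 'X^7 + (c * w - a * w ^+ 3) *: 'X^4 + (d - b * w ^+ 3) *:
  'X.
have Q_coef i : Q`_i = (w ^+ 2 - w ^+ 3) * (i == 7)%:R + (c * w - a * w ^+ 3) * (i == 4)%:R
    + (d - b * w ^+ 3) * (i == 1%N)%:R.
  by rewrite !(coefD, coefZ, coefXn, coefX).
have Q0 : Q = 0.
  apply/eqP; apply: contraT => Qn0; have := @max_poly_roots _ Q (codom e) Qn0.
  rewrite map_inj_uniq ?enum_uniq // size_codom card_ord => H.
  suff : (size Q <= 8)%N.
    rewrite leqNgt => /negP[]; apply: leq_trans (H _ isT) => //.
    apply/allP => x /codomP[i ->]; apply/rootP; apply: (mulfI u0); rewrite mulr0.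
    transitivity ((Hpoly c d).[u * e i] - u * w ^+ 3 * (Hpoly a b).[e i]).
      by rewrite !HpolyE /Q !hornerE /w /=; ring.
    by rewrite He Hue mulr0 subr0.
  apply/leq_sizeP => j Hj; rewrite Q_coef.
  by do 8 (case: j Hj => [//|j] Hj); rewrite /= !mulr0 !addr0.
have w0 : w != 0 by rewrite expf_neq0.
have w1 : w = 1.
  have E7 : w ^+ 2 - w ^+ 3 = 0 by have := Q_coef 7; rewrite Q0 coef0 /= !mulr0 !addr0 mulr1 => <-.
  apply/eqP; rewrite eq_sym -subr_eq0; apply/eqP; apply: (mulfI (expf_neq0 2 w0)).
  by rewrite mulr0 -E7; ring.
have /eqP := Q_coef 4; have /eqP := Q_coef 1%N.
rewrite Q0 !coef0 w1 /= !expr1n !mulr0 !addr0 !add0r !mulr1 ![0 == _]eq_sym !subr_eq0.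
by move=> /eqP-> /eqP->.
Qed.

Hypotheses (K2 : 2%:R != 0 :> K) (K3 : 3%:R != 0 :> K).

Lemma primitive_cube_root : exists2 zeta : K, zeta ^+ 2 + zeta + 1 = 0 & zeta != 1.
Proof.
have [z] : exists z : K, root ('X^2 + 'X + 1) z.
  apply/closed_rootP; suff -> : size ('X^2 + 'X + 1 : {poly K}) = 3 by [].
  apply/eqP; rewrite eqn_leq; apply/andP; split.
    by apply/leq_sizeP => -[|[|[|i]]] //; rewrite !coefD coefXn coefX coef1 /= !addr0.
  by rewrite ltnNge; apply/negP => /leq_sizeP/(_ 2 (leqnn _)) /eqP;
    rewrite !coefD coefXn coefX coef1 /= !addr0 oner_eq0.
move=> /rootP; rewrite !hornerE => Hz; exists z => //.
apply: contraNneq K3 => z1; apply/eqP; rewrite -Hz z1 expr1n; ring.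
Qed.

Theorem Hpoly_isomorphic_eq (a b c d : K) :
  separable_poly (Hpoly a b) -> separable_poly (Hpoly c d) ->
  curve_isomorphic 4 (Hpoly a b) (Hpoly c d) -> (a, b) = (c, d).
Proof.
move=> sep sep' iso; have [e e_inj eE] := Hpoly_roots sep.
have [e' e'_inj e'E] := Hpoly_roots sep'.
have [z z3 z1] := primitive_cube_root; have z0 := zeta_neq0 z3.
have [al [be [ga [de [det H]]]]] :=
  isomorphism_moebius K2 (Hpoly_branch_curve sep) (Hpoly_branch_curve sep') iso.
have Hz (a' b' x : K) : (Hpoly a' b').[z * x] = z * (Hpoly a' b').[x].
  have z4 : z ^+ 4 = z by rewrite exprS (zeta_cube z3) mulr1.
  have z7 : z ^+ 7 = z by rewrite (exprD z 4 3) z4 (zeta_cube z3) mulr1.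
  have z10 : z ^+ 10 = z by rewrite (exprD z 7 3) z7 (zeta_cube z3) mulr1.
  by rewrite !HpolyE !exprMn z4 z7 z10; ring.
have He i : (Hpoly a b).[e i] = 0 by apply/eE; exists i.
have He' i : (Hpoly c d).[e' i] = 0 by apply/e'E; exists i.
have zinj : injective ( *%R z) by apply: mulfI.
have [sigma sigmaE] : exists s : {perm 'I_10}, forall i, e (s i) = z * e i.
  by apply: perm_of_map => // [x y _ _|i]; [exact: zinj|apply/eE; rewrite Hz He mulr0].
have [sigma' sigma'E] : exists s : {perm 'I_10}, forall i, e' (s i) = z * e' i.
  by apply: perm_of_map => // [x y _ _|i]; [exact: zinj|apply/e'E; rewrite Hz He' mulr0].
have [mu muE] : exists s : {perm 'I_10}, forall i, e' (s i) = (al * e i + be) / (ga * e i + de).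
  apply: (perm_of_map (h := fun x => (al * x + be) / (ga * x + de))) =>
    // [_ _ /codomP[i ->] /codomP[j ->]|i].
    have [Qi _] := H _ (He i); have [Qj _] := H _ (He j) => /eqP.
    rewrite eqr_div // -subr_eq0 => /eqP E; apply: (mulfI det); apply/eqP; rewrite -subr_eq0 -E.
    by apply/eqP; ring.
  by have [_ /e'E[j Ej]] := H _ (He i); exists j.
have muM : moebius e e' mu.
  exists al, be, ga, de; split=> // i; have [Qi _] := H _ (He i); split=> //.
  by rewrite muE divfK.
have sigma'M : moebius e' e' sigma'.
  exists z, 0, 0, 1; rewrite mulr1 mul0r subr0; split=> // i.
  by rewrite mul0r add0r oner_neq0 mulr1 addr0 sigma'E.
have rigid (s : 'I_10 -> 'I_10) u : (forall i, e (s i) = u * e i) -> u != 0 -> u ^+ 3 = 1.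
  move=> Hs u0; have [] // := @Hpoly_scaled_roots a b a b e u e_inj u0 He.
  by move=> i; rewrite -Hs He.
have [i0 Ei0] : exists i, e i = 0 by apply/eE; rewrite HpolyE !expr0n /= !mulr0 !addr0.
have e0 : exists i, e i = 0 by exists i0.
(* The rotation of the second set of roots, transported to the first; products of permutations act
   from left to right. *)
pose tau := (mu * sigma' * mu^-1)%g.
have tauG : tau \in moebius_perms e.
  apply/moebius_permsP; have [al1 [be1 [ga1 [de1 [det1 H1]]]]] :=
    moebius_comp (moebius_comp muM sigma'M) (moebius_inv muM).
  by exists al1, be1, ga1, de1; split=> // i; rewrite !permM; exact: (H1 i).
have o_tau : #[tau]%g = 3.
  have -> : tau = (sigma' ^ mu^-1)%g by rewrite /tau conjgE invgK mulgA.
  rewrite orderJ; have e'0 : exists i, e' i = 0 by apply/e'E;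
    rewrite HpolyE !expr0n /= !mulr0 !addr0.
  exact: order_sigma e'_inj e'0 z3 z1 sigma'E.
have [x xG [j /andP[j0 j3] xE]] := conj_in_sigma e_inj e0 z3 z1 sigmaE rigid tauG o_tau.
have [i1 [i2 [i10 i20 i12]]] := three_indices i0.
have xM : moebius e e x by apply/moebius_permsP.
(* As x conjugates tau to a power of sigma, this corrected map turns that power into sigma', hence
   is a multiplication. The power may be either of the two nontrivial ones. *)
have sM : moebius e e' (mu \o (x^-1)%g) by apply: moebius_comp (moebius_inv xM) muM.
have [|u u0 Hu] := rotation_moebius (zeta := z) z1 sM e_inj Ei0 i10 i20 i12 (expf_neq0 j z0)
  (sigmaX sigmaE j).
  move=> i; rewrite /= -xE conjgE !permM permK -sigma'E; congr e'.
  by rewrite permKV.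
have [] // := @Hpoly_scaled_roots a b c d e u e_inj u0 He.
by move=> i; rewrite -Hu He'.
Qed.

Lemma curve_isomorphic_refl (f : {poly K}) : curve_isomorphic 4 f f.
Proof.
have same_refl (P : 3.-tuple K) : same_point 4 P P.
  by apply/same_pointP; exists 1; rewrite ?oner_neq0 // expr1n !mul1r.
have hX i : weighted_homog 4 (weight 4 i) ('X_i : {mpoly K[3]}).
  move=> m; rewrite msuppX inE => /eqP ->.
  rewrite (bigD1 i) //= big1 ?mnm1E ?eqxx ?muln1 ?addn0 // => j ji.
  by rewrite mnm1E eq_sym (negPf ji) muln0.
have idM : curve_morphism 4 f f id.
  split=> // P HP; exists 1%N, 'X_iX, 'X_iZ, 'X_iY; split; try exact: hX.
    have [[i Pi] E] := HP; rewrite !mevalXU.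
    have [X0|?] := eqVneq (tnth P iX) 0; last by left.
    have [Z0|?] := eqVneq (tnth P iZ) 0; last by right.
    (* The forms X and Z have no common zero on the curve: there the right-hand side of the equation
       vanishes by homogeneity, so Y = 0 as well. *)
    move/eqP: E; rewrite X0 Z0 -[X in homogenization _ _ X _](mul0r 0) -[X in homogenization _ _ _
      X](mul0r 0).
    rewrite homogenization_scale expr0n mul0r expf_eq0 /= => /eqP Y0.
    suff /(_ i) E : forall i, tnth P i = 0 by rewrite E eqxx in Pi.
    exact: forall_coord.
  move=> Q HQ _; apply/same_pointP; exists 1; rewrite ?oner_neq0 //.
  by rewrite !(tnth_nth 0) /= !mevalXU expr1n !mul1r !(tnth_nth 0).
by exists id, id; split.
Qed.

End HpolyIsomorphisms.

(** * From parameters in K to pairs over F_(p^2) *)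

Section Counting.

Variables (p : nat) (F : finFieldType) (K : closedFieldType) (iota : {rmorphism F -> K}).
Hypotheses (p_pr : prime p) (p_ge : (4 < p)%N) (cardF : #|F| = (p ^ 2)%N).

Lemma char_closure : p \in [pchar K].
Proof. by rewrite (fmorph_pchar iota) (card_finPcharP cardF). Qed.

(** The images of the p^2 elements of F are already all the roots of X^(p^2) - X. *)
Lemma iota_image (x : K) : x ^+ (p ^ 2) = x -> exists z, iota z = x.
Proof.
move=> Hx; have [[z Hz]|no] := EM (exists z, iota z = x); first by exists z.
have p2 : (1 < p ^ 2)%N by rewrite -{1}(exp1n 2) ltn_exp2r ?prime_gt1.
pose P : {poly K} := 'X^(p ^ 2) - 'X.
have sP : size P = (p ^ 2).+1.
  by rewrite size_polyDl size_polyXn // size_polyN size_polyX ltnS.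
have P0 : P != 0 by rewrite -size_poly_eq0 sP.
have := @max_poly_roots _ P (x :: [seq iota z | z <- enum F]) P0.
rewrite sP /= size_map -cardE cardF ltnn => H; suff : false by [].
apply: H.
  rewrite /root !hornerE Hx subrr eqxx /=; apply/allP => _ /mapP[z _ ->].
  by rewrite /root !hornerE -rmorphXn -cardF expf_card subrr.
rewrite map_inj_uniq ?enum_uniq ?andbT; last exact: fmorph_inj.
by apply/negP => /mapP[z _ E]; apply: no; exists z.
Qed.

Let K2 : 2%:R != 0 :> K.
Proof. by apply: (natf_lt_char char_closure); apply: leq_trans p_ge. Qed.

Let K3 : 3%:R != 0 :> K.
Proof. by apply: (natf_lt_char char_closure); apply: leq_trans p_ge. Qed.

Lemma superspecial_paramsP ab : ab \in superspecial_params p iota <->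
  separable_poly (HK iota ab) /\ superspecial 4 p (HK iota ab).
Proof. by rewrite inE; split=> [/asboolP|H]; [|apply/asboolP]. Qed.

(** Every isomorphism class is a singleton, since isomorphic members of the family coincide. *)
Lemma num_iso_classes_params : num_iso_classes p iota = #|superspecial_params p iota|.
Proof.
have iso_class1 : {in superspecial_params p iota, forall ab, iso_class p iota ab = [set ab]}.
  move=> [a b] abS; apply/setP => -[c d]; rewrite inE in_set1.
  apply/andP/eqP => [[cdS /asboolP iso]|->].
    have /superspecial_paramsP[sep _] := abS; have /superspecial_paramsP[sep' _] := cdS.
    by have [/fmorph_inj -> /fmorph_inj ->] := Hpoly_isomorphic_eq K2 K3 sep sep' iso.
  by split=> //; apply/asboolP/curve_isomorphic_refl.
rewrite /num_iso_classes (eq_in_imset iso_class1) card_imset //; exact: set1_inj.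
Qed.

Lemma superspecial_params_mod1 : (p %% 3 = 1)%N -> superspecial_params p iota = set0.
Proof.
move=> p1; apply/setP => ab; rewrite in_set0; apply/negP => /superspecial_paramsP[sep].
have odd_p : odd p by case/even_prime: p_pr p_ge => // ->.
have pE : p = (6 * (p %/ 6)).+1 by move: odd_p p1; lia.
by apply: (not_superspecial_mod1 char_closure pE) => //; lia.
Qed.

Lemma card_superspecial_params pN count g l1 l2 : N.to_nat pN = p -> (p %% 3 = 2)%N ->
  (p <= 1024)%N -> check (pN, count, g, l1, l2) ->
  #|superspecial_params p iota| = N.to_nat count.
Proof.
move=> pNE p2 p_le checked.
have odd_p : odd p by case/even_prime: p_pr p_ge => // ->.
have pE : N.to_nat pN = (6 * ((p - 5) %/ 6) + 5)%N by rewrite pNE; move: odd_p p2; lia.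
move: char_closure p_pr p_le; rewrite -pNE => charK pr le.
have [ms [abs [[uniq_ms size_ms ms0] [uniq_abs <- frob] cert_ms cert_abs]]] :=
  check_sound pE pr le charK checked.
have cl := classification charK pE uniq_ms size_ms ms0 cert_ms cert_abs.
rewrite pNE in cl frob.
pose img (ab : F * F) : K * K := (iota ab.1, iota ab.2).
rewrite pNE cardE -(size_map img); apply: perm_size; apply: uniq_perm => //.
  rewrite map_inj_uniq ?enum_uniq // => -[a b] [a' b'] [] /fmorph_inj -> /fmorph_inj -> //.
move=> xy; apply/mapP/idP => [[ab]|xyabs].
  rewrite mem_enum => abS ->.
  exact: (cl (img ab)).2 ((superspecial_paramsP ab).1 abS).
have [Hx Hy] := frob xy xyabs; have [a Ha] := iota_image Hx; have [b Hb] := iota_image Hy.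
exists (a, b); last by rewrite /img /= Ha Hb; case: (xy).
by rewrite mem_enum; apply/superspecial_paramsP; rewrite /HK /= Ha Hb; apply: (cl xy).1.
Qed.

End Counting.

(** * The certificates and their verification *)

Definition certificates : seq certificate := [::
  (17, 1, 3, [:: (3,7015,[:: 16000]);(5,6013,[:: 5000])], [::]);
  (23, 2, 5, [:: (3,10022,[::]);(8,9000,[:: 10000]);(0,1000,[:: 6000;17000])], [::]);
  (29, 1, 2, [:: (3,13024,[:: 4008;18000]);(17,6016,[::]);(8,25027,[::])], [::]);
  (41, 4, 6, [:: (3,19013,[:: 22017;35000]);(27,7021,[:: 24000]);(29,6007,[:: 13000]);
    (35,3008,[:: 18000])], [::]);
  (47, 5, 5, [:: (3,22016,[::]);(1,23031,[:: 24000]);(32,25000,[:: 17000;19000;44000]);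
    (8,10000,[:: 9000]);(0,1000,[::])], [::]);
  (53, 4, 2, [:: (3,25024,[:: 52000]);(41,6017,[::]);(8,49051,[:: 13000;38000])],
    [:: (10021,[:: 50014])]);
  (59, 6, 2, [:: (3,28019,[::]);(15,22038,[:: 20000]);(17,21034,[:: 48006]);(36,41047,[::]);
    (37,6000,[:: 14000;28000]);(0,1000,[:: 23000;36000])], [::]);
  (71, 9, 7, [:: (3,34055,[:: 14017;40000;70000]);(27,22020,[:: 15000]);(9,41000,[:: 1000;
    11000;40000;43000]);(6,40000,[:: 53000]);(18,62003,[:: 6000]);(36,51000,[:: 30000]);
    (0,1000,[::])], [::]);
  (83, 8, 2, [:: (3,40050,[:: 43001;77000]);(38,64028,[::]);(24,43000,[:: 49000;71000]);
    (36,65071,[:: 57000;65000]);(61,11069,[:: 11000]);(0,1000,[:: 6;9000;74000])],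
    [:: (28010,[::])]);
  (89, 7, 3, [:: (3,43017,[:: 88000]);(15,37006,[:: 9000;67000;80000]);
    (29,30063,[:: 86000]);(54,62074,[::]);(26,76014,[:: 39000]);(77,6004,[:: 29000;53000])],
    [:: (17010,[::])]);
  (101, 8, 2, [:: (3,49054,[:: 17025;64000]);(86,58086,[::]);(74,64030,[:: 33000]);
    (51,25061,[:: 67000]);(89,6023,[::]);(10,96082,[:: 31050;92000]);(8,97002,[::])],
    [:: (5015,[:: 15052])]);
  (107, 4, 2, [:: (3,52021,[:: 106000]);(9,49033,[:: 73029]);(36,89012,[:: 54000]);
    (50,63000,[:: 43000]);(10,102032,[::]);(0,1000,[::])], [:: (5028,[::]);(2050,[::])]);
  (113, 14, 3, [:: (3,55049,[:: 34040;42000]);(110,58097,[:: 13000;30032;40000;69000;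
    76000]);(34,96057,[:: 46000;84000]);(101,6004,[:: 37000])], [:: (39001,[:: 42]);
    (6056,[:: 27072]);(2023,[::])]);
  (131, 18, 2, [:: (3,64004,[:: 13061;28021;87040]);(27,52116,[:: 7000]);(94,84072,[::]);
    (6,35000,[:: 96000]);(74,94053,[:: 70033;78000]);(36,113119,[:: 7000;97021]);
    (34,114018,[::]);(22,8000,[:: 89000;120000]);(12,125076,[:: 54000;91000;125000]);
    (0,1000,[:: 22000;52000;55000;76000;79000;109000])], [:: (21047,[::])]);
  (137, 12, 3, [:: (3,67050,[:: 23066;88000]);(53,42043,[:: 12000;92046;119034]);
    (91,23003,[:: 91000]);(125,6133,[:: 45000])], [:: (45055,[::]);(8035,[::]);
    (4059,[:: 109112;115134]);(2022,[::])]);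
  (149, 18, 2, [:: (3,73117,[::]);(136,81146,[:: 14000;43000]);(65,42103,[:: 105000]);
    (58,120082,[:: 35000;60047;134000]);(117,16012,[::]);(137,6089,[:: 43000]);
    (8,145147,[:: 58069])], [:: (8027,[::]);(7040,[:: 24105;111096]);(5010,[:: 68061;
    75134])]);
  (167, 26, 5, [:: (3,82143,[:: 75000;128013]);(152,91132,[::]);(150,92107,[::]);
    (144,95029,[:: 89000]);(77,45016,[:: 8000]);(90,31000,[:: 119000;154000]);
    (76,14000,[:: 2000;31000;148037]);(28,154000,[:: 4000;8000;48000;103000;153000;
    165000]);(8,22000,[:: 70000;92000;141000]);(36,160000,[:: 10000;17000]);
    (0,1000,[:: 10071;57000;110000;157071])], [:: (44009,[::]);(8019,[:: 37142;104028])]);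
  (173, 22, 2, [:: (3,85155,[::]);(94,126148,[:: 26000;78000]);(58,144085,[:: 54000;
    172000]);(42,152074,[::]);(141,16161,[:: 26000;31083]);(161,6071,[::]);
    (8,169002,[:: 129000])], [:: (66020,[:: 15140]);(18077,[:: 28130;87046;132147]);
    (8026,[::]);(2025,[:: 72146;102027;104036])]);
  (179, 17, 2, [:: (3,88102,[:: 178000]);(25,77025,[:: 55050]);(39,70112,[:: 90000]);
    (75,52144,[::]);(37,94000,[:: 53000]);(90,152000,[:: 13000;148000;161000]);
    (36,161167,[::]);(22,168026,[::]);(14,172069,[:: 62023;90000;138000]);(0,1000,[::])],
    [:: (60077,[::]);(26032,[:: 111131]);(15031,[:: 49004;81029])]);
  (191, 32, 19, [:: (3,94026,[::]);(1,95026,[:: 11000;71000;79000;101000]);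
    (180,101016,[:: 8000]);(5,100000,[:: 155000;165000;170000]);(59,66014,[::]);
    (10,41000,[:: 79000;106000;118000;126000;154000]);(8,110000,[:: 7000;173000;175000]);
    (149,21161,[::]);(26,178174,[:: 79000;135059]);(96,181000,[:: 11000;84000;185000]);
    (20,46000,[:: 59085]);(36,93000,[:: 65000;112000;181000]);(0,1000,[:: 18000;173000])],
    [:: (59024,[:: 121052]);(22037,[:: 159041])]);
  (197, 21, 2, [:: (3,97127,[:: 32089;48035;98000;130000;196000]);(87,55175,[:: 52000;
    80000]);(111,43188,[:: 23000;32000;61089]);(185,6040,[:: 176000]);(8,193002,[::])],
    [:: (51069,[:: 14043]);(50090,[:: 193139]);(49022,[::]);(34059,[:: 117171;165031]);
    (11006,[:: 12103]);(10063,[:: 129013])]);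
  (227, 29, 2, [:: (3,112153,[::]);(182,136109,[:: 155000]);(160,147214,[:: 181038]);
    (121,53045,[::]);(41,138000,[:: 1000;156000;193000]);(147,40039,[:: 25000;50000]);
    (36,209215,[:: 48000;168005]);(203,12068,[:: 67000]);(50,191000,[:: 3000;29000]);
    (0,1000,[:: 75000;152000])], [:: (48081,[:: 130000]);(47051,[:: 72;5136;32139;53103]);
    (18003,[:: 221057]);(14086,[:: 8138]);(9052,[::])]);
  (233, 30, 3, [:: (3,115072,[:: 125000;169015;232000]);(186,140005,[:: 50019;54000;64000;
    166032]);(95,69085,[:: 13000;18000;27040;48027;77000;173000]);(145,44036,[:: 25000;
    228000]);(191,21188,[:: 36000]);(221,6229,[:: 77000;168000])], [:: (57043,[:: 110122;
    167121;201094]);(55109,[::]);(49106,[::]);(41003,[::]);(28025,[::]);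
    (16006,[:: 33132]);(14041,[:: 142102])]);
  (239, 36, 7, [:: (3,118176,[:: 45000;61075;114000;215030]);(11,114144,[::]);
    (232,123095,[::]);(27,106147,[:: 211000]);(216,131147,[::]);(162,158138,[:: 83000]);
    (10,174000,[:: 13000;70000;159000]);(8,37000,[:: 1000;168000]);(91,176000,[:: 26000;
    135000;145000;217000]);(100,227000,[:: 87000]);(36,228000,[:: 142000;145000]);
    (225,7003,[:: 15000;130000]);(16,177000,[::]);(44,117000,[:: 27000;31000;33000;151000;
    175000]);(0,1000,[:: 68000;80000;96000;143000;159000;171000])], [:: (8111,[::]);
    (3084,[:: 26011;30099;226087]);(80,[:: 36218;232034])]);
  (251, 28, 6, [:: (3,124040,[:: 62020;124000;250000]);(214,144050,[::]);
    (51,100199,[:: 26000]);(81,85176,[::]);(115,68195,[:: 49000]);(94,204224,[:: 172036;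
    218000;235000]);(102,105000,[:: 192000]);(111,102000,[:: 14000;70000;136000;149000;
    248000]);(74,214225,[:: 69;39000]);(99,22000,[:: 14000;62000;148000;225000;249000]);
    (36,233053,[::]);(227,12084,[:: 166000]);(243,4002,[::]);(0,1000,[:: 45000;113000;
    138000;206000])], [:: (86059,[::]);(39070,[:: 41029]);(24110,[::]);(5017,[:: 27009])]);
  (257, 28, 3, [:: (3,127008,[::]);(5,126218,[:: 60000;207077]);(19,119208,[:: 200000]);
    (125,66089,[:: 26000;82000;210000;229000]);(20,247055,[::]);(245,6004,[:: 85000]);
    (12,251137,[:: 149000;153078;182000]);(6,254001,[:: 47000])], [:: (81049,[:: 206058]);
    (64061,[:: 186030]);(43036,[:: 246236]);(40068,[:: 14198;163137;185024]);(10126,[::]);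
    (8050,[::]);(7070,[:: 61207])]);
  (263, 58, 5, [:: (3,130117,[:: 36000;112121]);(49,107142,[:: 24125;37000;51074;132000;
    175000]);(31,162000,[:: 38000;74000;98000;184000;202001;206000;212000]);
    (12,57000,[:: 133000;134000;185000;200028;215000;242000;246000]);(78,52000,[::]);
    (8,39000,[:: 103000;113000;144000;151048]);(221,21192,[::]);(34,246083,[:: 254000]);
    (32,247237,[::]);(6,20000,[:: 236000]);(249,7152,[:: 108;68027;250000]);
    (52,218000,[:: 37000;136000;180000;204000]);(0,1000,[::])], [:: (60114,[:: 107129;
    193000;214019]);(30052,[:: 190113]);(20038,[::]);(10101,[:: 43160;146147;201139;
    220032]);(2083,[:: 205135])]);
  (269, 32, 2, [:: (3,133043,[:: 47002;72087;86050;94000;147089;268000]);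
    (17,126172,[:: 13000;192000]);(192,173132,[:: 36000;103000]);(83,93168,[:: 126100;
    218000]);(158,190032,[::]);(137,66250,[:: 135035]);(130,204090,[::]);(88,225099,[::]);
    (60,239107,[:: 176000]);(257,6232,[:: 85000;157095;245000]);(8,265002,[:: 33026;
    206000])], [:: (78086,[:: 16041;108104]);(60107,[:: 90046]);(45046,[::]);
    (42131,[:: 41091]);(38079,[::]);(11010,[:: 27191;168002])]);
  (281, 34, 3, [:: (3,139114,[:: 12000;74000;102120;133077;182136;195000]);
    (47,117198,[:: 13000;148000]);(226,168182,[:: 13000;193000;213000]);(122,220194,[::]);
    (199,41139,[:: 2000;88000]);(74,244251,[::]);(221,30243,[:: 108103;233000]);
    (269,6277,[:: 93000;182000]);(12,275264,[:: 242140]);(6,278001,[:: 72128;146000])],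
    [:: (98130,[::]);(46029,[:: 247097]);(32092,[:: 56246;98187]);(31092,[:: 79138]);
    (21048,[:: 122193]);(11018,[:: 162201]);(4056,[:: 174060])]);
  (293, 29, 2, [:: (3,145016,[:: 2096;286000]);(41,126118,[:: 221000;251000]);
    (242,172030,[:: 217000]);(111,91139,[:: 20000;245000;274000]);(162,212065,[:: 195000]);
    (171,61137,[:: 152000;282000]);(215,39052,[::]);(281,6209,[:: 87000;144063;261000]);
    (8,289002,[:: 165000])], [:: (47019,[:: 103089]);(41123,[::]);(29054,[:: 234212]);
    (25059,[:: 124257]);(24128,[:: 252233]);(9030,[:: 215164]);(6060,[:: 124208]);
    (3011,[:: 67255])]);
  (311, 62, 17, [:: (3,154242,[::]);(21,145195,[::]);(8,128000,[:: 161101;163000]);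
    (242,190015,[:: 14000]);(240,191031,[:: 84035]);(105,103093,[:: 95000]);
    (25,101000,[:: 76000;109000;273000;306000;310113]);(137,87247,[:: 34000;107146;
    296000]);(159,76180,[::]);(14,96000,[:: 38000;145000]);(150,91000,[:: 90000;176000;
    304000]);(140,241223,[:: 17000;201043]);(64,204000,[:: 16000;133000;187148]);
    (134,243000,[:: 56000;85000;206000;305000]);(166,28000,[:: 34000;53000;193000;
    276000]);(130,282000,[:: 22120;74000;142000;145033;304000]);(273,19225,[:: 31000;
    115000]);(59,248000,[:: 1000;33131;47000;137000;163000;272000]);(0,1000,[:: 9;62000;
    125000;186000;249000])], [:: (83136,[:: 276183]);(14066,[::]);(11029,[:: 267008]);
    (7119,[:: 61130])]);
  (317, 21, 2, [:: (3,157223,[:: 19044;38000;138138;276000]);(29,144067,[:: 101096;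
    284000]);(30,302016,[:: 139000;280000]);(305,6179,[::]);(8,313315,[::])],
    [:: (109094,[::]);(97097,[:: 298187]);(78020,[::]);(64007,[:: 198170]);(59130,[:: 99308;
    183077]);(48061,[:: 289022]);(34067,[:: 196269]);(34025,[::]);(18044,[:: 168163]);
    (5007,[::]);(2148,[::])]);
  (347, 61, 2, [:: (3,172199,[:: 20000;93000;162015;216037;259000;299032]);
    (28,193000,[:: 162000;325000]);(236,229286,[:: 293000]);(197,75262,[:: 154000;300000]);
    (219,64270,[::]);(116,289139,[:: 66000;228143;253026]);(88,235000,[:: 42000;281000;
    307000;328000]);(36,329335,[:: 260116]);(341,3212,[:: 13068;277000]);(0,1000,[:: 45;
    72000;73000;83000;102000;245000;264000;274000;275000])], [:: (98017,[:: 332223]);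
    (72093,[:: 99176]);(70100,[:: 3341;30148;107165;192000;256241]);(65097,[:: 67078]);
    (53150,[:: 342099]);(51008,[:: 24010;135234]);(48132,[:: 306299]);(33134,[:: 213107;
    306299]);(26066,[:: 226104]);(6127,[:: 147321;276000])]);
  (353, 25, 3, [:: (3,175332,[::]);(5,174335,[::]);(322,192240,[:: 239000;347000]);
    (101,126344,[:: 196000]);(175,89200,[:: 255000;277000;311000]);(26,340049,[:: 26000;
    155000]);(20,343144,[:: 278000]);(341,6004,[:: 117000;163000;323031])],
    [:: (100029,[::]);(89072,[:: 239345;243297]);(87074,[::]);(65173,[:: 109327]);
    (43056,[::]);(42050,[::]);(20170,[:: 122032]);(19083,[::]);(18174,[::]);
    (7079,[:: 70067]);(5124,[:: 348276])]);
  (359, 55, 7, [:: (3,178351,[:: 207097;301000;358000]);(69,145116,[::]);(81,139301,[::]);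
    (256,231048,[:: 303000]);(27,125000,[:: 80000;229000;259000]);(36,113000,[::]);
    (141,109353,[:: 93000]);(182,268126,[:: 268003]);(173,129000,[:: 200000]);
    (108,305014,[::]);(229,182000,[:: 56000;121000;143000;261000;284086;314000;345000]);
    (39,46000,[:: 41000;97000;185000;230000;233000;266012]);(192,270000,[:: 91000;110098;
    129142]);(66,326194,[:: 10000;271000]);(60,329185,[:: 324000]);(37,167000,[:: 42000;
    86000;101000;128000;171000;290000;296000;338000]);(8,317000,[:: 174000]);
    (55,313000,[:: 44000;234000;346000]);(0,1000,[:: 29000;330000])], [:: (67127,[::]);
    (49151,[::]);(42080,[:: 62356]);(38122,[::]);(35158,[:: 47227;165323;181033;348257]);
    (16127,[::])]);
  (383, 72, 5, [:: (3,190174,[:: 111000;326045]);(1,191174,[:: 34000;208038;315000]);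
    (139,122280,[:: 59000;154051;270000]);(128,134000,[:: 51000;170083;178000;193000;
    206000]);(149,117289,[:: 123000]);(235,74277,[::]);(8,270000,[:: 131000;177000]);
    (54,269000,[:: 35000;221000]);(7,166000,[:: 65000;143000;301000;331000]);
    (131,226000,[:: 15000;95000;174000;366000]);(145,299000,[:: 57000;207000;213000;
    317000;328000]);(363,10287,[:: 340000]);(24,371287,[:: 58000;121181;291000;353000]);
    (137,333000,[:: 61000;81000;166000;266154;289000;357000]);(36,94000,[:: 63000;140000;
    279000;301000;305000;318000]);(0,1000,[:: 43;122;130;141000;242000]);
    (2,382060,[:: 215060;357103])], [:: (69030,[::]);(59150,[:: 7;117265]);
    (45149,[:: 145035]);(45142,[::]);(40133,[:: 185196;355133]);(34125,[:: 173364]);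
    (32098,[::]);(8086,[::])]);
  (389, 49, 2, [:: (3,193027,[:: 33109;320000]);(23,183028,[:: 174000;189000;299000]);
    (314,232260,[:: 334115]);(131,129053,[:: 335130]);(250,264122,[:: 52000;282000;292137;
    320095]);(217,86214,[:: 308000]);(271,59382,[:: 99008;213134;250000]);
    (110,334277,[:: 12134]);(377,6056,[::]);(387,1014,[:: 143000;191000]);
    (8,385387,[:: 293000;305000;352000])], [:: (89170,[:: 20165]);(87161,[::]);
    (70085,[:: 336216]);(59026,[:: 275051]);(58186,[:: 105366;195239;268154;368358]);
    (26178,[::]);(17172,[:: 30037;41222]);(12017,[::]);(11186,[:: 43079]);(7129,[::]);
    (5132,[:: 128070])]);
  (401, 44, 3, [:: (3,199010,[:: 254113;291000]);(210,296040,[:: 185000;200000]);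
    (199,101119,[::]);(182,310359,[:: 240111]);(84,359031,[:: 77000]);
    (325,38192,[:: 348000]);(333,34316,[:: 169198;213096;306000]);(74,364052,[:: 55000;
    178095]);(335,33321,[:: 63000;134000;242000;300000]);(389,6397,[:: 8000;120000;
    133000])], [:: (100103,[:: 162396;232164]);(84054,[:: 284244;301019]);
    (60080,[:: 125365]);(55103,[:: 109208]);(49005,[:: 188046;215128]);(46013,[::]);
    (43117,[::]);(33183,[:: 199130;199256;372088]);(23001,[::]);(16042,[::]);(13056,[::]);
    (12192,[::])]);
  (419, 61, 2, [:: (3,208142,[:: 189000;323164]);(81,169149,[::]);(87,166213,[:: 165180]);
    (292,273094,[::]);(150,116000,[:: 43000;276000]);(205,107268,[:: 26000;286000;397151]);
    (215,102081,[:: 53000]);(167,151000,[:: 15000;300000]);(225,97365,[:: 286084;292000;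
    303000]);(216,96000,[:: 44000;115000;160000;174000;260000]);(243,88138,[:: 287000;
    393023]);(178,330392,[:: 80000;320000]);(108,365203,[:: 173000;289000]);
    (343,38104,[:: 37000;178082]);(246,218000,[:: 127000;148000;234000]);(36,401407,[::]);
    (28,405092,[:: 92125;207000]);(0,1000,[::])], [:: (141020,[:: 351018]);(95155,[::]);
    (64071,[:: 283398]);(34204,[:: 58296]);(25155,[:: 276120]);(25150,[:: 102000;252207;
    393332]);(24183,[:: 369393]);(23163,[:: 207099;261063;284233;396183]);(11006,[::])]);
  (431, 72, 7, [:: (3,214156,[:: 73186;141089;146000;282000;430000]);(41,195055,[:: 205000;
    238000]);(278,292417,[:: 163000;202000;356000]);(91,205000,[:: 340000]);
    (256,303048,[:: 36000;319000]);(207,112010,[:: 202188]);(228,317010,[:: 75000;303000;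
    385000]);(194,126000,[:: 167164;238000;245000]);(29,184000,[:: 60000;83000]);
    (57,186000,[:: 5000;106000;333150;369000;396000;427177]);(89,263000,[:: 52000;133000;
    182000;261000]);(36,312000,[:: 33000;174000]);(297,67124,[::]);(138,362307,[:: 7000]);
    (235,328000,[:: 88000;152000;217000;313000]);(8,51000,[:: 2000;11000;224000;255000;
    352000]);(353,39202,[:: 14000]);(24,207000,[:: 147000;183069;302000;305000;313000]);
    (45,414000,[:: 417000]);(30,416393,[:: 244110]);(0,1000,[:: 107000;324000])],
    [:: (108021,[:: 189152]);(57113,[:: 240272]);(23164,[:: 400000]);(13046,[:: 356107]);
    (9207,[:: 283293]);(3181,[:: 207271;404315]);(19,[:: 1252]);(3,[::])]);
  (443, 50, 2, [:: (3,220099,[::]);(89,177405,[:: 346000]);(352,267129,[:: 116203;119087;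
    154000;167000]);(98,152000,[:: 325000]);(265,89286,[::]);(166,360079,[::]);
    (146,370191,[:: 305000;349000]);(223,29000,[:: 226000;369000;391000]);
    (36,425431,[:: 60000;122214]);(0,1000,[::])], [:: (196217,[:: 287076]);
    (161170,[:: 96017]);(134162,[:: 138218;214382]);(113197,[:: 268289]);
    (91079,[:: 239098]);(88121,[:: 336400;357210]);(84034,[:: 36000;106042;153310]);
    (59200,[::]);(29111,[:: 76000;266282]);(20162,[:: 123072]);(14166,[:: 440344]);
    (12127,[::]);(12117,[:: 7238;441202]);(6212,[::])]);
  (449, 38, 3, [:: (3,223258,[:: 33033;380000;448000]);(15,217032,[::]);
    (428,235400,[:: 384000]);(71,189125,[:: 98000;202000;311000;347125]);
    (332,283247,[:: 44000;122000]);(165,142009,[:: 261000]);(279,85128,[:: 130000;278000]);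
    (94,402016,[:: 235055]);(84,407088,[:: 278160]);(437,6445,[:: 3000;149000])],
    [:: (115221,[::]);(97102,[:: 431417]);(96093,[:: 41010]);(89196,[::]);
    (84083,[:: 393364]);(69150,[:: 227342]);(58144,[::]);(51159,[:: 329398]);(48145,[::]);
    (37101,[:: 199]);(25189,[::]);(20039,[:: 197309;235118]);(11058,[:: 23406]);
    (7059,[:: 60430])]);
  (461, 54, 2, [:: (3,229314,[:: 133211;192000;245053;429000]);(155,153032,[::]);
    (209,126212,[:: 371000;404000]);(250,336452,[:: 29000;409000;437000]);
    (176,373412,[::]);(315,73335,[:: 97000;135000;208000]);(148,387153,[::]);
    (146,388136,[:: 55056;141000]);(124,399457,[:: 329000]);(108,407186,[:: 92109]);
    (106,408175,[:: 35000;433000]);(429,16449,[:: 196037;289000]);(449,6255,[:: 99000;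
    168000;271000]);(459,1179,[::]);(8,457459,[:: 64000;318000])], [:: (142165,[:: 120017;
    267250]);(90016,[::]);(74160,[::]);(65117,[:: 280397]);(61091,[:: 155277]);
    (59186,[:: 353266]);(42095,[:: 413076]);(41069,[::]);(26224,[::]);(26154,[:: 37246;
    369026;429387]);(23188,[:: 2233;101255;372180;437337]);(8192,[:: 392318])]);
  (467, 73, 2, [:: (3,232092,[:: 291023;349000;466000]);(380,277413,[:: 109000;328000;
    393000]);(374,280318,[:: 176000]);(223,122162,[:: 184000;218000]);(267,100373,[:: 64000;
    396000]);(19,80000,[:: 5000;23000;196000]);(154,390188,[:: 333000]);
    (325,71081,[:: 300000;406108]);(90,422326,[:: 86022;441042]);(166,40000,[:: 6000;32000;
    295000;435000]);(407,30078,[:: 36000;255000;269000]);(259,435000,[:: 124000;209000;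
    447000;466000]);(36,449012,[:: 17000;269000;382000]);(0,1000,[:: 76000;391000])],
    [:: (187191,[::]);(175138,[:: 64167]);(124024,[:: 64167;141459]);(103003,[:: 29199;
    56340;386157]);(99156,[:: 138061]);(87187,[:: 120198;359145;363129;411298;428184]);
    (58028,[:: 310181]);(36112,[::]);(34207,[:: 191407;265434]);(20078,[::]);
    (20056,[:: 238143;241193;254369]);(10225,[::]);(10062,[:: 97140])]);
  (479, 82, 13, [:: (3,238337,[::]);(33,223190,[:: 141000;224000;364103]);
    (450,254289,[:: 127135;244000]);(147,166066,[:: 164000;442000]);(336,311066,[::]);
    (320,319232,[:: 350000]);(175,152269,[:: 407212]);(231,124405,[::]);
    (7,346000,[:: 174000]);(36,133000,[:: 49000;290000]);(214,165000,[:: 62000;90000]);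
    (8,101000,[:: 78000;89000;302191]);(178,390415,[:: 263000;399085]);(77,64000,[:: 9000;
    25000;139000;151000;219000;348000]);(128,415011,[:: 131000;133036;209133;243034]);
    (135,401000,[:: 195000;282000;367000;400000;407000;467000]);(50,258000,[:: 186000;
    214202;344000]);(95,20000,[:: 41000;227000;291000;348000]);(46,458000,[:: 53000;
    235000;429000]);(6,445000,[:: 46000;462000;477184]);(453,13203,[:: 204000;353000]);
    (60,468000,[:: 474000]);(146,341000,[:: 97000;114075;163000]);(0,1000,[:: 165000;
    230000;249000;314000]);(2,478099,[:: 458000])], [:: (215010,[:: 91390]);(118089,[::]);
    (84101,[::]);(75086,[:: 60135;285377]);(50029,[:: 127464]);(31072,[::]);
    (26234,[:: 42364;171143]);(21189,[:: 169179])]);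
  (491, 79, 2, [:: (3,244045,[:: 22106;139000;420083;444000]);(71,210252,[:: 19064;21000;
    385069]);(99,196234,[:: 129221;138000;141000]);(378,302141,[:: 170059;427000]);
    (290,346093,[::]);(226,378466,[:: 242218;334000;444064]);(305,93401,[:: 463000]);
    (164,409219,[::]);(341,75095,[:: 288000]);(162,406000,[:: 190000;281000;437000;
    460000]);(369,61345,[:: 328000;438027]);(265,313000,[:: 15000]);
    (106,438319,[:: 158052]);(401,45292,[:: 427125;433000]);(66,30000,[:: 175000;267000;
    324000]);(252,19000,[:: 111000;263000;319000;363000;443000]);(36,473479,[:: 39000;
    204000;339000;447000]);(0,1000,[:: 172;172000;230000;261000;319000])],
    [:: (73192,[::]);(67193,[::]);(62077,[::]);(60083,[:: 340407]);(50239,[:: 167041;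
    415074]);(49062,[:: 123147;247140;264143;370247]);(46146,[:: 78324;447471]);
    (32156,[:: 70471]);(20025,[:: 386367]);(15008,[:: 245292;338103]);(12019,[:: 335447]);
    (4071,[:: 157000])]);
  (503, 93, 5, [:: (3,250498,[:: 98000;122224;201008;256000;502000]);
    (484,261098,[:: 250000;387000;481000;501000]);(416,295114,[::]);(131,186086,[:: 98000;
    381169;442000]);(310,348242,[:: 206059;237000;374000;456000]);(231,136249,[:: 411000;
    430231]);(258,374137,[::]);(63,213000,[:: 68000;170000;249000;282000;466000]);
    (271,116478,[:: 123000;140000]);(36,357000,[:: 327000]);(224,391215,[::]);
    (26,164000,[:: 138000;209000;382000;383000]);(275,370000,[::]);(8,310000,[:: 69000;
    230000;262000;347000;408026]);(126,69000,[:: 26000;31000;187000;483000]);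
    (50,414000,[:: 58000;258000;270000;310000;501217]);(463,20162,[:: 79000;205000]);
    (16,417000,[:: 178000;262228;291000;292000;320000;391000;419000]);
    (92,496000,[:: 135000;183000;221000;255000;272000]);(88,166000,[:: 465000]);
    (0,1000,[:: 211000;251163;252163;292000])], [:: (188078,[::]);(60047,[:: 361401]);
    (36055,[:: 287162;318116;456147;481372]);(30170,[:: 3289]);(28251,[::]);
    (28074,[:: 53324;423100]);(23224,[:: 76115;381334]);(19198,[:: 245013;360115]);
    (16007,[:: 245015]);(15021,[::]);(14234,[:: 274005])]);
  (509, 59, 2, [:: (3,253137,[::]);(468,275483,[::]);(458,280304,[::]);
    (432,293035,[:: 143000;336000]);(87,211432,[::]);(390,314073,[::]);
    (163,173185,[:: 290032]);(193,158248,[::]);(318,350311,[::]);(233,138045,[::]);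
    (257,126406,[:: 117000;263000;416000;446000]);(162,428020,[::]);(397,56126,[:: 123219;
    402000]);(497,6445,[:: 153148]);(8,505507,[::])], [:: (155095,[::]);(124097,[:: 386238;
    411058;468094]);(95226,[:: 48228;80483;159098]);(93049,[:: 309116]);(83123,[:: 222454;
    426166]);(74043,[:: 345214;430309]);(38178,[:: 241494;400240]);(35074,[::]);
    (21029,[:: 13461;329220;493144]);(15173,[:: 15473;255093;447469]);(13150,[::]);
    (11128,[::]);(9100,[:: 37238;414025]);(6124,[:: 90154;313445])]);
  (521, 70, 3, [:: (3,259378,[:: 138158;242000;520000]);(41,240141,[:: 51000]);
    (75,223121,[::]);(85,218486,[:: 393000]);(103,209340,[:: 177000;470044]);
    (149,186359,[::]);(165,178342,[:: 61000;401000;516000]);(173,174440,[:: 326000]);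
    (340,351277,[:: 163000]);(270,386485,[:: 479000]);(269,126319,[:: 33000;40000;282000;
    490000]);(297,112225,[::]);(395,63140,[:: 471000]);(401,60077,[:: 318043;484000]);
    (68,487418,[:: 209000]);(509,6517,[:: 4000;117000;173000;365045])],
    [:: (199217,[:: 10293;123419]);(177220,[:: 258398;449457]);(175105,[:: 215279]);
    (147084,[:: 230415]);(140159,[::]);(113229,[::]);(81085,[::]);(81023,[:: 142509]);
    (49157,[:: 71324;501301]);(28248,[:: 145181;180303;261066]);(22139,[:: 147306;
    174106]);(19088,[:: 155248;377393]);(14180,[:: 438186]);(11041,[:: 55232;162331;
    173019;183447;207002])]);
  (557, 67, 2, [:: (3,277193,[:: 556000]);(356,379025,[:: 81000;526000;556000]);
    (334,390054,[:: 13000;165000;487145]);(269,144040,[::]);(271,143172,[:: 124228;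
    125000]);(345,106169,[:: 493000;545000]);(80,517297,[:: 217000;497000;501140]);
    (545,6053,[::]);(8,553002,[:: 433000])], [:: (182125,[:: 436109]);(163182,[:: 135269;
    530384]);(108082,[:: 220122]);(98114,[::]);(92127,[::]);(82185,[:: 5504;331073;
    460261]);(74012,[:: 10128]);(61145,[:: 123097]);(61035,[:: 475325]);(55134,[::]);
    (53278,[:: 24207;455531]);(50242,[:: 484150;500115]);(44258,[:: 16532;439027]);
    (36089,[:: 128192;130414]);(27177,[:: 193214;385086]);(23080,[:: 287370]);
    (14254,[:: 355108;409098;410383]);(11096,[::]);(3113,[:: 395096])]);
  (563, 75, 2, [:: (3,280409,[:: 70089;102000;229098;420000]);(19,272344,[:: 94000;
    209000]);(99,232495,[:: 320000]);(448,339322,[:: 360000]);(155,204420,[:: 244000;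
    425000]);(161,201066,[:: 540000]);(396,365073,[::]);(360,383547,[:: 9000;384000;
    520202]);(357,103348,[:: 206000;223000]);(391,86226,[:: 19000;303219]);
    (42,70000,[:: 254000;299120]);(461,51447,[:: 319265;470000]);(259,32000,[:: 211000;
    291000;434078;519000;527000;544000]);(503,30427,[:: 411135]);(311,303000,[:: 26000;
    98000;201000;273000;463000]);(50,296000,[:: 33000;68000;253000;292000;318000]);
    (36,545551,[::]);(0,1000,[:: 25;124000;439000])], [:: (180207,[::]);(175028,[:: 146536;
    552297]);(174154,[::]);(124067,[:: 45445]);(67178,[:: 556335]);(65135,[:: 522139]);
    (48023,[:: 156126;262264]);(39027,[::]);(30045,[:: 398499]);(19105,[:: 161387]);
    (12124,[:: 280239;387279]);(11040,[:: 321222]);(9206,[:: 138094;447282]);(5244,[::]);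
    (3107,[:: 97382])]);
  (569, 78, 3, [:: (3,283526,[::]);(540,299398,[:: 87000;109014;351000]);
    (47,261558,[:: 214000]);(53,258556,[:: 91000]);(510,314128,[:: 451223;508000]);
    (97,236518,[:: 225000;359130;424091;483000]);(420,359123,[:: 90110;291000]);
    (201,184048,[::]);(271,149404,[::]);(311,129371,[:: 403000]);(377,96056,[:: 24000]);
    (76,531186,[:: 340000;408018;563000]);(74,532504,[:: 372000;455000;482000]);
    (38,550183,[:: 69083;81242;266000]);(30,554378,[:: 181000;185000;503000]);
    (557,6004,[:: 189000])], [:: (148065,[:: 407531]);(124162,[:: 138315;248323]);
    (112259,[:: 20465;438429]);(100029,[:: 129140]);(89260,[:: 24078;200503]);
    (68189,[:: 329545;358115;430407]);(67274,[:: 86150]);(58262,[:: 271011]);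
    (58215,[:: 339070;374047]);(54079,[::]);(49223,[:: 358477;383005]);(49012,[:: 217159]);
    (30109,[::]);(20132,[::]);(14046,[:: 482004]);(7266,[:: 162410;396449])]);
  (587, 89, 2, [:: (3,292468,[:: 50189;209244;440214;484000;522129]);(454,360545,[::]);
    (374,400054,[::]);(219,184561,[:: 249000;487079;581000]);(111,153000,[:: 206065;
    565000]);(311,138394,[:: 231000;407024;424000;570000]);(329,129500,[:: 176000;
    184000]);(107,406000,[:: 37000;58000;157000;196000;350000;375000;468000]);
    (138,518283,[:: 457162;549000]);(114,530577,[:: 91000;194252;296000;556267]);
    (90,542396,[:: 407000]);(36,569575,[:: 569000]);(168,410000,[:: 138000;333002;480000;
    555000]);(0,1000,[:: 132000;455000])], [:: (231292,[:: 102498;211139]);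
    (182139,[:: 47488;243362;417458]);(111287,[::]);(100233,[:: 50422;222241]);
    (97028,[:: 236000;490522;577065]);(80039,[:: 207404;466367]);(65268,[::]);
    (64020,[::]);(52183,[:: 133571;445217]);(51129,[::]);(46037,[:: 267202;408340]);
    (41196,[::]);(39103,[:: 400193;521553]);(37192,[:: 199000;411500;523072]);
    (35039,[:: 387328]);(28003,[::]);(20248,[:: 447312]);(13117,[:: 274411])]);
  (593, 94, 3, [:: (3,295258,[:: 592000]);(27,283359,[:: 96159;188000;412000]);
    (41,276392,[:: 93000;105095;258268]);(372,407189,[:: 1000;64176;575000]);
    (320,433190,[:: 70000;77030]);(290,448028,[:: 30000;445000]);(341,126035,[:: 449000]);
    (365,114229,[:: 92032;211000;259000]);(443,75412,[:: 64049;110000]);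
    (537,28086,[:: 98000;152000;260000]);(539,27446,[::]);(581,6589,[:: 197000;373093])],
    [:: (180010,[:: 108359]);(162244,[:: 79187;463239]);(161106,[:: 337001;476313]);
    (99140,[:: 111332;393169;481484]);(89169,[:: 496283]);(82275,[:: 171434;528522]);
    (68238,[:: 358112]);(67069,[:: 551559]);(65095,[:: 180427;320129;503249]);(63028,[::]);
    (60038,[:: 117286]);(51246,[:: 49456;126035]);(48178,[:: 398063;514333]);
    (44152,[:: 373267]);(32196,[:: 133505;411346;535592]);(16166,[::]);(14087,[:: 216085;
    261583;473490]);(10257,[:: 367;525207]);(7263,[:: 132521])]);
  (599, 108, 7, [:: (3,298483,[:: 110000;243297]);(47,276267,[:: 41013;190000;530000]);
    (480,359389,[:: 4000;460000]);(147,226166,[:: 293000;598000]);(153,223324,[:: 400000]);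
    (8,328000,[:: 238000]);(432,383589,[:: 34000]);(195,202492,[:: 121000]);
    (309,145231,[:: 49;74000;401212]);(204,251000,[:: 161000;404000;455000]);
    (268,465473,[:: 153000]);(234,482390,[::]);(397,101364,[:: 267216;547000]);
    (289,92000,[:: 349000;496000;546000]);(36,386000,[::]);(313,85000,[:: 12110;25197;
    59000;79000;245227;269000;311000;373000;382000;535000]);(202,80000,[:: 1000;111000;
    208000]);(255,530000,[:: 117000;140000;330000;528000;553000]);(33,152000,[:: 217000;
    278000;310000;395000]);(543,28489,[:: 58101;184000;351055]);(225,21000,[:: 9000;
    250000;254000;453226;470000]);(46,18000,[:: 334000]);(253,580000,[:: 25000;41000;
    70000;72000;570000;592000]);(24,98000,[:: 290000;372000]);(0,1000,[:: 22000;141000;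
    253000;346000;458000;577000])], [:: (156148,[:: 87048;169146]);(148285,[:: 323256;
    324285]);(78242,[:: 105189]);(73287,[::]);(58237,[:: 200424;366092]);(54103,[::]);
    (51131,[::]);(23284,[:: 44343;155453]);(21162,[:: 258523;552467]);(16276,[:: 550142]);
    (14150,[::]);(7174,[:: 156108]);(5190,[:: 13230;64469;322598])]);
  (617, 60, 3, [:: (3,307097,[:: 253000;489042]);(55,281195,[:: 168000;278000;311198]);
    (89,264155,[:: 286000;404000]);(213,202196,[:: 42116;99000;255000]);(379,119152,[::]);
    (605,6613,[:: 205000])], [:: (165254,[:: 101226]);(161216,[::]);(128120,[:: 301110]);
    (123089,[::]);(117009,[:: 208610]);(116305,[:: 43603]);(85108,[:: 114088]);
    (83284,[:: 269352]);(76149,[:: 141032;443056]);(74281,[:: 224332;409500]);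
    (70285,[:: 317;26084;206208]);(56261,[::]);(56216,[:: 46193;427328;488182]);
    (44040,[::]);(41163,[:: 72364;446234;521152]);(39027,[:: 392315]);(38180,[::]);
    (25022,[:: 6155]);(24230,[::]);(13070,[:: 423342]);(8214,[::]);(8050,[::]);
    (5010,[:: 408006;437127])]);
  (641, 84, 3, [:: (3,319564,[::]);(600,341082,[:: 425000]);(61,290277,[:: 6000;192000;
    467000]);(83,279317,[:: 28000;123114;472000;539014]);(558,362011,[:: 118000;176171;
    476172]);(522,380172,[:: 47000;467000]);(155,243164,[:: 16000;28000;293000;433000]);
    (167,237211,[:: 581000]);(476,403464,[:: 435000;609000]);(374,454439,[::]);
    (328,477327,[:: 86050;144000;458001]);(278,502112,[:: 329000;516000]);
    (238,522256,[::]);(629,6637,[:: 182000;213000;424260;468000])],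
    [:: (196268,[:: 491127]);(159132,[:: 183129]);(115090,[::]);(98277,[::]);
    (95268,[:: 185008;617244]);(85250,[:: 116590;246618]);(85026,[::]);(78159,[::]);
    (67095,[:: 216571;344259]);(61073,[::]);(53267,[:: 84225]);(33214,[:: 79005;85383;
    290367]);(32154,[:: 91365;155519;577074]);(29059,[:: 464401]);(28061,[:: 67013;193441;
    371097;524020]);(27246,[:: 108337]);(26261,[::]);(26085,[:: 412264]);(17244,[::]);
    (4171,[:: 414460;491091])]);
  (647, 106, 5, [:: (3,322369,[:: 646000]);(109,269063,[:: 249000]);(165,241633,[:: 12000]);
    (484,405442,[:: 477000;560233;639000]);(175,236485,[:: 134102]);(201,223271,[::]);
    (287,180620,[::]);(301,173578,[:: 259043;378000;405000;534196]);
    (345,151594,[:: 622000]);(377,135543,[:: 11000;15000;37225;434182;577000;599000]);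
    (333,189000,[:: 14;227229;268000;513000]);(381,72000,[:: 6000]);(8,68000,[:: 348000;
    460000]);(515,66511,[:: 283000;592000]);(291,296000,[:: 19000;180000;198018;200000;
    202000;499000;532000]);(95,442000,[:: 5000;248000;416000;434000]);
    (80,335000,[:: 312000]);(37,41000,[:: 39000;246000;324000;468000;500199]);
    (200,479000,[:: 152212;161000;181027;360000;477000]);(36,414000,[:: 228000;353000]);
    (68,592000,[:: 86000;138000;288160;330000;338000;433000;448000;606000]);
    (116,538000,[:: 457000]);(0,1000,[::])], [:: (210201,[:: 161244;310599]);
    (205312,[:: 419120]);(181212,[:: 159046;596170]);(141281,[::]);(123124,[:: 552515]);
    (95111,[:: 21123;318138;395270]);(91279,[:: 136152;487198;519083]);(75264,[::]);
    (72029,[:: 485636]);(47171,[::]);(39130,[::]);(35218,[:: 301245]);(21044,[::]);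
    (14244,[:: 402319]);(3004,[::]);(2306,[:: 482633;528509])]);
  (653, 54, 2, [:: (3,325067,[:: 120000;265271]);(528,389092,[:: 109270;127000;242000]);
    (494,406319,[:: 228000]);(68,619480,[:: 173000;515112]);(641,6455,[:: 100000;144022;
    287000]);(14,646225,[:: 414251;473000]);(8,649002,[::])], [:: (177283,[:: 596015]);
    (161310,[::]);(158319,[::]);(156208,[::]);(142134,[::]);(134178,[:: 334167]);
    (113299,[:: 181611]);(109157,[::]);(108261,[:: 159258;644530]);(101117,[::]);
    (92041,[::]);(84095,[:: 365116]);(83181,[:: 36593;78522;388359]);(79114,[:: 67084]);
    (69053,[::]);(60292,[:: 569610]);(58101,[:: 377146]);(52299,[:: 33598;141315]);
    (52107,[:: 344157]);(12309,[:: 626266]);(12181,[:: 435097]);(12163,[:: 302325]);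
    (8062,[::]);(5190,[:: 466544])]);
  (659, 89, 2, [:: (3,328566,[:: 42090;572000]);(606,356200,[:: 526000;546000;564000]);
    (554,382335,[:: 190220;197000;498003]);(546,386471,[:: 35329;115000;365285;375000;
    610000]);(149,255573,[:: 191000;642000]);(454,432129,[:: 123134;228223;365205]);
    (253,203007,[:: 481031;612024]);(316,501464,[:: 617000]);(361,149300,[:: 108208]);
    (391,134310,[::]);(335,518000,[:: 61000;445000;596000]);(459,100289,[:: 304000]);
    (145,259000,[:: 138000;251000;488000;602000]);(509,75501,[:: 14074;316268]);
    (142,588121,[:: 247000;393310;519175]);(155,134000,[:: 360000;490000]);
    (94,612601,[:: 542311]);(581,39181,[:: 135000;294195]);(388,618000,[:: 468000;580146]);
    (339,36000,[:: 5000;260000;299000;563000]);(36,641647,[:: 49000;513000]);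
    (0,1000,[:: 156;215204;235070;424070;444204])], [:: (276210,[:: 476259]);
    (223304,[:: 41540]);(119071,[:: 321008]);(110001,[::]);(75001,[::]);(67226,[:: 56493]);
    (62325,[:: 103123;447302]);(62269,[::]);(56097,[::]);(45266,[:: 8218;284303]);
    (41304,[::]);(29164,[::]);(22289,[::]);(17066,[::]);(15073,[:: 41119]);
    (10199,[:: 161329]);(6071,[::])]);
  (677, 59, 2, [:: (3,337519,[:: 365000;493283]);(610,372337,[::]);(588,383048,[:: 6000]);
    (125,276287,[:: 56000;604000]);(554,400341,[:: 121000;331000;569000]);
    (470,442377,[:: 468150]);(379,149247,[:: 409268]);(425,126570,[:: 191000;567000;
    570000]);(435,121457,[:: 468000;479000;655000]);(471,103155,[:: 49000;385102]);
    (477,100019,[:: 174000]);(559,59028,[:: 18000]);(92,631478,[:: 238000;604332]);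
    (665,6309,[:: 89115]);(8,673002,[::])], [:: (234242,[:: 390221]);(202116,[:: 32045]);
    (169281,[:: 292216;350654;378330]);(142195,[::]);(138314,[::]);(138225,[:: 636595]);
    (137241,[::]);(137114,[:: 318204]);(129211,[:: 392097]);(75259,[::]);
    (66194,[:: 167424]);(60155,[::]);(59053,[::]);(58296,[:: 184321]);(47220,[::]);
    (42159,[::]);(35284,[:: 323459;619056]);(35051,[:: 159621;614176]);(31315,[::]);
    (27300,[:: 302188;579657]);(27199,[::])]);
  (683, 102, 5, [:: (3,340435,[:: 301000;531234;682000]);(227,228333,[:: 234000;550000]);
    (306,530483,[:: 274333;334000;411052]);(391,146231,[:: 273000]);(298,534095,[:: 94;
    26000;30000;191000;359000;575000]);(320,526000,[:: 293000;355000;378000;390000;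
    400000;463000;563000;605000]);(212,577062,[:: 59105;86000;236000]);
    (207,394000,[:: 255000;402000;498000;664000]);(36,665438,[::]);(0,1000,[:: 192;272000;
    411000])], [:: (243123,[:: 52194;631513]);(187279,[:: 547657]);(149018,[:: 628219]);
    (135172,[:: 56621;159197;427405;528450]);(126140,[:: 525047]);(125119,[:: 302319;
    342005;419591;535355]);(112332,[:: 176000;574129]);(112275,[::]);(106142,[:: 19178;
    130418;611419]);(104188,[:: 244063]);(101324,[:: 99308]);(100070,[::]);
    (95298,[:: 511472]);(91280,[::]);(87221,[::]);(80184,[:: 373014;498448;585129]);
    (79316,[:: 112013]);(79117,[:: 113284;272422]);(78133,[::]);(64320,[:: 249555;281007]);
    (40064,[:: 113511]);(34157,[::]);(9301,[:: 132658]);(6237,[:: 92369;197202;400543])]);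
  (701, 68, 2, [:: (3,349095,[:: 2000;19295;348285;660000;700000]);(21,340362,[:: 20000;
    515000]);(105,298271,[:: 491000]);(143,279513,[:: 70000;231000]);(490,456026,[::]);
    (227,237538,[:: 199000;377000;395000;439162;687000]);(458,472224,[::]);
    (353,174637,[:: 21000;420184;448000]);(344,529569,[:: 60000;158000;169000;369218]);
    (336,533025,[:: 245000]);(401,150533,[:: 436000]);(541,80078,[:: 451000]);
    (136,633582,[:: 670000]);(611,45127,[:: 24000;120000;345000;409015]);
    (675,13108,[:: 297000;320340;670000]);(689,6254,[:: 515053;561046]);
    (8,697002,[:: 265000])], [:: (250249,[:: 493266]);(245086,[::]);(213317,[::]);
    (169156,[:: 67302;634665]);(164159,[:: 264033]);(128280,[:: 259011;359234]);
    (120070,[::]);(119207,[::]);(117015,[:: 259618;373084]);(91236,[:: 583193]);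
    (89182,[::]);(84044,[::]);(59283,[::]);(59023,[::]);(54031,[:: 684303]);(52152,[::]);
    (34219,[::]);(31272,[:: 229114;351346]);(21092,[::]);(6265,[:: 192669]);
    (2004,[:: 469686])]);
  (719, 112, 11, [:: (3,358048,[:: 426009;458205;519000;583000;718000]);
    (15,352616,[:: 153000]);(678,380279,[::]);(103,308047,[:: 35339;572000]);
    (620,409672,[:: 169000;595064]);(209,255137,[:: 266000]);(217,251093,[::]);
    (49,424000,[:: 12176;333000;426000;434000;539000]);(331,194173,[:: 568000]);
    (293,169000,[:: 273000;331000;396000;478000]);(334,552245,[:: 61000]);
    (235,161000,[:: 49000;463000;561091]);(411,154226,[:: 6036;358000;555000;597000]);
    (117,145000,[:: 173000;176000;476000]);(433,143650,[:: 33091;361000]);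
    (435,142423,[::]);(260,141000,[:: 19000;46000;155000;288000;312000]);
    (473,123317,[::]);(250,594402,[::]);(36,275000,[:: 92000;280000]);
    (405,549000,[:: 472000;508000;658000;694054]);(156,641715,[:: 123100;286000]);
    (8,67000,[:: 154000;180000;194000;330000;367000;564083;574000;699000]);
    (133,524000,[:: 24000;142000;201000;567082;590000;667000]);(455,317000,[:: 411000;
    500000;546000]);(188,26000,[:: 268000;522000;545000]);(300,634000,[:: 21000;78000;
    529000]);(92,603000,[:: 215000;387000;482000;547000;625000;642000]);
    (149,687000,[::]);(74,658000,[:: 155000]);(0,1000,[:: 94000;339000;380000;625000])],
    [:: (216064,[:: 296656]);(151137,[::]);(142214,[:: 49411]);(135215,[:: 120000;268525;
    367427]);(129212,[::]);(114242,[:: 271369;615183;675273]);(114007,[:: 660154]);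
    (91185,[:: 517571]);(51241,[::]);(51095,[:: 259217]);(38172,[::]);(35174,[:: 137552]);
    (14173,[:: 558480]);(13021,[::]);(4192,[::])]);
  (743, 124, 5, [:: (3,370661,[:: 170190;208079;400000;481000;501145;568283;707362]);
    (714,386537,[:: 523276;633137;739000]);(202,230000,[:: 330000;539000]);
    (289,227251,[:: 71348;372000;424000]);(450,518153,[:: 229000]);(8,535000,[:: 62000;
    445000;637000;730000]);(357,193300,[::]);(346,219000,[:: 274000;316000;567000]);
    (338,574129,[:: 141000]);(36,244000,[:: 121339;477000;687000]);(290,598561,[:: 58000;
    117100;737000]);(276,605406,[::]);(254,616281,[:: 281066]);(54,572000,[:: 24000;129000;
    210000;231196;412000;505000;586000;688000;710000]);(465,171000,[:: 6000;685000;
    724000]);(84,564000,[:: 214000;250000;285000;465018]);(429,394000,[:: 141000;621000]);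
    (142,651000,[:: 44210;85000;113074;190000;219000]);(653,45188,[:: 433129]);
    (381,410000,[:: 261000;560000]);(0,1000,[:: 237000;506000])], [:: (310245,[:: 16287]);
    (248089,[::]);(230173,[::]);(177358,[::]);(146185,[::]);(142348,[:: 42525]);
    (124066,[:: 132055;209238;274499;555481;668460]);(109136,[:: 485613]);
    (109059,[:: 189196;351487;352321]);(103361,[:: 39514]);(77029,[:: 399676]);
    (72119,[:: 704496]);(59195,[:: 257485;396711]);(53115,[::]);(46249,[::]);
    (32300,[:: 218000;233442;287229;577414]);(15288,[:: 403090;441214]);
    (14299,[:: 679085]);(9363,[:: 119485;384379]);(6058,[:: 80547;331712]);
    (3202,[:: 102269;313437])]);
  (761, 129, 6, [:: (3,379141,[:: 26004;46317;55000;78209;602000;666000;706000;732286]);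
    (83,339409,[:: 303000;375000;430000]);(664,429078,[:: 60000]);(147,307291,[:: 211135;
    706000]);(600,461021,[:: 94000;507036;517240;561204]);(175,293206,[:: 41000;652000;
    655000;746000]);(193,284092,[:: 272000;340000]);(532,495744,[:: 104220;538000]);
    (432,545338,[:: 482237]);(408,557138,[:: 360000]);(373,194045,[:: 46000;304000;478000;
    575000;596276;706353]);(374,574681,[:: 401000]);(509,126636,[:: 409000;668000]);
    (533,114629,[:: 14000]);(539,111439,[:: 254000]);(555,103390,[::]);
    (102,710006,[:: 339000;632208]);(691,35535,[:: 221059]);(62,730028,[:: 308000;514273;
    732018]);(749,6146,[:: 248000;253000;703362])], [:: (296241,[:: 251234;623448]);
    (254247,[:: 234688;418054]);(237323,[:: 424686]);(208086,[:: 351177;480724]);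
    (189326,[::]);(177199,[:: 500537;587222;611164;663249]);(168065,[:: 1150;75448;
    146666;527499;667225]);(164007,[:: 300207;710130]);(162247,[:: 410341]);
    (155190,[:: 1212]);(136031,[:: 146098]);(105174,[:: 31486;441759;545760]);
    (103009,[::]);(88318,[::]);(56142,[::]);(51270,[:: 33454;101402;353615]);
    (48233,[:: 109255;623052]);(46344,[:: 170760;366038]);(43124,[:: 27072;757181]);
    (18188,[::]);(17085,[::]);(7264,[:: 354459;381387;675722])]);
  (773, 106, 2, [:: (3,385026,[:: 111000;716180;772000]);(101,336671,[::]);
    (632,457438,[:: 375000]);(562,492584,[:: 185000;468000;737000]);(502,522307,[:: 95000;
    215000;705000]);(319,227311,[:: 74142;225000]);(368,589227,[:: 516000;724000]);
    (521,126566,[:: 122000;318000]);(220,663023,[:: 31011;72041]);(122,712171,[:: 57000;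
    191000;241000;393000;545000;705000]);(72,737686,[:: 19000;262000;324000;636000]);
    (761,6542,[:: 421000;727177]);(8,769771,[::])], [:: (220074,[::]);(217213,[::]);
    (190097,[:: 317708;409261]);(171130,[::]);(155331,[::]);(133122,[:: 219664;716378]);
    (94293,[:: 550114]);(94173,[:: 155083;430316;453566]);(77011,[:: 458002;703371;
    770601]);(74178,[::]);(73321,[:: 80339;589369]);(73099,[:: 610152;671202;750274]);
    (72262,[:: 177490;224183;483674]);(71027,[::]);(66285,[:: 117187;517618;584308]);
    (66273,[:: 147363;157247;254500]);(62277,[:: 661525]);(49380,[:: 157656]);
    (49307,[:: 387452;504151;702166]);(42101,[::]);(40190,[::]);(36313,[:: 626304]);
    (34294,[:: 195260;283599;686350]);(33100,[:: 219136;346704]);(21058,[:: 352224]);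
    (7048,[::])]);
  (797, 90, 2, [:: (3,397241,[:: 26000;384131;433374;725000]);(584,505355,[:: 43000;106000;
    251000]);(253,272342,[:: 30135;742000]);(498,548317,[:: 180033;435257]);
    (488,553457,[:: 231000]);(419,189271,[:: 353298;749000]);(459,169286,[:: 123000;330000;
    777368]);(545,126529,[:: 349000;454000;466000]);(593,102751,[:: 686000;769000]);
    (617,90133,[:: 15340;131000;540326;613000;725000]);(649,74472,[::]);
    (717,40102,[:: 502160]);(48,773363,[:: 31000]);(785,6717,[::]);(8,793002,[:: 690000])],
    [:: (277043,[:: 468317;747616]);(246230,[::]);(219333,[:: 262685]);(211154,[::]);
    (199336,[:: 626670]);(194291,[:: 245263]);(183192,[:: 123490]);(164136,[:: 26777]);
    (144029,[:: 100693]);(115222,[:: 353759]);(100022,[::]);(80365,[:: 482236]);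
    (69326,[:: 350559]);(60091,[:: 32028;220203;468599]);(53116,[:: 18059;52578;570008]);
    (47013,[::]);(43096,[:: 482334;624328]);(39177,[::]);(30013,[:: 78167]);
    (24047,[:: 747403]);(22348,[::]);(15292,[:: 333262]);(13349,[::]);(13050,[:: 36779;
    426109]);(12066,[:: 362297]);(10204,[:: 103721;276023])]);
  (809, 94, 3, [:: (3,403159,[:: 234000;286151;808000]);(806,406128,[:: 305232;444000]);
    (85,362231,[:: 119000;537000]);(137,336568,[::]);(464,577165,[:: 115329;369000;
    549000]);(456,581738,[:: 285000]);(363,223291,[:: 63144]);(420,599526,[:: 57376;255258;
    361000]);(378,620484,[:: 68000;455000;522000]);(362,628057,[:: 47000;200000;434346;
    454394;629000;732000;790157]);(533,138323,[:: 370077;804000]);(611,99267,[:: 124000]);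
    (164,727705,[:: 697301]);(68,775099,[::]);(30,794213,[::]);(797,6004,[:: 269000])],
    [:: (262373,[:: 312806;694713]);(238089,[:: 628251;644636]);(207157,[::]);
    (195367,[:: 221051;336690]);(173137,[:: 615064]);(168060,[:: 658055]);
    (167115,[:: 502456]);(141400,[:: 263133]);(136016,[:: 213112]);(129094,[:: 725092]);
    (122303,[::]);(109309,[::]);(102165,[:: 258241]);(98052,[:: 216328;629159]);
    (74331,[:: 74255]);(71155,[:: 787485]);(65236,[:: 118134;804113]);(62268,[::]);
    (47165,[:: 83051;344175]);(44354,[::]);(37381,[::]);(37165,[:: 491616;531372]);
    (28205,[::]);(7327,[::]);(6313,[:: 384577]);(5243,[:: 49678;221337;506379;564052])]);
  (821, 107, 2, [:: (3,409229,[:: 68404;168000;325114;682000]);(129,346337,[::]);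
    (167,327004,[:: 133346;584000;731000]);(538,552284,[:: 703000]);(305,258039,[:: 33000]);
    (345,238405,[:: 66000;70000;576000]);(442,600476,[:: 178136;609000;624000]);
    (360,641153,[::]);(523,149566,[:: 766000;809000]);(577,122391,[:: 286173;575107;
    797000]);(659,81084,[:: 506000]);(124,759235,[:: 128083]);(719,51065,[:: 162000;264000;
    693000]);(809,6222,[:: 108319;305000]);(8,817819,[::])], [:: (234283,[:: 21536]);
    (208028,[::]);(190382,[:: 43024;250680;496124]);(184002,[::]);(158108,[:: 279679;
    396618]);(135189,[:: 167327;190713]);(134149,[:: 135716]);(128302,[::]);
    (100397,[:: 95047;340654;366778]);(100072,[:: 335127]);(95121,[::]);
    (86147,[:: 467677]);(64128,[:: 158515;611258]);(64102,[:: 225634]);(59210,[:: 160527;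
    360697]);(51288,[::]);(50048,[:: 533500]);(31384,[:: 191211;324763;411577;450095]);
    (31198,[:: 464513;589024]);(31175,[:: 491230]);(31123,[:: 70475;291317]);
    (30320,[:: 406439;818742]);(30067,[::]);(16183,[:: 548285]);(15135,[:: 384221]);
    (13233,[:: 170335;241147;744186]);(4242,[:: 180421;506734])]);
  (827, 120, 2, [:: (3,412548,[:: 121000;765131;826000]);(119,354189,[:: 236000;363000;
    706000]);(582,536212,[:: 397000]);(522,566248,[:: 17280;78401]);(341,243183,[:: 79000;
    820138]);(472,591472,[:: 207000;306000]);(170,388000,[:: 340000;406274;729000]);
    (519,154607,[::]);(166,597000,[:: 115000;189000;231408]);(126,764475,[:: 139000]);
    (729,49824,[:: 608000]);(202,382000,[:: 200000;480000;739000]);(36,809012,[:: 158108;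
    169000]);(0,1000,[:: 173;206;5124;139000;323000;504000;688000;822124])],
    [:: (250248,[:: 227710;634204]);(211040,[::]);(208204,[:: 114025;318206;549559;
    783205]);(169220,[:: 42200;491062;626459]);(157321,[:: 6673;177193]);
    (150096,[:: 265075;483242]);(133191,[::]);(133135,[:: 436478]);(131105,[:: 82125;
    685246]);(109276,[::]);(109081,[:: 291000;709393;715504]);(103059,[:: 686754]);
    (97274,[:: 740590]);(72377,[:: 114373;368448;545802;582426]);(54225,[:: 619299]);
    (40126,[:: 661444]);(38302,[:: 191271]);(33003,[:: 557000]);(31170,[:: 9369;348551;
    593126]);(26157,[::]);(24328,[:: 517147;709683]);(22334,[:: 701272]);(21140,[:: 70192;
    167444]);(20015,[::]);(15196,[:: 8753;93239;798546]);(12381,[::]);(7267,[:: 246333]);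
    (5093,[:: 246251])]);
  (839, 119, 11, [:: (3,418545,[:: 196000;320027]);(828,425681,[:: 315354]);
    (784,447383,[::]);(774,452828,[:: 73094;260000]);(36,473000,[:: 256183;337000;370239;
    606142]);(636,521509,[:: 434352;783000]);(622,528644,[::]);(241,299488,[:: 586000;
    670000]);(500,589234,[:: 9000;107000]);(371,234318,[:: 80000;306000]);
    (170,412000,[:: 135000]);(414,632493,[::]);(368,655490,[:: 48395;437132;566000]);
    (374,638000,[:: 299000]);(577,131078,[:: 403319]);(236,721700,[:: 345000;633000;
    738000]);(473,110000,[:: 599000;662000]);(633,103559,[:: 229000;410000;515278;
    529000]);(641,99706,[::]);(528,664000,[:: 146081;185000;428000;435000]);
    (12,694000,[:: 94000;145000;588000]);(354,762000,[:: 240000;375000;489000;552000;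
    685000]);(381,748000,[:: 66000;248000;397000]);(358,545000,[:: 265000;667417]);
    (280,509000,[:: 18000;43000;555000]);(244,552000,[:: 33000;158000;347000;511000;
    633000;679000]);(33,770000,[:: 264000]);(773,33217,[:: 259000;334173;604000;758000]);
    (174,234000,[:: 432000;742000]);(60,810000,[:: 453000]);(6,795000,[:: 14000;65000;
    113000;402000;419000;544000]);(8,54000,[:: 57000;277000;299000;813000]);
    (0,1000,[:: 11000;828000])], [:: (186068,[:: 263000;712814]);(179359,[::]);
    (177281,[::]);(169405,[::]);(157075,[:: 60430;553350]);(148043,[:: 233367]);
    (140224,[::]);(105392,[:: 786435]);(104227,[::]);(91188,[:: 615000]);(81234,[::]);
    (73339,[:: 78516;250006;755106]);(63257,[::]);(57175,[:: 287802]);(53007,[::]);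
    (37115,[:: 296013;399603]);(36353,[::]);(10096,[:: 250439;533762]);(6172,[::])]);
  (857, 121, 3, [:: (3,427532,[::]);(818,448309,[:: 18000;21000;288193;386000;768000]);
    (75,391692,[:: 9000]);(87,385723,[:: 588000;622000]);(766,474426,[:: 127000;248000]);
    (726,494209,[:: 695000;721000]);(137,360809,[:: 223000;309000;782000]);
    (183,337269,[:: 642000]);(626,544142,[:: 554000;856157]);(486,614572,[:: 166372]);
    (605,126475,[:: 204000;362000]);(252,731183,[:: 24027]);(633,112376,[:: 53000;420384]);
    (76,819580,[:: 292000;308000]);(34,840779,[:: 721098]);(845,6853,[:: 285000;372233;
    429000])], [:: (285295,[:: 491163]);(254145,[:: 566752;600505;680210]);
    (242369,[:: 217708]);(241097,[:: 411577]);(218204,[:: 190332;313576]);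
    (175382,[:: 229454]);(174053,[:: 570538]);(134154,[::]);(133211,[:: 341411;558465;
    615327]);(129056,[:: 390407]);(128204,[::]);(120072,[:: 429736;750700]);
    (119026,[:: 131826;135073;321709]);(116092,[:: 138444;853031]);(116039,[:: 340324;
    696385]);(106158,[:: 248026]);(104230,[:: 675582;697233]);(103150,[:: 27626]);
    (102171,[::]);(92250,[::]);(92213,[:: 118267;329578;652709]);(72083,[:: 355820]);
    (63379,[:: 62295]);(50372,[:: 604044]);(42424,[:: 232190]);(42378,[:: 353471]);
    (42015,[:: 20269;471850;691300]);(10189,[:: 115401;499519;561126;780431])]);
  (863, 138, 5, [:: (3,430078,[:: 160089;540000;862000]);(830,448517,[:: 116105;242346;
    481000;638000;790303]);(161,351667,[:: 181000;244000]);(706,510667,[:: 204085;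
    820430]);(690,518329,[::]);(74,520000,[:: 344000;361000;498000;551000;728000;
    814000]);(36,422000,[:: 52000;355337;774000]);(144,223000,[:: 53000;125000;375000]);
    (420,653246,[:: 74000;536000;828138]);(495,184260,[::]);(362,682028,[:: 303147;
    651000]);(8,498000,[:: 59000;84000]);(258,172000,[:: 289000]);(214,760000,[:: 209000;
    460247;515000]);(444,342000,[:: 9000;241000]);(150,788276,[:: 742000]);
    (496,539000,[:: 6000;104000;282000;291000;561000;668000]);(38,479000,[:: 23000;52000;
    285000;322000;456000;481172;613000;614000;775000;781000]);(82,822087,[:: 174000]);
    (106,155000,[:: 103000;285000;462000;562000;653000]);(0,1000,[:: 115000;145000;
    718000;748000])], [:: (352193,[:: 309125;383418]);(305224,[:: 69686]);
    (300297,[:: 415640]);(299196,[::]);(293031,[:: 23783;377720;598524;716772]);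
    (269110,[:: 81819;712751;820790]);(264250,[:: 797018]);(218272,[:: 55495;180113]);
    (166228,[:: 824000]);(116028,[:: 8801;276263;395631;791658]);(113398,[:: 706394]);
    (96040,[:: 559161;601610]);(92036,[:: 307180]);(78017,[:: 102823]);(76431,[:: 177556]);
    (62156,[:: 537016]);(60299,[::]);(53200,[:: 98616;640229]);(50310,[::]);
    (46287,[:: 1755;247526]);(40294,[:: 128092;507000;621344]);(39262,[::]);(31090,[::]);
    (24222,[::]);(12247,[::]);(93,[:: 327000])]);
  (881, 112, 3, [:: (3,439634,[:: 52248;244333;390000;774000;880000]);
    (59,411820,[:: 525000]);(818,472817,[:: 11337]);(724,519754,[:: 105000;542149;565000]);
    (165,358342,[:: 75000;398000]);(201,340107,[:: 117000;347000]);(516,623601,[:: 324000;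
    613342;846000]);(417,232343,[:: 199000;485294;712013]);(455,213504,[:: 42000;284188]);
    (467,207702,[::]);(376,693254,[::]);(513,184408,[:: 33198;304325;312339]);
    (326,718608,[:: 614000;800000]);(611,135396,[:: 71000;436177]);(629,126536,[:: 245000]);
    (699,91568,[:: 152302;469000]);(184,789636,[:: 731000;848000]);(132,815699,[:: 63000]);
    (775,53374,[:: 139000;577000]);(869,6004,[:: 178334;293000;390118])], [:: (276253,[::]);
    (276010,[:: 259444]);(258027,[::]);(250194,[:: 248558]);(244417,[:: 533316]);
    (233219,[:: 147777]);(215159,[:: 607519]);(184208,[:: 699840;813638]);
    (177070,[:: 829341]);(164352,[:: 462411]);(145184,[:: 386559;783438;868751]);
    (114167,[:: 256355;513683]);(104426,[:: 119088]);(104105,[:: 409215]);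
    (90311,[:: 632466]);(90090,[:: 61209;571528]);(84383,[:: 48503;847792]);(82279,[::]);
    (71041,[:: 158692]);(66359,[:: 99305;664793]);(60138,[::]);(55291,[:: 172540;535084;
    647368]);(25133,[:: 470744]);(21217,[:: 451367]);(13144,[:: 139858;506445]);
    (7396,[::]);(3080,[::])]);
  (887, 156, 5, [:: (3,442574,[:: 49255;353000;401000;685128;709073;786000]);
    (49,419454,[:: 283248;786047]);(163,362821,[:: 473000;501000;506000]);
    (8,400000,[:: 624000;651199;833044]);(616,579020,[::]);(303,292460,[::]);
    (343,272002,[::]);(528,623507,[:: 273000;623262]);(381,253135,[:: 614000;679000]);
    (11,249000,[:: 88000;680000;764294;787000]);(36,219000,[:: 242000;363000;401119]);
    (321,194000,[:: 185000;842000]);(392,691813,[:: 355000;384000]);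
    (581,153756,[:: 833000]);(625,131191,[::]);(478,726000,[:: 833000]);(133,532000,[:: 7000;
    423000;470000;473000;702000;738000]);(508,621000,[:: 242000;561000;597000;686000]);
    (350,622000,[:: 295000;387000;826000]);(747,70011,[:: 79306;656000]);
    (167,536000,[:: 11312;276000;296000;346000;532000;874000]);(201,398000,[:: 86000;
    611000]);(797,45497,[:: 594000]);(200,839000,[:: 327000;420000;645000;758000]);
    (807,40682,[:: 6142;836000]);(25,670000,[:: 137000;465000;502000;742000]);
    (486,30000,[:: 154000;333000;574000;817000]);(98,815000,[:: 97000;127000;305000;
    329000;388000;515000;692000;872000]);(0,1000,[::])], [:: (323280,[:: 32542;272880;
    640144]);(314151,[:: 590353]);(263163,[:: 583470]);(260397,[:: 502426]);
    (248145,[:: 55091]);(176411,[:: 51724]);(165255,[:: 84250;151218;315003;740663]);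
    (158097,[:: 52784;61090]);(154403,[::]);(124394,[:: 141776;526153]);(124326,[:: 209182;
    286455;431746]);(124171,[:: 727588]);(107213,[::]);(86243,[:: 22790]);
    (85129,[:: 883373]);(84217,[::]);(71295,[:: 381282;847682]);(40303,[:: 267717]);
    (37164,[:: 303318]);(32009,[:: 458643]);(25178,[:: 713115]);(24053,[:: 269881;490884;
    676363]);(2338,[:: 45583;300183;375834;500013;586442])]);
  (911, 182, 17, [:: (3,454178,[:: 292000;308227;480434;592201;747233]);(103,404325,[::]);
    (147,382001,[:: 46120;841431]);(768,527910,[:: 155000;465000;626000]);
    (746,538668,[:: 770000]);(205,353304,[:: 711352]);(8,348000,[:: 54000;253000;464000;
    538000;668306;713000]);(36,603000,[:: 129000;336000;619000;681000]);
    (45,473000,[:: 45000;81000;311000;483000;739000;830000;859000;902000]);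
    (100,209000,[:: 8000;193000;280000;568376;720000]);(541,185174,[:: 76000;331000;
    767096]);(30,680000,[:: 76000;275000;596454;765000;766000]);(63,638000,[:: 377000;
    414000;621022]);(310,756022,[:: 137000;201000;297287;308298;831302]);
    (105,688000,[:: 40000;327000;383000;694175]);(687,112086,[:: 174000;708000]);
    (701,105675,[:: 625000;673000]);(709,101255,[:: 124425]);(206,808255,[:: 108352]);
    (471,536000,[:: 22000;436000;494000]);(180,821882,[:: 287000;325000;872000]);
    (292,78000,[:: 6000;181000]);(308,846000,[:: 13000;165000;247000;475000;633000;
    760000]);(837,37264,[:: 731000]);(843,34766,[:: 336000;627192]);(49,482000,[:: 130000;
    374000;494000;543000;550000]);(52,527000,[:: 496000;545000;673000]);
    (355,885000,[:: 643000;645000;793000]);(160,904000,[:: 745000]);(156,302000,[:: 224000;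
    228000;372386;502000;692000]);(0,1000,[:: 452000;459000])], [:: (271286,[:: 722651]);
    (196090,[:: 69047;248420;584031]);(195328,[:: 428500]);(161436,[:: 157838;910144]);
    (158293,[:: 65568]);(147034,[:: 73086;305573]);(147007,[::]);(136296,[:: 395479]);
    (124011,[:: 22146;399840]);(120154,[:: 386119]);(104228,[:: 81834;609217;793100;
    817875]);(93309,[:: 54430;646077]);(84065,[:: 512676;791865]);(83080,[:: 4314;17535]);
    (53327,[::]);(36353,[::]);(35188,[:: 51362;358762;755372]);(25291,[::]);(24022,[::]);
    (8438,[:: 217721;480137]);(8311,[:: 107678;217877;817745]);(8230,[::]);(120,[:: 29480;
    63363;75681;746420])]);
  (929, 89, 3, [:: (3,463767,[:: 93201;740000]);(914,472913,[:: 851000]);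
    (27,451764,[:: 69000;701000]);(267,331851,[:: 339292;512000;754000]);
    (409,260759,[:: 605000]);(427,251307,[::]);(449,240363,[::]);(473,228251,[:: 198179;
    451200]);(444,707336,[:: 427000;621000]);(541,194836,[:: 95000;803092]);
    (316,771901,[:: 277000;417000;422000;732000]);(629,150553,[:: 77000;98000;344069;
    511073;566000]);(677,126421,[:: 375000;853000;912000]);(216,821010,[:: 210000]);
    (214,822499,[::]);(62,898114,[:: 54429;144000]);(26,916079,[::]);(917,6925,[:: 309000;
    491106])], [:: (353143,[:: 25153;145867]);(298450,[:: 112637;465323]);(257096,[::]);
    (246415,[::]);(204362,[:: 294219;534670]);(191372,[::]);(181329,[:: 65871;295835]);
    (169093,[:: 538636;813574]);(153376,[:: 454742;482515]);(153153,[::]);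
    (144265,[:: 286072]);(136257,[::]);(135163,[:: 263691;432329]);(132426,[::]);
    (127205,[::]);(108166,[::]);(104230,[:: 645341]);(96457,[:: 373375]);
    (86409,[:: 415195]);(73008,[:: 34073]);(72208,[::]);(57082,[::]);(17057,[::]);
    (15151,[::]);(15041,[:: 217050;721405]);(14399,[::]);(14014,[:: 85636]);
    (13065,[:: 692332]);(9297,[:: 352674]);(2449,[:: 836595])]);
  (941, 126, 2, [:: (3,469899,[:: 222000;239000;358044;820271]);(13,464482,[::]);
    (237,352637,[:: 816000]);(259,341396,[:: 861000]);(654,614394,[::]);
    (315,313249,[:: 259000]);(407,267073,[:: 166000;614470]);(506,688197,[:: 486351;
    640000]);(517,212010,[:: 57448;89000]);(424,729136,[:: 222000;330000;347236;405263]);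
    (418,732345,[:: 210000;380000;625000]);(545,198217,[:: 388248;593058;624221]);
    (298,792076,[:: 212144;572000]);(689,126828,[:: 360000;450000]);(232,825936,[:: 172280;
    895000]);(206,838329,[:: 273000;798000;849000]);(813,64508,[:: 675000]);
    (124,879208,[:: 595000;607000;905000]);(835,53822,[:: 191000]);(889,26412,[:: 435000]);
    (929,6343,[::]);(939,1321,[:: 41000;183293;715000]);(8,937939,[::])],
    [:: (354001,[:: 194310;457867]);(294243,[:: 559358;663705]);(163401,[:: 168529;237517;
    264102]);(161266,[:: 30422]);(141403,[::]);(122278,[::]);(119145,[:: 152300;584066;
    787163]);(107024,[::]);(103189,[::]);(99017,[:: 885915]);(88184,[:: 25919;543857;
    711332]);(77109,[::]);(76035,[:: 329020;402643;748310]);(69350,[:: 471778;897827]);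
    (68094,[:: 389541;509776]);(63070,[:: 165809;560680;628537;722409;816177]);
    (62414,[:: 92774]);(62179,[:: 211581]);(50214,[:: 936817]);(37014,[:: 51495;104504;
    610027]);(35417,[::]);(34313,[:: 323845]);(32013,[:: 940423]);(28386,[::]);
    (27275,[:: 653586]);(20246,[:: 906772]);(13072,[::]);(10153,[:: 855455])]);
  (947, 95, 2, [:: (3,472675,[:: 279302;316249;349396]);(770,562704,[:: 241000]);
    (51,516000,[:: 62000;222000;433000;512000;537000;698028;720000;902000]);
    (742,576539,[::]);(672,611475,[:: 137000;219000]);(606,644293,[:: 79188;500214]);
    (849,49810,[:: 612000]);(36,929012,[:: 204000;332000;573000]);(520,866000,[:: 21000]);
    (0,1000,[:: 133;9000;130000;268000;679000;817000;938000])], [:: (300140,[::]);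
    (267060,[:: 515267]);(210271,[::]);(204212,[::]);(187049,[:: 22287;118647;400152]);
    (167003,[::]);(165086,[:: 399472;860796]);(165032,[::]);(153364,[::]);(149018,[::]);
    (144085,[::]);(143334,[:: 596418;858198]);(133205,[:: 542515]);(131296,[:: 215163;
    359939]);(118253,[:: 178281]);(114072,[::]);(113123,[:: 192857]);(103327,[:: 149944;
    238637;658276]);(99118,[:: 396099;620457]);(86023,[::]);(77460,[:: 180191;873608]);
    (77330,[:: 202432;406000;884773]);(72169,[:: 933448]);(71144,[:: 804095]);
    (68290,[:: 596753]);(68019,[:: 477134]);(64204,[:: 3779]);(48229,[:: 33229;877758]);
    (44093,[::]);(36119,[::]);(34233,[:: 620754;692192]);(33042,[::]);(32133,[:: 13717]);
    (21044,[:: 884815]);(7099,[::])]);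
  (953, 109, 3, [:: (3,475221,[:: 238145;474000;952000]);(908,499717,[:: 478000;496092;
    505000;738000]);(816,545716,[:: 111000;150000]);(748,579447,[:: 149000;888421]);
    (281,336197,[:: 309000]);(588,659724,[:: 587000;829156]);(383,285803,[:: 218000]);
    (548,679357,[:: 635381;726000;741000]);(451,251338,[:: 439187;875000]);
    (453,250493,[:: 585000]);(474,716261,[:: 166326;366000;862000]);(246,830014,[:: 27000;
    295470]);(170,868829,[::]);(86,910132,[:: 13000;168000]);(929,12249,[:: 26000;371000]);
    (941,6949,[:: 199000;317000])], [:: (340387,[:: 520579;556795;620365]);(296025,[::]);
    (294259,[:: 910058]);(276282,[:: 267641]);(265476,[::]);(256131,[::]);(192431,[::]);
    (180255,[::]);(171264,[::]);(169195,[::]);(159013,[:: 222323]);(148215,[::]);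
    (143396,[:: 206304;449947;910003]);(140373,[::]);(138250,[:: 126532;127653]);
    (137207,[:: 719870]);(133383,[:: 442350;875592]);(118247,[:: 640886;787106]);
    (118032,[:: 358884]);(116419,[::]);(114335,[:: 297603;800020]);(111448,[::]);
    (106025,[:: 208118;343909;400419]);(86455,[:: 11343;511101;796210]);(61099,[:: 641453;
    945219]);(59234,[:: 286652;853558]);(46343,[:: 394681;465848]);(45243,[:: 7944;
    574223]);(29370,[:: 57726;527892]);(21457,[::]);(21369,[::]);(5121,[:: 311297])]);
  (971, 122, 6, [:: (3,484198,[:: 8000;83048;222149;480160;663101;970000]);
    (103,434243,[:: 115000;314000;451469]);(105,433851,[:: 248000;402000;441000;795474]);
    (822,560339,[:: 749000;821000]);(814,564896,[:: 419115]);(299,336715,[:: 331000;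
    528000]);(321,325691,[:: 891000]);(624,659226,[::]);(371,300668,[:: 254000]);
    (473,249602,[:: 445000]);(388,777752,[:: 20000;384285;481387]);(530,259000,[:: 219000;
    805000;907000]);(242,166000,[:: 290000;652000;813000]);(320,811437,[::]);
    (665,153191,[:: 302460]);(220,598000,[:: 48000;120000;711000;856000]);
    (298,822403,[:: 228000]);(94,143000,[:: 492000;736000;759000]);(186,878825,[:: 458314;
    684130;742000]);(33,88000,[:: 41000;95000;352000;413000]);(142,900248,[::]);
    (841,65848,[:: 45000]);(76,933263,[:: 4318;436152]);(60,941318,[:: 82000;337000]);
    (36,953755,[:: 60320]);(213,746000,[:: 23000;52000;758000]);(953,9599,[::]);
    (209,872000,[:: 707000]);(963,4002,[:: 109000;203000;690282;749000]);
    (0,1000,[:: 328000;374000;383000;588000;597000;643000])], [:: (391459,[:: 345713]);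
    (299158,[:: 315073]);(292004,[:: 918332]);(229060,[::]);(225226,[::]);
    (142117,[:: 135355;182657;875088]);(141359,[::]);(141078,[:: 55835]);
    (122045,[:: 725926]);(121449,[:: 79000;208123]);(114154,[:: 445458]);(110396,[::]);
    (107208,[:: 402258;828025;872526]);(97303,[:: 920960]);(93079,[::]);
    (88150,[:: 914531]);(84059,[:: 309113]);(76127,[:: 828369]);(75415,[:: 625077]);
    (75309,[:: 325270;402258]);(68385,[::]);(54197,[:: 461267]);(53063,[:: 143198]);
    (45273,[::]);(41119,[::]);(24177,[:: 356828;834745])]);
  (977, 120, 3, [:: (3,487851,[::]);(828,563163,[:: 155000;316097]);(794,580374,[:: 179000]);
    (668,643333,[:: 412000;465000;642186]);(632,661145,[:: 242000;606362;885000]);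
    (478,738920,[:: 201000;421000]);(643,167017,[:: 179000;881000]);(757,110293,[:: 674000;
    744000]);(192,881256,[:: 62000;138000;489000;654000;694000]);(965,6004,[:: 325000])],
    [:: (401164,[::]);(322255,[:: 145408;299676;818419]);(293076,[::]);(278091,[::]);
    (242416,[:: 869611]);(214161,[:: 500797]);(205178,[:: 74137;146127;395693;654830]);
    (196209,[::]);(172471,[:: 617232]);(141001,[::]);(132136,[:: 411301]);
    (122150,[:: 305097]);(118057,[:: 111726;136034;283963]);(112448,[:: 434243;604194;
    868295]);(108124,[:: 470720;489923]);(77125,[:: 66080]);(76194,[::]);(75109,[:: 462376;
    585899]);(68405,[:: 57265]);(60264,[:: 444825;737831]);(60030,[:: 6631;286441]);
    (52214,[:: 542077]);(50389,[:: 183626]);(42280,[:: 558144]);(40136,[:: 952493]);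
    (34459,[:: 289925;362942;712350;730061]);(33459,[:: 558006;866609;898208]);
    (30344,[:: 358036;889544]);(30061,[:: 903256]);(29228,[:: 738495]);(23351,[:: 625195;
    658525]);(22080,[:: 295381]);(21258,[::]);(5470,[:: 440196]);(3382,[:: 389711]);
    (2200,[::])]);
  (983, 115, 5, [:: (3,490007,[::]);(36,480000,[::]);(112,464000,[:: 69000;588000;766000]);
    (98,359000,[:: 140000;307000;672000;813000;939000]);(319,332819,[:: 157000;353000]);
    (600,683905,[::]);(469,257575,[::]);(512,727698,[:: 656000]);(434,766022,[:: 408000]);
    (46,613000,[:: 89000;400000;640000]);(368,799434,[:: 907000]);(296,835522,[::]);
    (248,859895,[:: 611000]);(246,114000,[:: 25000]);(556,536000,[:: 51374;200000;498000;
    662000;698000;814000;970000]);(8,896000,[:: 160000;320000;514000;734000]);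
    (150,908657,[:: 627000;785000]);(193,903000,[:: 91000;473000;531000]);
    (93,67000,[:: 2000;341000;352045;786000;889000]);(895,44468,[:: 458000;619000]);
    (903,40501,[::]);(458,556000,[:: 19000;393044;602000;672000]);(56,955440,[:: 602358;
    631039]);(118,851000,[:: 430000;580000;597000]);(96,970000,[:: 92000;237000;719000]);
    (133,859000,[:: 159000;661072]);(0,1000,[:: 71000;108000;875000;912000])],
    [:: (382471,[:: 81762]);(270164,[:: 381657]);(261133,[:: 450756;806419]);(248274,[::]);
    (247448,[:: 959936]);(231400,[:: 327000]);(195340,[::]);(191153,[:: 75038;227061]);
    (157272,[::]);(139434,[::]);(135429,[:: 7904;295022;531783;594587;716180]);
    (128141,[:: 323794]);(123299,[::]);(118261,[:: 268788;671452]);(117413,[:: 822736]);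
    (111254,[::]);(87437,[::]);(85233,[:: 7941;93313]);(83030,[:: 459528;802649]);
    (79110,[::]);(76299,[::]);(53401,[:: 862003]);(50147,[:: 863950]);(49488,[:: 759024]);
    (35180,[::]);(30041,[:: 700451]);(11444,[:: 67121]);(2348,[::])])]%num.

Lemma check_cons c l : check c -> all check l -> all check (c :: l).
Proof. by move=> cc cl; apply/andP. Qed.

(** One conversion per certificate, left to the virtual machine. *)
Lemma certificates_checked : all check certificates.
Proof.
rewrite /certificates.
by repeat (refine (check_cons _ _); [vm_cast_no_check (erefl true) |]).
Qed.

Definition certificate_entry (c : certificate) : nat * nat :=
  let: (pN, count, _, _, _) := c in (N.to_nat pN, N.to_nat count).

(** Trial division up to 31 suffices, because 37^2 exceeds 1000; what remains in the class 2 modulo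
    3 must have a certificate. *)
Lemma certificates_complete :
  all (fun p => [|| has (fun d => (d %| p) && (d != p)) [:: 2; 3; 5; 7; 11; 13; 17; 19; 23; 29; 31],
                    p %% 3 != 2 | has (fun c => (certificate_entry c).1 == p) certificates]%N)
    (iota 17 983).
Proof. by vm_compute. Qed.

(** Positivity of the counts yields the existence of superspecial curves. *)
Lemma certificate_entries :
  all (fun c => (certificate_entry c \in class_numbers) && (0 < (certificate_entry c).2)%N)
    certificates.
Proof. by vm_compute. Qed.

Lemma certificate_exists p : prime p -> (17 <= p < 1000)%N -> (p %% 3 = 2)%N ->
  exists2 c, c \in certificates & (certificate_entry c).1 = p.
Proof.
move=> p_pr p_range p2.
have := allP certificates_complete p; rewrite mem_iota p2 => /(_ p_range).
case/orP=> [/hasP[d d_small /andP[d_dvd d_neq]]|/hasP[c c_in /eqP <-]]; last by exists c.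
have /orP[/eqP d1|/eqP dE] := (primeP p_pr).2 d d_dvd; first by rewrite d1 in d_small.
by rewrite dE eqxx in d_neq.
Qed.

Theorem theorem2 (p : nat) (p_pr : prime p) (p_range : (17 <= p < 1000)%N)
    (F : finFieldType) (cardF : #|F| = (p ^ 2)%N)
    (K : closedFieldType) (iota : {rmorphism F -> K})
    (K_algebraic : integralRange iota) :
  [/\ (p %% 3 = 1)%N -> num_iso_classes p iota = 0%N,
      (p %% 3 = 2)%N -> (p, num_iso_classes p iota) \in class_numbers,
      (p %% 3 = 2)%N -> exists a b : F, superspecial_hyperelliptic p iota (a, b)
    & (p %% 3 = 1)%N ->
      ~ exists a b : F, superspecial_hyperelliptic p iota (a, b)].
Proof.
have p_gt4 : (4 < p)%N by case/andP: p_range => /(leq_trans _) ->.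
have numE := num_iso_classes_params iota p_pr p_gt4 cardF.
have mod1 := superspecial_params_mod1 iota p_pr p_gt4 cardF.
have mod2 : (p %% 3 = 2)%N ->
    (p, num_iso_classes p iota) \in class_numbers /\ (0 < num_iso_classes p iota)%N.
  move=> p2; have [[[[[pN count] g] l1] l2] c_in /= pE] := certificate_exists p_pr p_range p2.
  have p_le : (p <= 1024)%N by case/andP: p_range => _ /ltnW/leq_trans->.
  have checked := allP certificates_checked _ c_in.
  have /andP[] := allP certificate_entries _ c_in.
  by rewrite numE (card_superspecial_params iota p_pr p_gt4 cardF pE p2 p_le checked) /= pE.
split=> [p1|p2|p2|p1 [a [b /asboolP ab_in]]].
- by rewrite numE mod1 ?cards0.
- by have [] := mod2 p2.
- have [_] := mod2 p2; rewrite numE => /card_gt0P[[a b]].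
  by rewrite inE => /asboolP ss; exists a, b.
- by have := in_set0 (a, b); rewrite -(mod1 p1) inE ab_in.
Qed.
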